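(* For every real $t$, \[ Z(t)=2\,\Re\bigl\{e^{i\vartheta(t)}U(t)\bigr\}. \]
   Context: Let $\Omega$ be the complex plane with the two cuts $\{iy: y\ge \tfrac12\}$ and $\{iy: y\le -\tfrac12\}$ removed. $\vartheta$ is the Riemann–Siegel theta function: the holomorphic function on $\Omega$ with $\vartheta(0)=0$ and \[ e^{i\vartheta(t)}=\pi^{-it/2}\sqrt{\frac{\Gamma(\frac14+\frac{it}{2})}{\Gamma(\frac14-\frac{it}{2})}}, \] which for real $t$ equals $\pi^{-it/2}\Gamma(\frac14+\frac{it}2)/|\Gamma(\frac14+\frac{it}2)|$. The function $Z(t)=e^{i\vartheta(t)}\zeta(\frac12+it)$ (real for real $t$), where $\zeta$ is the Riemann zeta function. For real $t$ define \[ U(t)=\frac{1}{2\pi i}\int_{-i\sigma-\infty}^{-i\sigma+\infty} e^{i\vartheta(t+x)-i\vartheta(t)}\,\zeta\bigl(\tfrac12+i(t+x)\bigr)\,\frac{\pi}{2\sinh\frac{\pi x}{2}}\,dx, \] with $0<\sigma<\frac12$ (the integration is along the horizontal line $\Im x=-\sigma$; the value is independent of $\sigma\in(0,\frac12)$). *)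

(* Defs.v *)
From Stdlib Require Import Reals.
From Coquelicot Require Import Coquelicot.
Open Scope R_scope.

Definition cexp (z : C) : C := (exp (Re z) * cos (Im z), exp (Re z) * sin (Im z)).

Definition csinh (z : C) : C := ((cexp z - cexp (- z)) / RtoC 2)%C.

(* Sum of a complex series (real and imaginary parts summed separately;
   equals the sum of the series whenever it converges). *)
Definition CSeries (a : nat -> C) : C :=
  (Series (fun n => Re (a n)), Series (fun n => Im (a n))).

Definition Rcpow (b : R) (z : C) : C := cexp (z * RtoC (ln b))%C.

(* Euler's Gamma integral, valid (and used only) for Re z > 0:
   Gamma(z) = \int_0^oo u^(z-1) e^(-u) du. *)
Definition CGamma (z : C) : C :=
  RInt_gen (V := C_R_CompleteNormedModule)
    (fun u : R => (Rcpow u (z - RtoC 1) * RtoC (exp (- u)))%C)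
    (at_right 0) (Rbar_locally p_infty).

(* Dirichlet eta function eta(s) = sum_{n>=1} (-1)^(n-1) n^(-s), convergent for Re s > 0. *)
Definition eta (s : C) : C :=
  CSeries (fun n : nat => (RtoC ((-1) ^ n) * Rcpow (INR (S n)) (- s))%C).

(* Riemann zeta function for Re s > 0, s <> 1 (away from the zeros of 1 - 2^(1-s)),
   via its standard analytic continuation zeta(s) = eta(s) / (1 - 2^(1-s)).
   It is only used here on the strip 0 < Re s < 1. *)
Definition zeta (s : C) : C := (eta s / (RtoC 1 - Rcpow 2 (RtoC 1 - s)))%C.

(* The horizontal strip |Im z| < 1/2 (a connected subset of Omega containing
   every point where theta is evaluated in the statement). *)
Definition strip (z : C) : Prop := Rabs (Im z) < / 2.

Definition is_RS_theta (th : C -> C) : Prop :=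
  (forall z, strip z -> ex_derive (K := C_AbsRing) (V := C_NormedModule) th z) /\
  th (RtoC 0) = RtoC 0 /\
  (forall z, strip z ->
     (cexp (Ci * th z) * cexp (Ci * th z))%C =
     (Rcpow PI (- (Ci * z)) *
        (CGamma (RtoC (/ 4) + Ci * z / RtoC 2) /
         CGamma (RtoC (/ 4) - Ci * z / RtoC 2)))%C).

Definition U (th : C -> C) (sigma t : R) : C :=
  (/ (RtoC (2 * PI) * Ci) *
   RInt_gen (V := C_R_CompleteNormedModule)
     (fun s : R =>
        let x : C := (s, Ropp sigma) in
        (cexp (Ci * th (RtoC t + x) - Ci * th (RtoC t)) *
         zeta (RtoC (/ 2) + Ci * (RtoC t + x)) *
         (RtoC PI / (RtoC 2 * csinh (RtoC PI * x / RtoC 2))))%C)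
     (Rbar_locally m_infty) (Rbar_locally p_infty))%C.

Definition Zfun (th : C -> C) (t : R) : C :=
  (cexp (Ci * th (RtoC t)) * zeta (RtoC (/ 2) + Ci * RtoC t))%C.

(* Main.v *)
Require Import Defs.
From Stdlib Require Import Reals Lra Lia ZArith ClassicalEpsilon.
From Coquelicot Require Import Coquelicot.
Open Scope R_scope.

(** Write Z(z) = e^(i theta(z)) zeta(1/2 + i z) on the strip |Im z| < 1/2.  The kernel
    pi / (2 sinh(pi x / 2)) has residue 1 at x = 0, so shifting the contour of U from
    Im x = -sigma to Im x = sigma gives Z(t) = A - B, where A = e^(i theta(t)) U(t) and B
    is the same integral along Im x = sigma.  The functional equation says that Z takes
    conjugate values at conjugate points, hence B = - conj A and Z(t) = A + conj A.  It
    also gives Z(z)^2 = zeta(s) zeta(1 - s) with s = 1/2 + i z, so that Z grows at most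
    linearly and the contour shift is legitimate.

    The functional equation is Riemann's.  Poisson summation, proved by summing the residues
    of g(z) / (e^(2 pi i z) - 1), gives Jacobi's identity: for omega(x) the sum of
    e^(-pi n^2 x) over n >= 1, phi(x) = omega(x) - 1 / (2 sqrt x) satisfies
    phi(1/x) = sqrt x phi(x).  In the critical strip the Mellin transform at s / 2 of
    omega(x) - 2 omega(4 x) = phi(x) - 2 phi(4 x), the alternating sum of the e^(-pi n^2 x),
    is pi^(-s/2) Gamma(s/2) eta(s). *)

Ltac Ccomponents := apply injective_projections; unfold Re, Im; simpl.

Lemma Cmod_Cminus_sym (z w : C) : Cmod (z - w)%C = Cmod (w - z)%C.
Proof. rewrite <- Cmod_opp. f_equal. ring. Qed.

Lemma Cmod_Cminus_le (z w : C) : Cmod (z - w)%C <= Cmod z + Cmod w.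
Proof. unfold Cminus. rewrite <- (Cmod_opp w). apply Cmod_triangle. Qed.

Lemma Cmod_Cplus_ge (z w : C) : Cmod z - Cmod w <= Cmod (z + w)%C.
Proof.
  assert (triangle := Cmod_Cminus_le (z + w) w).
  replace (z + w - w)%C with z in triangle by ring. lra.
Qed.

Lemma Cmod_le_Rabs_Re_Im (z : C) : Cmod z <= Rabs (Re z) + Rabs (Im z).
Proof.
  replace z with (RtoC (Re z) + Ci * RtoC (Im z))%C at 1
    by (Ccomponents; ring).
  eapply Rle_trans; [apply Cmod_triangle|].
  rewrite Cmod_mult, Cmod_Ci, !Cmod_R. lra.
Qed.

Lemma Re_Cminus (z w : C) : Re (z - w)%C = Re z - Re w.
Proof. reflexivity. Qed.

Lemma Im_Cminus (z w : C) : Im (z - w)%C = Im z - Im w.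
Proof. reflexivity. Qed.

Lemma Rabs_Im_le_Cmod (z : C) : Rabs (Im z) <= Cmod z.
Proof. eapply Rle_trans; [|apply Rmax_Cmod]. apply Rmax_r. Qed.

Lemma RtoC_neq_0 (x : R) : x <> 0 -> RtoC x <> RtoC 0.
Proof. intros Hx E. now apply RtoC_inj in E. Qed.

Lemma Cconj_RtoC (x : R) : Cconj (RtoC x) = RtoC x.
Proof. Ccomponents; ring. Qed.

Lemma Cinv_0 : (/ RtoC 0)%C = RtoC 0.
Proof. Ccomponents; unfold Rdiv; ring. Qed.

Lemma Cmult_integral (z w : C) : (z * w)%C = RtoC 0 -> z = RtoC 0 \/ w = RtoC 0.
Proof.
  intros zw_eq_0. apply NNPP. intros H. apply (Cmult_neq_0 z w); tauto.
Qed.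

Lemma exp_le (x y : R) : x <= y -> exp x <= exp y.
Proof. intros [Hlt| ->]; [left; now apply exp_increasing|lra]. Qed.

Lemma exp_opp_lt_1 (x : R) : 0 < x -> exp (- x) < 1.
Proof. intros Hx. rewrite <- exp_0. apply exp_increasing. lra. Qed.

Lemma exp_pow (x : R) (n : nat) : exp x ^ n = exp (INR n * x).
Proof.
  induction n as [|n IHn].
  - simpl. now rewrite Rmult_0_l, exp_0.
  - rewrite S_INR. simpl. rewrite IHn, <- exp_plus. f_equal. ring.
Qed.

Lemma Rabs_sqr (x : R) : Rabs x * Rabs x = x * x.
Proof. rewrite <- Rabs_mult. apply Rabs_pos_eq, Rle_0_sqr. Qed.

Lemma sqrt_exp (x : R) : sqrt (exp x) = exp (x / 2).
Proof.
  replace x with (x / 2 + x / 2) at 1 by field.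
  rewrite exp_plus. apply sqrt_square, Rlt_le, exp_pos.
Qed.

Lemma cexp_plus (z w : C) : cexp (z + w)%C = (cexp z * cexp w)%C.
Proof.
  unfold cexp. destruct z as [a b], w as [c d]. simpl.
  rewrite exp_plus, cos_plus, sin_plus. Ccomponents; ring.
Qed.

Lemma cexp_RtoC (x : R) : cexp (RtoC x) = RtoC (exp x).
Proof.
  unfold cexp. simpl. rewrite cos_0, sin_0. Ccomponents; ring.
Qed.

Lemma cexp_0 : cexp (RtoC 0) = RtoC 1.
Proof. now rewrite cexp_RtoC, exp_0. Qed.

Lemma Cmod_cexp (z : C) : Cmod (cexp z) = exp (Re z).
Proof.
  destruct z as [x y].
  replace (cexp (x, y)) with (RtoC (exp x) * (cos y, sin y))%C
    by (Ccomponents; ring).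
  rewrite Cmod_mult, Cmod_R, Rabs_pos_eq by apply Rlt_le, exp_pos.
  replace (Cmod (cos y, sin y)) with 1; [simpl; ring|].
  unfold Cmod. simpl. rewrite !Rmult_1_r, Rplus_comm.
  change (1 = sqrt (Rsqr (sin y) + Rsqr (cos y))). now rewrite sin2_cos2, sqrt_1.
Qed.

Lemma cexp_neq_0 (z : C) : cexp z <> RtoC 0.
Proof. apply Cmod_gt_0. rewrite Cmod_cexp. apply exp_pos. Qed.

Lemma cexp_minus (z w : C) : cexp (z - w)%C = (cexp z / cexp w)%C.
Proof.
  replace (cexp z) with (cexp (z - w) * cexp w)%C
    by (rewrite <- cexp_plus; f_equal; ring).
  field. apply cexp_neq_0.
Qed.

Lemma cexp_opp (z : C) : cexp (- z)%C = (/ cexp z)%C.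
Proof.
  replace (- z)%C with (RtoC 0 - z)%C by ring.
  rewrite cexp_minus, cexp_0. unfold Cdiv. ring.
Qed.

Lemma cexp_conj (z : C) : Cconj (cexp z) = cexp (Cconj z).
Proof.
  unfold cexp, Cconj. simpl. rewrite cos_neg, sin_neg.
  Ccomponents; ring.
Qed.

Lemma cexp_INR_mult (n : nat) (z : C) : cexp (RtoC (INR n) * z)%C = Cpow (cexp z) n.
Proof.
  induction n as [|n IHn].
  - simpl. rewrite <- cexp_0. f_equal. ring.
  - rewrite S_INR, RtoC_plus. simpl. rewrite <- IHn, <- cexp_plus. f_equal. ring.
Qed.

Lemma Cmod_Rcpow (b : R) (z : C) : Cmod (Rcpow b z) = exp (Re z * ln b).
Proof. unfold Rcpow. rewrite Cmod_cexp, re_scal_r. reflexivity. Qed.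

Lemma Rcpow_conj (b : R) (z : C) : Rcpow b (Cconj z) = Cconj (Rcpow b z).
Proof. unfold Rcpow. now rewrite cexp_conj, Cmult_conj, Cconj_RtoC. Qed.

Lemma cos_eq_1_small (x : R) : - PI <= x <= PI -> cos x = 1 -> x = 0.
Proof.
  intros Hx cos_x.
  assert (sin_half : sin (x / 2) = 0).
  { replace x with (2 * (x / 2)) in cos_x by field. rewrite cos_2a_sin in cos_x. nra. }
  destruct (Rtotal_order x 0) as [Hneg|[Hx0|Hpos]]; [exfalso|exact Hx0|exfalso].
  - assert (sin_pos : 0 < sin (- (x / 2))) by (apply sin_gt_0; lra).
    rewrite sin_neg in sin_pos. lra.
  - assert (sin_pos : 0 < sin (x / 2)) by (apply sin_gt_0; lra). lra.
Qed.

Lemma cexp_eq_1_small (z : C) : - PI <= Im z <= PI -> cexp z = RtoC 1 -> z = RtoC 0.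
Proof.
  intros Hz exp_z.
  assert (re_z : Re z = 0).
  { apply exp_inv. now rewrite exp_0, <- Cmod_cexp, exp_z, Cmod_1. }
  assert (cos_z : cos (Im z) = 1).
  { apply (f_equal Re) in exp_z. change (exp (Re z) * cos (Im z) = 1) in exp_z.
    now rewrite re_z, exp_0, Rmult_1_l in exp_z. }
  apply injective_projections; [exact re_z|]. now apply cos_eq_1_small.
Qed.

(** * Continuity and differentiability of complex functions *)

Notation Ccontinuous := (continuous (T := C_UniformSpace) (U := C_UniformSpace)).
Notation is_Cderive := (is_derive (K := C_AbsRing) (V := C_NormedModule)).
Notation ex_Cderive := (ex_derive (K := C_AbsRing) (V := C_NormedModule)).

Lemma locally_Cmod (z : C) (P : C -> Prop) :
  locally (T := C_UniformSpace) z P <->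
  exists d, 0 < d /\ forall w, Cmod (w - z)%C < d -> P w.
Proof.
  rewrite locally_C. split.
  - intros [d Hd]. exists d. split; [apply cond_pos|]. exact Hd.
  - intros [d [d_pos Hd]]. exists (mkposreal d d_pos). exact Hd.
Qed.

Lemma filterlim_Cmult {T : Type} {F : (T -> Prop) -> Prop} {FF : Filter F} (f g : T -> C) (k l : C) :
  filterlim f F (locally (T := C_UniformSpace) k) -> filterlim g F (locally (T := C_UniformSpace) l) ->
  filterlim (fun x => f x * g x)%C F (locally (T := C_UniformSpace) (k * l)%C).
Proof.
  intros Hf Hg.
  apply (filterlim_comp_2 f g Cmult (G := locally (T := AbsRing_UniformSpace C_AbsRing) k)
    (H := locally (T := C_UniformSpace) l)).
  - intros P HP. apply Hf. now apply locally_C.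
  - exact Hg.
  - apply (filterlim_scal (V := C_NormedModule)).
Qed.

Lemma filterlim_Cplus {T : Type} {F : (T -> Prop) -> Prop} {FF : Filter F} (f g : T -> C) (k l : C) :
  filterlim f F (locally (T := C_UniformSpace) k) -> filterlim g F (locally (T := C_UniformSpace) l) ->
  filterlim (fun x => f x + g x)%C F (locally (T := C_UniformSpace) (k + l)%C).
Proof.
  intros Hf Hg. apply (filterlim_comp_2 f g Cplus Hf Hg).
  apply (filterlim_plus (V := C_NormedModule)).
Qed.

Lemma filterlim_Cminus {T : Type} {F : (T -> Prop) -> Prop} {FF : Filter F} (f g : T -> C) (k l : C) :
  filterlim f F (locally (T := C_UniformSpace) k) -> filterlim g F (locally (T := C_UniformSpace) l) ->
  filterlim (fun x => f x - g x)%C F (locally (T := C_UniformSpace) (k - l)%C).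
Proof.
  intros Hf Hg. apply filterlim_Cplus; [exact Hf|].
  exact (filterlim_comp _ _ _ _ _ _ _ _ Hg (filterlim_opp (V := C_NormedModule) l)).
Qed.

Lemma continuous_Cmult {T : UniformSpace} (f g : T -> C) (x : T) :
  continuous (U := C_UniformSpace) f x -> continuous (U := C_UniformSpace) g x ->
  continuous (U := C_UniformSpace) (fun y => f y * g y)%C x.
Proof. apply filterlim_Cmult. Qed.

Lemma continuous_Cminus {T : UniformSpace} (f g : T -> C) (x : T) :
  continuous (U := C_UniformSpace) f x -> continuous (U := C_UniformSpace) g x ->
  continuous (U := C_UniformSpace) (fun y => f y - g y)%C x.
Proof. apply filterlim_Cminus. Qed.

Lemma continuous_RtoC (x : R) : continuous (U := C_UniformSpace) RtoC x.
Proof.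
  apply (continuous_comp_2 (fun y : R => y) (fun _ => 0) (fun a b : R => (a, b) : C_UniformSpace)).
  - apply continuous_id.
  - apply continuous_const.
  - apply (continuous_ext (fun p : R * R => p)); [now intros [a b]|apply continuous_id].
Qed.

Lemma ex_Cderive_continuous (f : C -> C) (z : C) : ex_Cderive f z -> Ccontinuous f z.
Proof.
  intros Hf P HP. apply locally_C.
  exact (ex_derive_continuous (V := C_NormedModule) f z Hf P HP).
Qed.

Lemma is_Cderive_iff (f : C -> C) (z l : C) :
  is_Cderive f z l <->
  forall eps, 0 < eps -> locally (T := C_UniformSpace) z (fun w =>
    Cmod (f w - f z - l * (w - z))%C <= eps * Cmod (w - z)%C).
Proof.
  split.
  - intros [_ dominated] eps eps_pos. apply locally_C.
    generalize (dominated z (fun P HP => HP) (mkposreal eps eps_pos)).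
    apply filter_imp. intros w Hw.
    now rewrite (Cmult_comm l).
  - intros H. split; [apply is_linear_scal_l|].
    intros w Hw. apply (is_filter_lim_locally_unique (V := AbsRing_NormedModule C_AbsRing)) in Hw.
    subst w.
    intros eps. apply locally_C. generalize (H eps (cond_pos eps)).
    apply filter_imp. intros w Hw. now rewrite (Cmult_comm l) in Hw.
Qed.

(* Coquelicot gives [C] two [NormedModule] structures over itself, whose uniform
   structures are equivalent but not convertible. *)
Lemma is_Cderive_AbsRing (f : C -> C) (z l : C) :
  is_Cderive f z l <-> is_derive (V := AbsRing_NormedModule C_AbsRing) f z l.
Proof. split; intros [_ dominated]; (split; [apply is_linear_scal_l|exact dominated]). Qed.

Lemma is_Cderive_id (z : C) : is_Cderive (fun w => w) z (RtoC 1).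
Proof. apply is_Cderive_AbsRing. exact (is_derive_id (K := C_AbsRing) z). Qed.

Lemma is_Cderive_mult (f g : C -> C) (z l m : C) :
  is_Cderive f z l -> is_Cderive g z m ->
  is_Cderive (fun w => f w * g w)%C z (l * g z + f z * m)%C.
Proof.
  intros Hf Hg. apply is_Cderive_AbsRing in Hf.
  apply (filterdiff_ext_lin _ (fun y : AbsRing_NormedModule C_AbsRing => y * l * g z + f z * (y * m))%C).
  - apply (filterdiff_comp'_2 (T := AbsRing_NormedModule C_AbsRing)
      (U := AbsRing_NormedModule C_AbsRing) (V := C_NormedModule) (W := C_NormedModule)
      f g Cmult z _ _ (fun a b => a * g z + f z * b)%C Hf Hg).
    apply (filterdiff_scal (K := C_AbsRing) (V := C_NormedModule) (f z, g z)).
    + intros P HP. exact HP.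
    + apply Cmult_comm.
  - intros y. change (y * l * g z + f z * (y * m) = y * (l * g z + f z * m))%C. ring.
Qed.

Lemma is_Cderive_comp (f g : C -> C) (z l m : C) :
  is_Cderive f z l -> is_Cderive g (f z) m -> is_Cderive (fun w => g (f w)) z (l * m)%C.
Proof. intros Hf Hg. apply is_Cderive_AbsRing in Hf. exact (is_derive_comp g f z m l Hg Hf). Qed.

Notation is_CRInt := (is_RInt (V := C_R_CompleteNormedModule)).
Notation ex_CRInt := (ex_RInt (V := C_R_CompleteNormedModule)).
Notation CRInt := (RInt (V := C_R_CompleteNormedModule)).

Lemma cexp_RtoC_mult (t : R) (z : C) :
  cexp (RtoC t * z)%C = (exp (t * Re z) * cos (t * Im z), exp (t * Re z) * sin (t * Im z)).
Proof. unfold cexp. now rewrite re_scal_l, im_scal_l. Qed.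

Lemma is_derive_cexp_real (z : C) (t : R) :
  is_derive (V := C_R_NormedModule) (fun t : R => cexp (RtoC t * z)%C) t (z * cexp (RtoC t * z))%C.
Proof.
  set (x := Re z). set (y := Im z).
  apply (is_derive_ext (fun t => plus (scal (exp (t * x) * cos (t * y)) (RtoC 1 : C_R_NormedModule))
    (scal (exp (t * x) * sin (t * y)) (Ci : C_R_NormedModule)))).
  { intros u. rewrite cexp_RtoC_mult, !scal_R_Cmult. fold x y.
    unfold plus. Ccomponents; unfold plus; simpl; ring. }
  replace (z * cexp (RtoC t * z))%C with
    (plus (scal (x * exp (t * x) * cos (t * y) - y * exp (t * x) * sin (t * y)) (RtoC 1 : C_R_NormedModule))
      (scal (x * exp (t * x) * sin (t * y) + y * exp (t * x) * cos (t * y)) (Ci : C_R_NormedModule))).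
  - apply (is_derive_plus (V := C_R_NormedModule)); apply (is_derive_scal_l (V := C_R_NormedModule));
      auto_derive; auto; ring.
  - rewrite cexp_RtoC_mult, !scal_R_Cmult. unfold x, y, plus.
    Ccomponents; unfold plus, Re, Im; simpl; ring.
Qed.

Lemma is_CRInt_cexp (z : C) (a b : R) :
  is_CRInt (fun t => z * cexp (RtoC t * z))%C a b (cexp (RtoC b * z) - cexp (RtoC a * z))%C.
Proof.
  apply (is_RInt_derive (V := C_R_CompleteNormedModule) (fun t => cexp (RtoC t * z)%C)); intros t _.
  - apply is_derive_cexp_real.
  - apply continuous_Cmult; [apply continuous_const|].
    apply (ex_derive_continuous (V := C_R_NormedModule)). eexists. apply is_derive_cexp_real.
Qed.

Lemma is_CRInt_minus (f g : R -> C) (a b : R) (l m : C) :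
  is_CRInt f a b l -> is_CRInt g a b m -> is_CRInt (fun t => f t - g t)%C a b (l - m)%C.
Proof. apply (is_RInt_minus (V := C_R_NormedModule)). Qed.

Lemma is_CRInt_const (c : C) (a b : R) : is_CRInt (fun _ => c) a b (RtoC (b - a) * c)%C.
Proof. rewrite <- scal_R_Cmult. apply (is_RInt_const (V := C_R_NormedModule)). Qed.

Lemma Cmod_CRInt_le_const (f : R -> C) (a b M : R) (l : C) : a <= b ->
  (forall t, a <= t <= b -> Cmod (f t) <= M) -> is_CRInt f a b l -> Cmod l <= (b - a) * M.
Proof.
  intros Hab f_le Hl. rewrite Cmod_norm.
  apply (norm_RInt_le_const (V := C_R_NormedModule) f a b); auto.
  intros t Ht. rewrite <- Cmod_norm. auto.
Qed.

Lemma Cmod_cexp_minus_1_le (z : C) : Cmod (cexp z - RtoC 1)%C <= Cmod z * exp (Cmod z).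
Proof.
  assert (integral := is_CRInt_cexp z 0 1).
  replace (RtoC 1 * z)%C with z in integral by ring.
  replace (RtoC 0 * z)%C with (RtoC 0) in integral by ring. rewrite cexp_0 in integral.
  replace (Cmod z * exp (Cmod z)) with ((1 - 0) * (Cmod z * exp (Cmod z))) by ring.
  apply (Cmod_CRInt_le_const _ 0 1 _ _ Rle_0_1) with (2 := integral).
  intros t Ht. rewrite Cmod_mult, Cmod_cexp, re_scal_l.
  apply Rmult_le_compat_l; [apply Cmod_ge_0|]. apply exp_le.
  assert (re_le := re_le_Cmod z). assert (le_abs := Rle_abs (Re z)).
  assert (abs_pos := Rabs_pos (Re z)). nra.
Qed.

Lemma Cmod_cexp_minus_1_id_le (z : C) :
  Cmod (cexp z - RtoC 1 - z)%C <= Cmod z * Cmod z * exp (Cmod z).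
Proof.
  assert (z_pos := Cmod_ge_0 z).
  assert (integral : is_CRInt (fun t => z * cexp (RtoC t * z) - z)%C 0 1 (cexp z - RtoC 1 - z)%C).
  { replace (cexp z - RtoC 1 - z)%C
      with (cexp (RtoC 1 * z) - cexp (RtoC 0 * z) - RtoC (1 - 0) * z)%C.
    - apply is_CRInt_minus; [apply is_CRInt_cexp|apply is_CRInt_const].
    - replace (RtoC 0 * z)%C with (RtoC 0) by ring.
      rewrite cexp_0, Cmult_1_l, RtoC_minus. ring. }
  replace (Cmod z * Cmod z * exp (Cmod z))
    with ((1 - 0) * (Cmod z * (Cmod z * exp (Cmod z)))) by ring.
  apply (Cmod_CRInt_le_const _ 0 1 _ _ Rle_0_1) with (2 := integral).
  intros t Ht.
  replace (z * cexp (RtoC t * z) - z)%C with (z * (cexp (RtoC t * z) - RtoC 1))%C by ring.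
  rewrite Cmod_mult. apply Rmult_le_compat_l; [exact z_pos|].
  eapply Rle_trans; [apply Cmod_cexp_minus_1_le|].
  rewrite Cmod_mult, Cmod_R, Rabs_pos_eq by lra.
  assert (tz_le : t * Cmod z <= Cmod z) by nra.
  apply Rmult_le_compat; [apply Rmult_le_pos; lra|apply Rlt_le, exp_pos|exact tz_le|].
  now apply exp_le.
Qed.

Lemma is_Cderive_cexp (z : C) : is_Cderive cexp z (cexp z).
Proof.
  apply is_Cderive_iff. intros eps eps_pos. apply locally_Cmod.
  assert (exp_z_pos := exp_pos (Re z)). assert (exp_1_pos := exp_pos 1).
  exists (Rmin 1 (eps / (exp (Re z) * exp 1))). split.
  { apply Rmin_pos; [lra|]. apply Rdiv_lt_0_compat; nra. }
  intros w Hw. set (h := (w - z)%C) in *.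
  assert (h_lt_1 := Rlt_le_trans _ _ _ Hw (Rmin_l _ _)).
  assert (h_lt_eps := Rlt_le_trans _ _ _ Hw (Rmin_r _ _)).
  replace (cexp w - cexp z - cexp z * h)%C with (cexp z * (cexp h - RtoC 1 - h))%C.
  2:{ replace w with (h + z)%C by (unfold h; ring). rewrite cexp_plus. ring. }
  rewrite Cmod_mult, Cmod_cexp.
  apply Rle_trans with (exp (Re z) * (Cmod h * Cmod h * exp 1)).
  - apply Rmult_le_compat_l; [lra|].
    eapply Rle_trans; [apply Cmod_cexp_minus_1_id_le|].
    apply Rmult_le_compat_l; [apply Rle_0_sqr|]. apply exp_le. lra.
  - replace (exp (Re z) * (Cmod h * Cmod h * exp 1))
      with (Cmod h * (exp (Re z) * exp 1) * Cmod h) by ring.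
    apply Rmult_le_compat_r; [apply Cmod_ge_0|].
    apply Rle_div_r; [nra|lra].
Qed.

Lemma is_Cderive_Cinv (z : C) : z <> RtoC 0 -> is_Cderive Cinv z (- / (z * z))%C.
Proof.
  intros z_neq_0. apply is_Cderive_iff. intros eps eps_pos. apply locally_Cmod.
  assert (M_pos : 0 < Cmod z) by now apply Cmod_gt_0. set (M := Cmod z) in *.
  exists (Rmin (M / 2) (eps * (M * M * M / 2))). split.
  { apply Rmin_pos; [lra|]. repeat apply Rmult_lt_0_compat; lra. }
  intros w Hw.
  assert (close_half := Rlt_le_trans _ _ _ Hw (Rmin_l _ _)).
  assert (close_eps := Rlt_le_trans _ _ _ Hw (Rmin_r _ _)).
  assert (w_ge : M / 2 <= Cmod w).
  { assert (triangle := Cmod_Cplus_ge z (w - z)). fold M in triangle.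
    replace (z + (w - z))%C with w in triangle by ring. lra. }
  assert (w_neq_0 : w <> RtoC 0) by (apply Cmod_gt_0; lra).
  replace (/ w - / z - - / (z * z) * (w - z))%C with ((w - z) / (z * z * w) * (w - z))%C
    by (field; auto).
  rewrite Cmod_mult. apply Rmult_le_compat_r; [apply Cmod_ge_0|].
  rewrite Cmod_div by (repeat apply Cmult_neq_0; auto).
  rewrite !Cmod_mult. fold M.
  apply Rle_div_l; [repeat apply Rmult_lt_0_compat; lra|].
  apply Rle_trans with (eps * (M * M * M / 2)); [lra|].
  apply Rmult_le_compat_l; [lra|].
  replace (M * M * M / 2) with (M * M * (M / 2)) by field.
  apply Rmult_le_compat_l; [apply Rle_0_sqr|exact w_ge].
Qed.

Lemma ex_Cderive_id (z : C) : ex_Cderive (fun w => w) z.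
Proof. eexists. apply is_Cderive_id. Qed.

Lemma ex_Cderive_const (c z : C) : ex_Cderive (fun _ => c) z.
Proof. apply (ex_derive_const (V := C_NormedModule)). Qed.

Lemma ex_Cderive_plus (f g : C -> C) (z : C) :
  ex_Cderive f z -> ex_Cderive g z -> ex_Cderive (fun w => f w + g w)%C z.
Proof. apply (ex_derive_plus (V := C_NormedModule)). Qed.

Lemma ex_Cderive_minus (f g : C -> C) (z : C) :
  ex_Cderive f z -> ex_Cderive g z -> ex_Cderive (fun w => f w - g w)%C z.
Proof. apply (ex_derive_minus (V := C_NormedModule)). Qed.

Lemma ex_Cderive_opp (f : C -> C) (z : C) : ex_Cderive f z -> ex_Cderive (fun w => - f w)%C z.
Proof. apply (ex_derive_opp (V := C_NormedModule)). Qed.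

Lemma ex_Cderive_mult (f g : C -> C) (z : C) :
  ex_Cderive f z -> ex_Cderive g z -> ex_Cderive (fun w => f w * g w)%C z.
Proof. intros [l Hl] [m Hm]. exists (l * g z + f z * m)%C. now apply is_Cderive_mult. Qed.

Lemma ex_Cderive_comp (f g : C -> C) (z : C) :
  ex_Cderive f z -> ex_Cderive g (f z) -> ex_Cderive (fun w => g (f w)) z.
Proof. intros [l Hl] [m Hm]. exists (l * m)%C. now apply is_Cderive_comp. Qed.

Lemma ex_Cderive_cexp (f : C -> C) (z : C) : ex_Cderive f z -> ex_Cderive (fun w => cexp (f w)) z.
Proof. intros Hf. apply (ex_Cderive_comp f cexp); [exact Hf|]. eexists. apply is_Cderive_cexp. Qed.

Lemma ex_Cderive_div (f g : C -> C) (z : C) :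
  ex_Cderive f z -> ex_Cderive g z -> g z <> RtoC 0 -> ex_Cderive (fun w => f w / g w)%C z.
Proof.
  intros Hf Hg g_neq_0. apply ex_Cderive_mult; [exact Hf|].
  apply (ex_Cderive_comp g Cinv); [exact Hg|]. eexists. now apply is_Cderive_Cinv.
Qed.

Lemma continuous_Cinv (z : C) : z <> RtoC 0 -> Ccontinuous Cinv z.
Proof. intros z_neq_0. apply ex_Cderive_continuous. eexists. now apply is_Cderive_Cinv. Qed.

Lemma continuous_Cdiv {T : UniformSpace} (f g : T -> C) (x : T) :
  continuous (U := C_UniformSpace) f x -> continuous (U := C_UniformSpace) g x ->
  g x <> RtoC 0 -> continuous (U := C_UniformSpace) (fun y => f y / g y)%C x.
Proof.
  intros Hf Hg g_neq_0. apply continuous_Cmult; [exact Hf|].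
  apply (continuous_comp g Cinv); [exact Hg|now apply continuous_Cinv].
Qed.

Lemma is_Cderive_scal (k z : C) : is_Cderive (fun w => k * w)%C z k.
Proof.
  assert (product : is_Cderive (fun w => k * w)%C z (RtoC 0 * z + k * RtoC 1)%C).
  { apply (is_Cderive_mult (fun _ => k) (fun w => w)).
    - apply (is_derive_const (V := C_NormedModule)).
    - apply is_Cderive_id. }
  now replace (RtoC 0 * z + k * RtoC 1)%C with k in product by ring.
Qed.

Lemma is_Cderive_minus_const (k z : C) : is_Cderive (fun w => w - k)%C z (RtoC 1).
Proof.
  rewrite <- (Cplus_0_r (RtoC 1)), <- Copp_0.
  apply (is_derive_minus (V := C_NormedModule) (fun w => w) (fun _ => k)).
  - apply is_Cderive_id.
  - apply (is_derive_const (V := C_NormedModule)).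
Qed.

Lemma is_Cderive_cexp_scal (k z : C) : is_Cderive (fun w => cexp (k * w)%C) z (k * cexp (k * z))%C.
Proof. apply (is_Cderive_comp (fun w => k * w)%C cexp); [apply is_Cderive_scal|apply is_Cderive_cexp]. Qed.

(** * Integrals of complex-valued functions *)

Lemma Riemann_sum_linear {U V : NormedModule R_AbsRing} (L : U -> V) (f : R -> U) (ptd : SF_seq.SF_seq) :
  is_linear L -> Riemann_sum (fun t => L (f t)) ptd = L (Riemann_sum f ptd).
Proof.
  intros HL. apply SF_cons_ind with (s := ptd).
  - intros x. symmetry. apply (linear_zero L HL).
  - intros x s IH. rewrite !Riemann_sum_cons, IH.
    now rewrite (linear_plus L HL), (linear_scal L HL).
Qed.

Lemma is_RInt_linear {U V : NormedModule R_AbsRing} (L : U -> V) (f : R -> U) (a b : R) (l : U) :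
  is_linear L -> is_RInt f a b l -> is_RInt (fun t => L (f t)) a b (L l).
Proof.
  intros HL Hl. unfold is_RInt.
  apply (filterlim_ext (fun ptd => L (scal (sign (b - a)) (Riemann_sum f ptd)))).
  - intros ptd. now rewrite (Riemann_sum_linear L f ptd HL), (linear_scal L HL).
  - exact (filterlim_comp _ _ _ _ L _ _ _ Hl (linear_cont L l HL)).
Qed.

Lemma is_RInt_gen_linear {U V : NormedModule R_AbsRing} (Fa Fb : (R -> Prop) -> Prop)
  {FFa : Filter Fa} {FFb : Filter Fb} (L : U -> V) (f : R -> U) (l : U) :
  is_linear L -> is_RInt_gen f Fa Fb l -> is_RInt_gen (fun t => L (f t)) Fa Fb (L l).
Proof.
  intros HL Hl P HP. generalize (Hl _ (linear_cont L l HL P HP)).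
  unfold filtermapi. apply filter_imp. intros ab [y [Hy Py]].
  exists (L y). split; [now apply is_RInt_linear|exact Py].
Qed.

Lemma is_linear_Cmult (c : C) : is_linear (U := C_R_NormedModule) (V := C_R_NormedModule) (Cmult c).
Proof.
  split.
  - intros z w. apply (Cmult_plus_distr_l c z w).
  - intros k z. rewrite !scal_R_Cmult. change (c * (k * z) = k * (c * z))%C. ring.
  - exists (Cmod c + 1). assert (c_pos := Cmod_ge_0 c). split; [lra|]. intros z.
    rewrite <- !Cmod_norm, Cmod_mult. assert (z_pos := Cmod_ge_0 z). nra.
Qed.

Lemma is_linear_Cconj : is_linear (U := C_R_NormedModule) (V := C_R_NormedModule) Cconj.
Proof.
  split.
  - intros z w. apply (Cplus_conj z w).
  - intros k z. now rewrite !scal_R_Cmult, Cmult_conj, Cconj_RtoC.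
  - exists 1. split; [lra|]. intros z. rewrite <- !Cmod_norm, Cmod_conj. lra.
Qed.

Lemma is_linear_RtoC : is_linear (U := R_NormedModule) (V := C_R_NormedModule) RtoC.
Proof.
  split.
  - intros x y. apply (RtoC_plus x y).
  - intros k x. rewrite scal_R_Cmult. apply (RtoC_mult k x).
  - exists 1. split; [lra|]. intros x. rewrite <- Cmod_norm, Cmod_R. right. symmetry. apply Rmult_1_l.
Qed.

Lemma is_CRInt_Cmult (c : C) (f : R -> C) (a b : R) (l : C) :
  is_CRInt f a b l -> is_CRInt (fun t => c * f t)%C a b (c * l)%C.
Proof. apply (is_RInt_linear (U := C_R_NormedModule) (V := C_R_NormedModule)), is_linear_Cmult. Qed.

Lemma is_CRInt_RtoC (f : R -> R) (a b l : R) :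
  is_RInt f a b l -> is_CRInt (fun t => RtoC (f t)) a b (RtoC l).
Proof. apply (is_RInt_linear (V := C_R_NormedModule)), is_linear_RtoC. Qed.

Lemma is_CRInt_ext (f g : R -> C) (a b : R) (l : C) :
  (forall t, Rmin a b < t < Rmax a b -> f t = g t) -> is_CRInt f a b l -> is_CRInt g a b l.
Proof. apply (is_RInt_ext (V := C_R_NormedModule)). Qed.

Lemma CRInt_correct (f : R -> C) (a b : R) : ex_CRInt f a b -> is_CRInt f a b (CRInt f a b).
Proof. apply (RInt_correct (V := C_R_CompleteNormedModule)). Qed.

Lemma CRInt_unique (f : R -> C) (a b : R) (l : C) : is_CRInt f a b l -> CRInt f a b = l.
Proof. apply (is_RInt_unique (V := C_R_CompleteNormedModule)). Qed.

Lemma CRInt_minus (f g : R -> C) (a b : R) : ex_CRInt f a b -> ex_CRInt g a b ->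
  CRInt (fun t => f t - g t)%C a b = (CRInt f a b - CRInt g a b)%C.
Proof. apply (RInt_minus (V := C_R_CompleteNormedModule)). Qed.

Lemma CRInt_Cmult (c : C) (f : R -> C) (a b : R) : ex_CRInt f a b ->
  CRInt (fun t => c * f t)%C a b = (c * CRInt f a b)%C.
Proof. intros Hf. now apply CRInt_unique, is_CRInt_Cmult, CRInt_correct. Qed.

Lemma CRInt_Chasles (f : R -> C) (a b c : R) : ex_CRInt f a b -> ex_CRInt f b c ->
  (CRInt f a b + CRInt f b c)%C = CRInt f a c.
Proof. apply (RInt_Chasles (V := C_R_CompleteNormedModule)). Qed.

Lemma Cmod_CRInt_le (f : R -> C) (a b M : R) : a <= b -> ex_CRInt f a b ->
  (forall t, a <= t <= b -> Cmod (f t) <= M) -> Cmod (CRInt f a b) <= (b - a) * M.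
Proof. intros Hab Hf f_le. apply (Cmod_CRInt_le_const f a b); auto. now apply CRInt_correct. Qed.

Lemma continuous_horizontal (f : C -> C) (x y : R) : Ccontinuous f (x, y) ->
  continuous (U := C_UniformSpace) (fun s : R => f (s, y)) x.
Proof.
  intros Hf. apply (continuous_comp_2 (fun s : R => s) (fun _ => y) (fun s u : R => f (s, u))).
  - apply continuous_id.
  - apply continuous_const.
  - revert Hf. apply continuous_ext. now intros [s u].
Qed.

Lemma continuous_vertical (f : C -> C) (x y : R) : Ccontinuous f (x, y) ->
  continuous (U := C_UniformSpace) (fun s : R => f (x, s)) y.
Proof.
  intros Hf. apply (continuous_comp_2 (fun _ => x) (fun s : R => s) (fun u s : R => f (u, s))).
  - apply continuous_const.
  - apply continuous_id.
  - revert Hf. apply continuous_ext. now intros [s u].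
Qed.

Lemma ex_CRInt_continuous (f : R -> C) (a b : R) : a <= b ->
  (forall t, a <= t <= b -> continuous (U := C_UniformSpace) f t) -> ex_CRInt f a b.
Proof.
  intros Hab Hf. apply (ex_RInt_continuous (V := C_R_CompleteNormedModule)).
  rewrite Rmin_left, Rmax_right by exact Hab. exact Hf.
Qed.

Lemma Cmod_bounded_segment (f : R -> C) (a b : R) :
  (forall t, a <= t <= b -> continuous (U := C_UniformSpace) f t) ->
  exists M, 0 < M /\ forall t, a <= t <= b -> Cmod (f t) <= M.
Proof.
  intros Hf. destruct (bounded_continuity (V := C_R_NormedModule) f a b Hf) as [M HM].
  exists (Rmax M 1). split; [eapply Rlt_le_trans; [|apply Rmax_r]; lra|].
  intros t Ht. specialize (HM t Ht). rewrite <- Cmod_norm in HM.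
  eapply Rle_trans; [|apply Rmax_l]. lra.
Qed.

(** * Cauchy's theorem on rectangles *)

Definition rectangle (a b c d : R) (z : C) : Prop := a <= Re z <= b /\ c <= Im z <= d.

Definition rectangle_boundary (a b c d : R) (z : C) : Prop :=
  rectangle a b c d z /\ (Re z = a \/ Re z = b \/ Im z = c \/ Im z = d).

Definition rect_int (f : C -> C) (a b c d : R) : C :=
  (CRInt (fun s : R => f (s, c)) a b - CRInt (fun s : R => f (s, d)) a b
   + Ci * (CRInt (fun s : R => f (b, s)) c d - CRInt (fun s : R => f (a, s)) c d))%C.

Lemma ex_CRInt_horizontal (f : C -> C) (a b y : R) : a <= b ->
  (forall x, a <= x <= b -> Ccontinuous f (x, y)) -> ex_CRInt (fun s : R => f (s, y)) a b.
Proof. intros Hab Hf. apply ex_CRInt_continuous; auto using continuous_horizontal. Qed.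

Lemma ex_CRInt_vertical (f : C -> C) (c d x : R) : c <= d ->
  (forall y, c <= y <= d -> Ccontinuous f (x, y)) -> ex_CRInt (fun s : R => f (x, s)) c d.
Proof. intros Hcd Hf. apply ex_CRInt_continuous; auto using continuous_vertical. Qed.

Section RectInt.

Variables (f : C -> C) (a b c d : R).
Hypothesis (Hab : a <= b) (Hcd : c <= d).
Hypothesis f_continuous : forall z, rectangle_boundary a b c d z -> Ccontinuous f z.

Lemma ex_CRInt_sides :
  ex_CRInt (fun s : R => f (s, c)) a b /\ ex_CRInt (fun s : R => f (s, d)) a b /\
  ex_CRInt (fun s : R => f (b, s)) c d /\ ex_CRInt (fun s : R => f (a, s)) c d.
Proof.
  refine (conj _ (conj _ (conj _ _))); [apply (ex_CRInt_horizontal f a b c Hab)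
    |apply (ex_CRInt_horizontal f a b d Hab)|apply (ex_CRInt_vertical f c d b Hcd)
    |apply (ex_CRInt_vertical f c d a Hcd)];
    intros t Ht; apply f_continuous; (split; [split; simpl; lra|simpl; auto]).
Qed.

Lemma Cmod_rect_int_le (M : R) : (forall z, rectangle_boundary a b c d z -> Cmod (f z) <= M) ->
  Cmod (rect_int f a b c d) <= 2 * ((b - a) + (d - c)) * M.
Proof.
  intros f_le. destruct ex_CRInt_sides as (bottom & top & right & left).
  apply Cmod_CRInt_le with (M := M) in bottom, top, right, left; auto;
    try (intros t Ht; apply f_le; split; [split; simpl; lra|simpl; auto]).
  unfold rect_int. eapply Rle_trans; [apply Cmod_triangle|].
  rewrite Cmod_mult, Cmod_Ci, Rmult_1_l.
  eapply Rle_trans; [apply Rplus_le_compat; apply Cmod_Cminus_le|]. lra.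
Qed.

Lemma rect_int_Cmult (k : C) : rect_int (fun z => k * f z)%C a b c d = (k * rect_int f a b c d)%C.
Proof.
  destruct ex_CRInt_sides as (bottom & top & right & left). unfold rect_int.
  rewrite (CRInt_Cmult k (fun s : R => f (s, c))), (CRInt_Cmult k (fun s : R => f (s, d))),
    (CRInt_Cmult k (fun s : R => f (b, s))), (CRInt_Cmult k (fun s : R => f (a, s))) by auto.
  ring.
Qed.

End RectInt.

Lemma rect_int_minus (f g : C -> C) (a b c d : R) : a <= b -> c <= d ->
  (forall z, rectangle_boundary a b c d z -> Ccontinuous f z) ->
  (forall z, rectangle_boundary a b c d z -> Ccontinuous g z) ->
  rect_int (fun z => f z - g z)%C a b c d = (rect_int f a b c d - rect_int g a b c d)%C.
Proof.
  intros Hab Hcd Hf Hg.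
  destruct (ex_CRInt_sides f a b c d) as (fbottom & ftop & fright & fleft); auto.
  destruct (ex_CRInt_sides g a b c d) as (gbottom & gtop & gright & gleft); auto.
  unfold rect_int.
  rewrite (CRInt_minus (fun s : R => f (s, c)) (fun s : R => g (s, c))),
    (CRInt_minus (fun s : R => f (s, d)) (fun s : R => g (s, d))),
    (CRInt_minus (fun s : R => f (b, s)) (fun s : R => g (b, s))),
    (CRInt_minus (fun s : R => f (a, s)) (fun s : R => g (a, s))) by auto.
  ring.
Qed.

Lemma rect_int_split_x (f : C -> C) (a m b c d : R) : a <= m <= b ->
  (forall x, a <= x <= b -> Ccontinuous f (x, c)) ->
  (forall x, a <= x <= b -> Ccontinuous f (x, d)) ->
  rect_int f a b c d = (rect_int f a m c d + rect_int f m b c d)%C.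
Proof.
  intros Hm Hc Hd. unfold rect_int.
  rewrite <- (CRInt_Chasles (fun s : R => f (s, c)) a m b)
    by (apply ex_CRInt_horizontal; [lra|intros; apply Hc; lra]).
  rewrite <- (CRInt_Chasles (fun s : R => f (s, d)) a m b)
    by (apply ex_CRInt_horizontal; [lra|intros; apply Hd; lra]).
  ring.
Qed.

Lemma rect_int_split_y (f : C -> C) (a b c m d : R) : c <= m <= d ->
  (forall y, c <= y <= d -> Ccontinuous f (a, y)) ->
  (forall y, c <= y <= d -> Ccontinuous f (b, y)) ->
  rect_int f a b c d = (rect_int f a b c m + rect_int f a b m d)%C.
Proof.
  intros Hm Ha Hb. unfold rect_int.
  rewrite <- (CRInt_Chasles (fun s : R => f (a, s)) c m d)
    by (apply ex_CRInt_vertical; [lra|intros; apply Ha; lra]).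
  rewrite <- (CRInt_Chasles (fun s : R => f (b, s)) c m d)
    by (apply ex_CRInt_vertical; [lra|intros; apply Hb; lra]).
  ring.
Qed.

Lemma rect_int_opposite_sides (f : C -> C) (a b c d : R) : a <= b -> c <= d ->
  (forall z, rectangle_boundary a b c d z -> Ccontinuous f z) ->
  rect_int f a b c d = (CRInt (fun s : R => f (s, c) - f (s, d))%C a b
    + Ci * CRInt (fun s : R => f (b, s) - f (a, s))%C c d)%C.
Proof.
  intros Hab Hcd Hf. destruct (ex_CRInt_sides f a b c d) as (bottom & top & right & left); auto.
  unfold rect_int.
  rewrite (CRInt_minus (fun s : R => f (s, c)) (fun s : R => f (s, d))),
    (CRInt_minus (fun s : R => f (b, s)) (fun s : R => f (a, s))) by auto.
  ring.
Qed.

Lemma continuous_affine (k l z : C) : Ccontinuous (fun z => k + l * z)%C z.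
Proof.
  apply ex_Cderive_continuous, ex_Cderive_plus; [apply ex_Cderive_const|].
  eexists. apply is_Cderive_scal.
Qed.

Lemma rect_int_affine (k l : C) (a b c d : R) : a <= b -> c <= d ->
  rect_int (fun z => k + l * z)%C a b c d = RtoC 0.
Proof.
  intros Hab Hcd.
  rewrite rect_int_opposite_sides by (auto; intros; apply continuous_affine).
  rewrite (CRInt_unique _ a b (RtoC (b - a) * (l * Ci * RtoC (c - d)))%C).
  - rewrite (CRInt_unique _ c d (RtoC (d - c) * (l * RtoC (b - a)))%C).
    + rewrite !RtoC_minus. ring.
    + apply is_CRInt_ext with (2 := is_CRInt_const _ c d).
      intros s _. Ccomponents; ring.
  - apply is_CRInt_ext with (2 := is_CRInt_const _ a b).
    intros s _. Ccomponents; ring.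
Qed.

Definition left_half (I : R * R) : R * R := (fst I, (fst I + snd I) / 2).
Definition right_half (I : R * R) : R * R := ((fst I + snd I) / 2, snd I).

Lemma successive_halves_converge (I : nat -> R * R) :
  fst (I O) <= snd (I O) ->
  (forall n, I (S n) = left_half (I n) \/ I (S n) = right_half (I n)) ->
  exists x, (forall n, fst (I n) <= x <= snd (I n)) /\
    is_lim_seq (fun n => snd (I n) - fst (I n)) 0.
Proof.
  intros nonempty halves. set (w := snd (I O) - fst (I O)).
  assert (width : forall n, snd (I n) - fst (I n) = w * (/ 2) ^ n).
  { induction n as [|n IHn]; [unfold w; simpl; ring|].
    simpl. destruct (halves n) as [-> | ->]; simpl; lra. }
  assert (half_pow_pos : forall n, 0 < (/ 2) ^ n) by (intros n; apply pow_lt; lra).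
  assert (ordered : forall n, fst (I n) <= snd (I n)).
  { intros n. specialize (width n). specialize (half_pow_pos n). unfold w in width. nra. }
  assert (lower_incr : forall n, fst (I n) <= fst (I (S n))).
  { intros n. specialize (ordered n). destruct (halves n) as [-> | ->]; simpl; lra. }
  assert (upper_decr : forall n, snd (I (S n)) <= snd (I n)).
  { intros n. specialize (ordered n). destruct (halves n) as [-> | ->]; simpl; lra. }
  assert (width_lim : is_lim_seq (fun n => snd (I n) - fst (I n)) 0).
  { apply (is_lim_seq_ext (fun n => w * (/ 2) ^ n)); [now intros n; rewrite width|].
    replace (Finite 0) with (Rbar_mult w 0) by (simpl; f_equal; ring).
    apply is_lim_seq_scal_l, is_lim_seq_geom. rewrite Rabs_pos_eq; lra. }
  destruct (ex_lim_seq_adj _ _ lower_incr upper_decr width_lim) as (lower_cv & upper_cv & same).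
  apply Lim_seq_correct' in lower_cv, upper_cv. rewrite same in lower_cv.
  eexists. split; [intros n; split|exact width_lim].
  - exact (is_lim_seq_incr_compare _ _ lower_cv lower_incr n).
  - exact (is_lim_seq_decr_compare _ _ upper_cv upper_decr n).
Qed.

Definition on_box (P : R -> R -> R -> R -> Prop) (B : (R * R) * (R * R)) : Prop :=
  P (fst (fst B)) (snd (fst B)) (fst (snd B)) (snd (snd B)).

Definition some_bad_quarter (P : R -> R -> R -> R -> Prop) (B : (R * R) * (R * R)) :
  (R * R) * (R * R) :=
  let (I, J) := B in
  if excluded_middle_informative (on_box P (left_half I, left_half J)) then
  if excluded_middle_informative (on_box P (left_half I, right_half J)) then
  if excluded_middle_informative (on_box P (right_half I, left_half J)) then
    (right_half I, right_half J)
  else (right_half I, left_half J)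
  else (left_half I, right_half J)
  else (left_half I, left_half J).

Lemma rectangle_bisection (P : R -> R -> R -> R -> Prop) (a b c d : R) : a <= b -> c <= d ->
  (forall I J, on_box P (left_half I, left_half J) -> on_box P (left_half I, right_half J) ->
    on_box P (right_half I, left_half J) -> on_box P (right_half I, right_half J) ->
    on_box P (I, J)) ->
  (forall x y, a <= x <= b -> c <= y <= d -> exists r, 0 < r /\
    forall a' b' c' d', a' <= x <= b' -> c' <= y <= d' -> b' - a' < r -> d' - c' < r ->
      P a' b' c' d') ->
  P a b c d.
Proof.
  intros Hab Hcd from_quarters locally_P. apply NNPP. intros bad.
  set (B := fix B n := match n with O => ((a, b), (c, d)) | S m => some_bad_quarter P (B m) end).
  assert (all_bad : forall n, ~ on_box P (B n)).
  { induction n as [|n IHn]; [exact bad|]. simpl. destruct (B n) as [I J]. unfold some_bad_quarter.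
    repeat destruct excluded_middle_informative; auto. }
  assert (halves : forall n,
    (fst (B (S n)) = left_half (fst (B n)) \/ fst (B (S n)) = right_half (fst (B n))) /\
    (snd (B (S n)) = left_half (snd (B n)) \/ snd (B (S n)) = right_half (snd (B n)))).
  { intros n. simpl. destruct (B n) as [I J]. unfold some_bad_quarter.
    repeat destruct excluded_middle_informative; simpl; auto. }
  destruct (successive_halves_converge (fun n => fst (B n)) Hab (fun n => proj1 (halves n)))
    as (x & Hx & width_lim).
  destruct (successive_halves_converge (fun n => snd (B n)) Hcd (fun n => proj2 (halves n)))
    as (y & Hy & height_lim).
  destruct (locally_P x y (Hx O) (Hy O)) as (r & r_pos & small_good).
  apply is_lim_seq_spec in width_lim, height_lim.
  destruct (filter_and _ _ (width_lim (mkposreal r r_pos)) (height_lim (mkposreal r r_pos)))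
    as [n small]. destruct (small n (Nat.le_refl n)) as [width_small height_small].
  rewrite Rminus_0_r in width_small, height_small. simpl in width_small, height_small.
  assert (width_le := Rle_abs (snd (fst (B n)) - fst (fst (B n)))).
  assert (height_le := Rle_abs (snd (snd (B n)) - fst (snd (B n)))).
  apply (all_bad n), small_good; auto; lra.
Qed.

Section Goursat.

Variables (f : C -> C) (a b c d : R).
Hypothesis f_holo : forall z, rectangle a b c d z -> ex_Cderive f z.

Let subrectangle (a' b' c' d' : R) : Prop := a <= a' <= b' /\ b' <= b /\ c <= c' <= d' /\ d' <= d.

Lemma Goursat_continuous (x y : R) : a <= x <= b -> c <= y <= d -> Ccontinuous f (x, y).
Proof. intros Hx Hy. apply ex_Cderive_continuous, f_holo. now split. Qed.

Lemma rect_int_quarters (I J : R * R) :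
  subrectangle (fst I) (snd I) (fst J) (snd J) ->
  rect_int f (fst I) (snd I) (fst J) (snd J) =
  let m := (fst I + snd I) / 2 in let n := (fst J + snd J) / 2 in
  (rect_int f (fst I) m (fst J) n + rect_int f (fst I) m n (snd J) +
   (rect_int f m (snd I) (fst J) n + rect_int f m (snd I) n (snd J)))%C.
Proof.
  intros (HI & HIb & HJ & HJd). simpl.
  rewrite (rect_int_split_x f (fst I) ((fst I + snd I) / 2) (snd I))
    by (lra || (intros; apply Goursat_continuous; lra)).
  rewrite !(rect_int_split_y f _ _ (fst J) ((fst J + snd J) / 2) (snd J))
    by (lra || (intros; apply Goursat_continuous; lra)).
  reflexivity.
Qed.

Lemma rect_int_locally_small (x y eps : R) : 0 < eps -> rectangle a b c d (x, y) ->
  exists r, 0 < r /\ forall a' b' c' d', subrectangle a' b' c' d' ->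
    a' <= x <= b' -> c' <= y <= d' -> b' - a' < r -> d' - c' < r ->
    Cmod (rect_int f a' b' c' d') <= eps * Rsqr ((b' - a') + (d' - c')).
Proof.
  intros eps_pos Hxy. destruct (f_holo _ Hxy) as [l Hl].
  destruct (proj1 (locally_Cmod _ _) (proj1 (is_Cderive_iff _ _ _) Hl (eps / 2) ltac:(lra)))
    as (r & r_pos & f_affine).
  exists (r / 2). split; [lra|].
  intros a' b' c' d' (Ha & Hb & Hc & Hd) Hx Hy small_width small_height.
  set (g := fun z : C => (f (x, y) - l * (x, y) + l * z)%C).
  assert (f_cont : forall z, rectangle_boundary a' b' c' d' z -> Ccontinuous f z).
  { intros [u v] [[Hu Hv] _]. simpl in Hu, Hv. apply Goursat_continuous; lra. }
  replace (rect_int f a' b' c' d') with (rect_int (fun z => f z - g z)%C a' b' c' d').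
  2:{ rewrite rect_int_minus by (lra || auto; intros; apply continuous_affine).
      unfold g. rewrite rect_int_affine by lra. ring. }
  replace (eps * Rsqr ((b' - a') + (d' - c')))
    with (2 * ((b' - a') + (d' - c')) * (eps / 2 * ((b' - a') + (d' - c'))))
    by (unfold Rsqr; field).
  apply Cmod_rect_int_le; try lra.
  { intros z Hz. apply continuous_Cminus; [auto|apply continuous_affine]. }
  intros [u v] [[Hu Hv] _]. simpl in Hu, Hv. unfold g.
  replace (f (u, v) - (f (x, y) - l * (x, y) + l * (u, v)))%C
    with (f (u, v) - f (x, y) - l * ((u, v) - (x, y)))%C by ring.
  assert (dist_le : Cmod ((u, v) - (x, y))%C <= (b' - a') + (d' - c')).
  { eapply Rle_trans; [apply Cmod_le_Rabs_Re_Im|]. simpl.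
    apply Rplus_le_compat; apply Rabs_le; lra. }
  eapply Rle_trans; [apply f_affine; lra|]. apply Rmult_le_compat_l; lra.
Qed.

Lemma Goursat : a <= b -> c <= d -> rect_int f a b c d = RtoC 0.
Proof.
  intros Hab Hcd. apply Cmod_eq_0, Rle_antisym; [|apply Cmod_ge_0].
  set (perimeter := Rsqr ((b - a) + (d - c)) + 1).
  assert (perimeter_pos : 0 < perimeter) by apply Rle_lt_0_plus_1, Rle_0_sqr.
  apply le_epsilon. intros eps eps_pos. rewrite Rplus_0_l.
  apply Rle_trans with (eps / perimeter * Rsqr ((b - a) + (d - c))).
  2:{ apply Rle_trans with (eps / perimeter * perimeter).
      - apply Rmult_le_compat_l; [apply Rlt_le, Rdiv_lt_0_compat; lra|unfold perimeter; lra].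
      - right. field. lra. }
  assert (eps'_pos : 0 < eps / perimeter) by now apply Rdiv_lt_0_compat.
  apply (rectangle_bisection (fun a' b' c' d' => subrectangle a' b' c' d' ->
    Cmod (rect_int f a' b' c' d') <= eps / perimeter * Rsqr ((b' - a') + (d' - c'))) a b c d Hab Hcd).
  - intros I J left_lower left_upper right_lower right_upper HIJ. unfold on_box in *. simpl in *.
    rewrite (rect_int_quarters I J HIJ). cbv zeta. unfold subrectangle in *.
    specialize (left_lower ltac:(lra)). specialize (left_upper ltac:(lra)).
    specialize (right_lower ltac:(lra)). specialize (right_upper ltac:(lra)).
    eapply Rle_trans; [apply Cmod_triangle|].
    eapply Rle_trans; [apply Rplus_le_compat; apply Cmod_triangle|].
    unfold Rsqr in *. lra.
  - intros x y Hx Hy.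
    destruct (rect_int_locally_small x y (eps / perimeter) eps'_pos (conj Hx Hy)) as (r & r_pos & small).
    exists r. split; auto.
  - unfold subrectangle. lra.
Qed.

End Goursat.

(** * Residues *)

Lemma rect_int_ext (f g : C -> C) (a b c d : R) : a <= b -> c <= d ->
  (forall z, rectangle_boundary a b c d z -> f z = g z) -> rect_int f a b c d = rect_int g a b c d.
Proof.
  intros Hab Hcd fg.
  assert (horizontal : forall y, y = c \/ y = d ->
    CRInt (fun s : R => f (s, y)) a b = CRInt (fun s : R => g (s, y)) a b).
  { intros y Hy. apply (RInt_ext (V := C_R_CompleteNormedModule)).
    rewrite Rmin_left, Rmax_right by auto.
    intros s Hs. apply fg. split; [split; simpl; lra|simpl; tauto]. }
  assert (vertical : forall x, x = a \/ x = b ->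
    CRInt (fun s : R => f (x, s)) c d = CRInt (fun s : R => g (x, s)) c d).
  { intros x Hx. apply (RInt_ext (V := C_R_CompleteNormedModule)).
    rewrite Rmin_left, Rmax_right by auto.
    intros s Hs. apply fg. split; [split; simpl; lra|simpl; tauto]. }
  unfold rect_int. now rewrite !horizontal, !vertical by auto.
Qed.

Lemma rect_int_shrink (f : C -> C) (a a' b' b c c' d' d : R) :
  a <= a' <= b' -> b' <= b -> c <= c' <= d' -> d' <= d ->
  (forall z, rectangle a b c d z -> ~ (a' < Re z < b' /\ c' < Im z < d') -> ex_Cderive f z) ->
  rect_int f a b c d = rect_int f a' b' c' d'.
Proof.
  intros Ha Hb Hc Hd f_holo.
  assert (f_holo' : forall x y, a <= x <= b -> c <= y <= d ->
    x <= a' \/ b' <= x \/ y <= c' \/ d' <= y -> ex_Cderive f (x, y)).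
  { intros x y Hx Hy outside. apply f_holo; [now split|]. simpl. lra. }
  assert (f_cont : forall x y, a <= x <= b -> c <= y <= d ->
    x <= a' \/ b' <= x \/ y <= c' \/ d' <= y -> Ccontinuous f (x, y)).
  { intros. now apply ex_Cderive_continuous, f_holo'. }
  rewrite (rect_int_split_x f a a' b) by (lra || (intros; apply f_cont; lra)).
  rewrite (Goursat f a a') by (lra || (intros [x y] [Hx Hy]; simpl in *; apply f_holo'; lra)).
  rewrite (rect_int_split_x f a' b' b) by (lra || (intros; apply f_cont; lra)).
  rewrite (Goursat f b' b) by (lra || (intros [x y] [Hx Hy]; simpl in *; apply f_holo'; lra)).
  rewrite (rect_int_split_y f a' b' c c' d) by (lra || (intros; apply f_cont; lra)).
  rewrite (Goursat f a' b' c c') by (lra || (intros [x y] [Hx Hy]; simpl in *; apply f_holo'; lra)).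
  rewrite (rect_int_split_y f a' b' c' d' d) by (lra || (intros; apply f_cont; lra)).
  rewrite (Goursat f a' b' d' d) by (lra || (intros [x y] [Hx Hy]; simpl in *; apply f_holo'; lra)).
  ring.
Qed.

Definition square (z0 : C) (r : R) : C -> Prop :=
  rectangle (Re z0 - r) (Re z0 + r) (Im z0 - r) (Im z0 + r).

Definition square_boundary (z0 : C) (r : R) : C -> Prop :=
  rectangle_boundary (Re z0 - r) (Re z0 + r) (Im z0 - r) (Im z0 + r).

Definition square_int (f : C -> C) (z0 : C) (r : R) : C :=
  rect_int f (Re z0 - r) (Re z0 + r) (Im z0 - r) (Im z0 + r).

Lemma square_dist_le (z0 z : C) (r : R) : square z0 r z -> Cmod (z - z0)%C <= 2 * r.
Proof.
  intros [Hx Hy]. eapply Rle_trans; [apply Cmod_le_Rabs_Re_Im|].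
  rewrite Re_Cminus, Im_Cminus.
  replace (2 * r) with (r + r) by ring. apply Rplus_le_compat; apply Rabs_le; lra.
Qed.

Lemma square_boundary_dist_ge (z0 z : C) (r : R) : 0 <= r -> square_boundary z0 r z ->
  r <= Cmod (z - z0)%C.
Proof.
  intros r_pos [_ side].
  assert (re_le := re_le_Cmod (z - z0)%C). assert (im_le := Rabs_Im_le_Cmod (z - z0)%C).
  rewrite Re_Cminus in re_le. rewrite Im_Cminus in im_le.
  destruct side as [E|[E|[E|E]]]; rewrite E in re_le || rewrite E in im_le.
  - rewrite Rabs_left1 in re_le; lra.
  - rewrite Rabs_pos_eq in re_le; lra.
  - rewrite Rabs_left1 in im_le; lra.
  - rewrite Rabs_pos_eq in im_le; lra.
Qed.

Lemma is_RInt_atan_kernel (x0 r : R) : 0 < r ->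
  is_RInt (fun t => 2 * r / (Rsqr (t - x0) + Rsqr r)) (x0 - r) (x0 + r) PI.
Proof.
  intros r_pos. assert (r2_pos : 0 < Rsqr r) by (unfold Rsqr; nra).
  assert (den_neq_0 : forall t, Rsqr (t - x0) + Rsqr r <> 0).
  { intros t. assert (sqr_pos := Rle_0_sqr (t - x0)). lra. }
  replace PI with (minus (2 * atan ((x0 + r - x0) / r)) (2 * atan ((x0 - r - x0) / r))).
  - apply (is_RInt_derive (V := R_CompleteNormedModule) (fun t => 2 * atan ((t - x0) / r)));
      intros t _; specialize (den_neq_0 t); unfold Rsqr in *.
    + auto_derive; [lra|]. field. split; [lra|]. nra.
    + apply (ex_derive_continuous (V := R_NormedModule)). unfold Rsqr. auto_derive. lra.
  - replace ((x0 + r - x0) / r) with 1 by (field; lra).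
    replace ((x0 - r - x0) / r) with (- (1)) by (field; lra).
    rewrite atan_opp, atan_1. unfold minus, plus, opp; simpl. field.
Qed.

Lemma ex_Cderive_recip (z0 z : C) : z <> z0 -> ex_Cderive (fun z => / (z - z0))%C z.
Proof.
  intros Hz. apply (ex_Cderive_comp (fun z => z - z0)%C Cinv).
  - eexists. apply is_Cderive_minus_const.
  - eexists. now apply is_Cderive_Cinv, Cminus_eq_contra.
Qed.

Lemma square_boundary_neq_center (z0 z : C) (r : R) : 0 < r -> square_boundary z0 r z -> z <> z0.
Proof.
  intros r_pos Hz E. assert (far := square_boundary_dist_ge z0 z r (Rlt_le _ _ r_pos) Hz).
  rewrite E in far. replace (z0 - z0)%C with (RtoC 0) in far by ring. rewrite Cmod_0 in far. lra.
Qed.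

Lemma two_pi_i_neq_0 : (RtoC (2 * PI) * Ci)%C <> RtoC 0.
Proof. apply Cmult_neq_0; [apply RtoC_neq_0; assert (PI_pos := PI_RGT_0); lra|exact Ci_nz]. Qed.

Lemma square_int_recip (z0 : C) (r : R) : 0 < r ->
  square_int (fun z => / (z - z0))%C z0 r = (RtoC (2 * PI) * Ci)%C.
Proof.
  intros r_pos. destruct z0 as [x0 y0].
  unfold square_int. rewrite rect_int_opposite_sides; simpl; try lra.
  2:{ intros z Hz. apply ex_Cderive_continuous, ex_Cderive_recip.
      now apply (square_boundary_neq_center (x0, y0) z r). }
  rewrite (CRInt_unique _ (x0 - r) (x0 + r) (Ci * RtoC PI)%C).
  - rewrite (CRInt_unique _ (y0 - r) (y0 + r) (RtoC PI)).
    + replace (2 * PI) with (PI + PI) by ring. rewrite RtoC_plus. ring.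
    + apply is_CRInt_ext with (2 := is_CRInt_RtoC _ _ _ _ (is_RInt_atan_kernel y0 r r_pos)).
      intros t _. assert (sqr_pos := Rle_0_sqr (t - y0)). unfold Rsqr in *.
      Ccomponents; field; repeat split; nra.
  - apply is_CRInt_ext with (2 := is_CRInt_Cmult Ci _ _ _ _
      (is_CRInt_RtoC _ _ _ _ (is_RInt_atan_kernel x0 r r_pos))).
    intros t _. assert (sqr_pos := Rle_0_sqr (t - x0)). unfold Rsqr in *.
    Ccomponents; field; repeat split; nra.
Qed.

Lemma square_int_near_pole (f : C -> C) (z0 A : C) (r eps : R) : 0 < r ->
  (forall z, square_boundary z0 r z -> Ccontinuous f z) ->
  (forall z, square_boundary z0 r z -> Cmod (f z * (z - z0) - A)%C <= eps) ->
  Cmod (square_int f z0 r - RtoC (2 * PI) * Ci * A)%C <= 8 * eps.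
Proof.
  intros r_pos f_cont f_near.
  assert (recip_cont : forall z, square_boundary z0 r z -> Ccontinuous (fun z => / (z - z0))%C z).
  { intros z Hz. apply ex_Cderive_continuous, ex_Cderive_recip.
    now apply (square_boundary_neq_center z0 z r). }
  assert (pole_cont : forall z, square_boundary z0 r z -> Ccontinuous (fun z => A * / (z - z0))%C z).
  { intros z Hz. apply continuous_Cmult; [apply continuous_const|auto]. }
  replace (RtoC (2 * PI) * Ci * A)%C with (square_int (fun z => A * / (z - z0))%C z0 r).
  2:{ unfold square_int. rewrite rect_int_Cmult by (lra || auto).
      fold (square_int (fun z => / (z - z0))%C z0 r). rewrite square_int_recip by auto. ring. }
  unfold square_int. rewrite <- rect_int_minus by (lra || auto).
  replace (8 * eps) with (2 * ((Re z0 + r - (Re z0 - r)) + (Im z0 + r - (Im z0 - r))) * (eps / r))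
    by (field; lra).
  apply Cmod_rect_int_le; try lra.
  - intros z Hz. apply continuous_Cminus; auto.
  - intros z Hz. fold (square_boundary z0 r z) in Hz.
    assert (z_neq := Cminus_eq_contra _ _ (square_boundary_neq_center z0 z r r_pos Hz)).
    assert (far := square_boundary_dist_ge z0 z r (Rlt_le _ _ r_pos) Hz).
    replace (f z - A * / (z - z0))%C with ((f z * (z - z0) - A) / (z - z0))%C by (field; auto).
    rewrite Cmod_div by auto. apply Rmult_le_compat; auto using Cmod_ge_0.
    + apply Rlt_le, Rinv_0_lt_compat. lra.
    + apply Rinv_le_contravar; lra.
Qed.

Lemma rect_int_residue (f : C -> C) (z0 A : C) (a b c d : R) :
  a < Re z0 < b -> c < Im z0 < d ->
  (forall z, rectangle a b c d z -> z <> z0 -> ex_Cderive f z) ->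
  filterlim (fun z => f z * (z - z0))%C (locally' (T := C_UniformSpace) z0)
    (locally (T := C_UniformSpace) A) ->
  rect_int f a b c d = (RtoC (2 * PI) * Ci * A)%C.
Proof.
  intros Hx0 Hy0 f_holo f_lim. apply Ceq_minus, Cmod_eq_0, Rle_antisym; [|apply Cmod_ge_0].
  apply le_epsilon. intros eps eps_pos. rewrite Rplus_0_l.
  assert (near : locally (T := C_UniformSpace) A (fun w => Cmod (w - A)%C <= eps / 8)).
  { apply locally_Cmod. exists (eps / 8). split; [lra|]. intros w Hw. lra. }
  destruct (proj1 (locally_Cmod _ _) (f_lim _ near)) as (r0 & r0_pos & f_near).
  set (margins := (r0 / 3 :: Re z0 - a :: b - Re z0 :: Im z0 - c :: d - Im z0 :: nil)%list).
  set (r := RList.MinRlist margins).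
  assert (r_pos : 0 < r).
  { apply RList.MinRlist_P2. intros y Hy. simpl in Hy. decompose [or] Hy; subst; lra || tauto. }
  assert (r_le : forall y, List.In y margins -> r <= y) by apply RList.MinRlist_P1.
  assert (r_small : r <= r0 / 3) by (apply r_le; simpl; tauto).
  assert (Ha : r <= Re z0 - a) by (apply r_le; simpl; tauto).
  assert (Hb : r <= b - Re z0) by (apply r_le; simpl; tauto).
  assert (Hc : r <= Im z0 - c) by (apply r_le; simpl; tauto).
  assert (Hd : r <= d - Im z0) by (apply r_le; simpl; tauto).
  rewrite (rect_int_shrink f a (Re z0 - r) (Re z0 + r) b c (Im z0 - r) (Im z0 + r) d) by
    (lra || (intros z Hz outside; apply f_holo; [exact Hz|intros ->; lra])).
  replace eps with (8 * (eps / 8)) by field. apply square_int_near_pole; auto.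
  - intros z Hz. apply ex_Cderive_continuous, f_holo.
    + destruct Hz as [[Hx Hy] _]. split; lra.
    + now apply (square_boundary_neq_center z0 z r).
  - intros z Hz. apply f_near.
    + destruct Hz as [Hz _]. apply Rle_lt_trans with (2 * r); [|lra].
      now apply square_dist_le.
    + now apply (square_boundary_neq_center z0 z r).
Qed.

Lemma filterlim_simple_pole (f g : C -> C) (z0 l : C) :
  Ccontinuous f z0 -> is_Cderive g z0 l -> g z0 = RtoC 0 -> l <> RtoC 0 ->
  filterlim (fun z => f z / g z * (z - z0))%C (locally' (T := C_UniformSpace) z0)
    (locally (T := C_UniformSpace) (f z0 / l)%C).
Proof.
  intros f_cont Hg g_z0 l_neq_0.
  assert (slope_lim : filterlim (fun z => g z / (z - z0))%C (locally' (T := C_UniformSpace) z0)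
    (locally (T := C_UniformSpace) l)).
  { intros P HP. apply locally_Cmod in HP. destruct HP as (eps & eps_pos & HP).
    generalize (proj1 (is_Cderive_iff g z0 l) Hg (eps / 2) ltac:(lra)).
    unfold filtermap, locally', within. apply filter_imp. intros z g_affine z_neq. apply HP.
    apply Cminus_eq_contra in z_neq. assert (dist_pos := proj1 (Cmod_gt_0 _) z_neq).
    rewrite g_z0 in g_affine.
    replace (g z / (z - z0) - l)%C with ((g z - RtoC 0 - l * (z - z0)) / (z - z0))%C by (field; auto).
    rewrite Cmod_div by auto. apply Rle_lt_trans with (eps / 2); [|lra].
    now apply Rle_div_l. }
  apply (filterlim_ext_loc (fun z => f z * / (g z / (z - z0)))%C).
  { exists (mkposreal 1 Rlt_0_1). intros z _ z_neq. apply Cminus_eq_contra in z_neq.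
    destruct (classic (g z = RtoC 0)) as [-> |g_neq_0]; [|field; auto].
    unfold Cdiv. rewrite Cmult_0_l, Cinv_0. ring. }
  apply filterlim_Cmult.
  - apply filterlim_filter_le_1 with (2 := f_cont). apply filter_le_within.
  - apply (filterlim_comp _ _ _ _ Cinv _ _ _ slope_lim).
    now apply continuous_Cinv.
Qed.

Lemma rect_int_simple_pole (f g : C -> C) (z0 l : C) (a b c d : R) :
  a < Re z0 < b -> c < Im z0 < d ->
  (forall z, rectangle a b c d z -> ex_Cderive f z) ->
  (forall z, rectangle a b c d z -> ex_Cderive g z) ->
  (forall z, rectangle a b c d z -> z <> z0 -> g z <> RtoC 0) ->
  is_Cderive g z0 l -> g z0 = RtoC 0 -> l <> RtoC 0 ->
  rect_int (fun z => f z / g z)%C a b c d = (RtoC (2 * PI) * Ci * (f z0 / l))%C.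
Proof.
  intros Hx0 Hy0 f_holo g_holo g_neq_0 Hg g_z0 l_neq_0.
  apply rect_int_residue with z0; auto.
  - intros z Hz z_neq. apply ex_Cderive_div; auto.
  - apply filterlim_simple_pole; auto. apply ex_Cderive_continuous, f_holo. split; lra.
Qed.

Lemma Cauchy_formula (f : C -> C) (z0 : C) (a b c d : R) :
  a < Re z0 < b -> c < Im z0 < d -> (forall z, rectangle a b c d z -> ex_Cderive f z) ->
  rect_int (fun z => f z / (z - z0))%C a b c d = (RtoC (2 * PI) * Ci * f z0)%C.
Proof.
  intros Hx0 Hy0 f_holo.
  rewrite (rect_int_simple_pole f (fun z => z - z0)%C z0 (RtoC 1)); auto using Cminus_eq_contra, C1_nz.
  - unfold Cdiv. replace (/ RtoC 1)%C with (RtoC 1); [ring|]. Ccomponents; field.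
  - intros z _. eexists. apply is_Cderive_minus_const.
  - apply is_Cderive_minus_const.
  - ring.
Qed.

(** * Uniform limits of holomorphic functions *)

Lemma continuous_uniform_limit {T : UniformSpace} (fn : nat -> T -> C) (f : T -> C) (x : T) :
  (forall n, continuous (U := C_UniformSpace) (fn n) x) ->
  (forall eps, 0 < eps -> exists n, locally x (fun y => Cmod (fn n y - f y)%C <= eps)) ->
  continuous (U := C_UniformSpace) f x.
Proof.
  intros fn_cont close P HP. apply locally_Cmod in HP. destruct HP as (eps & eps_pos & HP).
  destruct (close (eps / 4) ltac:(lra)) as [n fn_close].
  assert (fn_near : locally (T := C_UniformSpace) (fn n x) (fun w => Cmod (w - fn n x)%C < eps / 4)).
  { apply locally_Cmod. exists (eps / 4). split; [lra|auto]. }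
  assert (fn_close_x := locally_singleton _ _ fn_close). cbv beta in fn_close_x.
  generalize (filter_and _ _ fn_close (fn_cont n _ fn_near)).
  unfold filtermap. apply filter_imp. intros y [close_y near_y]. apply HP.
  replace (f y - f x)%C with ((fn n y - fn n x) - (fn n y - f y) + (fn n x - f x))%C by ring.
  eapply Rle_lt_trans; [apply Cmod_triangle|].
  assert (triangle := Cmod_Cminus_le (fn n y - fn n x)%C (fn n y - f y)%C). lra.
Qed.

Lemma Cmod_bounded_boundary (f : C -> C) (a b c d : R) : a <= b -> c <= d ->
  (forall z, rectangle_boundary a b c d z -> Ccontinuous f z) ->
  exists M, 0 < M /\ forall z, rectangle_boundary a b c d z -> Cmod (f z) <= M.
Proof.
  intros Hab Hcd f_cont.
  assert (horizontal : forall y, y = c \/ y = d ->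
    exists M, 0 < M /\ forall x, a <= x <= b -> Cmod (f (x, y)) <= M).
  { intros y Hy. apply (Cmod_bounded_segment (fun x : R => f (x, y))). intros x Hx.
    apply continuous_horizontal, f_cont. split; [split; simpl; lra|simpl; tauto]. }
  assert (vertical : forall x, x = a \/ x = b ->
    exists M, 0 < M /\ forall y, c <= y <= d -> Cmod (f (x, y)) <= M).
  { intros x Hx. apply (Cmod_bounded_segment (fun y : R => f (x, y))). intros y Hy.
    apply continuous_vertical, f_cont. split; [split; simpl; lra|simpl; tauto]. }
  destruct (horizontal c (or_introl eq_refl)) as (Mc & Mc_pos & Hc).
  destruct (horizontal d (or_intror eq_refl)) as (Md & Md_pos & Hd).
  destruct (vertical a (or_introl eq_refl)) as (Ma & Ma_pos & Ha).
  destruct (vertical b (or_intror eq_refl)) as (Mb & Mb_pos & Hb).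
  exists (Mc + Md + Ma + Mb). split; [lra|].
  intros [x y] [[Hx Hy] [E|[E|[E|E]]]]; simpl in *; subst.
  - specialize (Ha y Hy). lra.
  - specialize (Hb y Hy). lra.
  - specialize (Hc x Hx). lra.
  - specialize (Hd x Hx). lra.
Qed.

Section CauchyIntegral.

Variables (z0 : C) (r : R).
Hypothesis r_pos : 0 < r.

Let near_center (w : C) : Prop := Cmod (w - z0)%C < r / 2.

Lemma center_near : near_center z0.
Proof. unfold near_center. replace (z0 - z0)%C with (RtoC 0) by ring. rewrite Cmod_0. lra. Qed.

Lemma square_boundary_far (w z : C) : near_center w -> square_boundary z0 r z ->
  r / 2 <= Cmod (z - w)%C.
Proof.
  intros w_near Hz.
  assert (far := square_boundary_dist_ge z0 z r (Rlt_le _ _ r_pos) Hz).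
  assert (triangle := Cmod_Cminus_le (z - w)%C (z0 - w)%C).
  replace (z - w - (z0 - w))%C with (z - z0)%C in triangle by ring.
  rewrite (Cmod_Cminus_sym z0 w) in triangle. unfold near_center in w_near. lra.
Qed.

Lemma square_boundary_neq (w z : C) : near_center w -> square_boundary z0 r z ->
  (z - w)%C <> RtoC 0.
Proof.
  intros w_near Hz. assert (far := square_boundary_far w z w_near Hz). apply Cmod_gt_0. lra.
Qed.

Lemma continuous_Cauchy_kernel (g : C -> C) (w : C) : near_center w ->
  (forall z, square_boundary z0 r z -> Ccontinuous g z) ->
  forall z, square_boundary z0 r z -> Ccontinuous (fun z => g z / (z - w))%C z.
Proof.
  intros w_near g_cont z Hz. apply continuous_Cdiv; [auto| |now apply square_boundary_neq].
  apply ex_Cderive_continuous. eexists. apply is_Cderive_minus_const.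
Qed.

Lemma square_int_Cauchy_difference (g : C -> C) (w : C) : near_center w ->
  (forall z, square_boundary z0 r z -> Ccontinuous g z) ->
  (square_int (fun z => g z / (z - w)) z0 r - square_int (fun z => g z / (z - z0)) z0 r =
   (w - z0) * square_int (fun z => g z / (z - z0) / (z - w)) z0 r)%C.
Proof.
  intros w_near g_cont.
  assert (cont_w := continuous_Cauchy_kernel g w w_near g_cont).
  assert (cont_z0 := continuous_Cauchy_kernel g z0 center_near g_cont).
  assert (cont_z0_w := continuous_Cauchy_kernel _ w w_near cont_z0).
  unfold square_int.
  rewrite <- rect_int_minus, <- rect_int_Cmult by (lra || assumption).
  apply rect_int_ext; try lra. intros z Hz.
  field. split; apply square_boundary_neq; auto using center_near.
Qed.

Lemma Cmod_square_int_Cauchy_le (g : C -> C) (w : C) (M : R) : near_center w ->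
  (forall z, square_boundary z0 r z -> Ccontinuous g z) ->
  (forall z, square_boundary z0 r z -> Cmod (g z) <= M) ->
  Cmod (square_int (fun z => g z / (z - w))%C z0 r) <= 16 * M.
Proof.
  intros w_near g_cont g_le. unfold square_int.
  replace (16 * M) with (2 * ((Re z0 + r - (Re z0 - r)) + (Im z0 + r - (Im z0 - r))) * (M / (r / 2)))
    by (field; lra).
  apply Cmod_rect_int_le; try lra; [now apply continuous_Cauchy_kernel|].
  intros z Hz. rewrite Cmod_div by now apply square_boundary_neq.
  apply Rmult_le_compat; auto using Cmod_ge_0.
  - apply Rlt_le, Rinv_0_lt_compat. assert (far := square_boundary_far w z w_near Hz). lra.
  - apply Rinv_le_contravar; [lra|]. now apply square_boundary_far.
Qed.

Variable f : C -> C.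
Hypothesis f_continuous : forall z, square_boundary z0 r z -> Ccontinuous f z.
Hypothesis f_Cauchy : forall w, near_center w ->
  square_int (fun z => f z / (z - w))%C z0 r = (RtoC (2 * PI) * Ci * f w)%C.

Let Df (z : C) : C := (f z / (z - z0))%C.
Let D2f (z : C) : C := (Df z / (z - z0))%C.

Lemma Cauchy_formula_second_order (w : C) : near_center w ->
  (f w - f z0 - square_int D2f z0 r / (RtoC (2 * PI) * Ci) * (w - z0) =
   (w - z0) * (w - z0) * (square_int (fun z => D2f z / (z - w)) z0 r / (RtoC (2 * PI) * Ci)))%C.
Proof.
  intros w_near. assert (z0_near := center_near). assert (two_pi_i_nz := two_pi_i_neq_0).
  assert (order1 := square_int_Cauchy_difference f w w_near f_continuous).
  rewrite !f_Cauchy in order1 by auto.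
  assert (order2 := square_int_Cauchy_difference Df w w_near
    (continuous_Cauchy_kernel f z0 z0_near f_continuous)).
  change (fun z => (f z / (z - z0) / (z - w))%C) with (fun z => (Df z / (z - w))%C) in order1.
  change (fun z => (Df z / (z - z0))%C) with D2f in order2.
  change (fun z => (Df z / (z - z0) / (z - w))%C) with (fun z => (D2f z / (z - w))%C) in order2.
  set (I := square_int D2f z0 r) in *.
  set (J := square_int (fun z => Df z / (z - w))%C z0 r) in *.
  set (K := square_int (fun z => D2f z / (z - w))%C z0 r) in *.
  set (k := (RtoC (2 * PI) * Ci)%C) in *.
  transitivity ((k * f w - k * f z0 - I * (w - z0)) / k)%C; [field; auto|].
  rewrite order1. transitivity ((w - z0) * (J - I) / k)%C; [field; auto|].
  rewrite order2. field. auto.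
Qed.

Lemma ex_Cderive_Cauchy_formula : ex_Cderive f z0.
Proof.
  assert (PI_pos := PI_RGT_0). assert (z0_near := center_near).
  assert (D2f_cont := continuous_Cauchy_kernel _ z0 z0_near
    (continuous_Cauchy_kernel f z0 z0_near f_continuous)).
  destruct (Cmod_bounded_boundary D2f (Re z0 - r) (Re z0 + r) (Im z0 - r) (Im z0 + r))
    as (M & M_pos & D2f_le); try lra; [exact D2f_cont|].
  assert (K_pos : 0 < 16 * M / (2 * PI)) by (apply Rdiv_lt_0_compat; lra).
  eexists. apply is_Cderive_iff. intros eps eps_pos. apply locally_Cmod.
  exists (Rmin (r / 2) (eps / (16 * M / (2 * PI)))).
  split; [apply Rmin_pos; [lra|now apply Rdiv_lt_0_compat]|].
  intros w Hw. assert (w_near := Rlt_le_trans _ _ _ Hw (Rmin_l _ _)).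
  assert (w_eps := Rlt_le_trans _ _ _ Hw (Rmin_r _ _)).
  rewrite Cauchy_formula_second_order, !Cmod_mult, Rmult_assoc, Rmult_comm by exact w_near.
  apply Rmult_le_compat_r; [apply Cmod_ge_0|].
  apply Rle_trans with (Cmod (w - z0)%C * (16 * M / (2 * PI))).
  - apply Rmult_le_compat_l; [apply Cmod_ge_0|].
    rewrite Cmod_div by exact two_pi_i_neq_0.
    rewrite Cmod_mult, Cmod_Ci, Cmod_R, Rmult_1_r, (Rabs_pos_eq (2 * PI)) by lra.
    apply Rmult_le_compat_r; [apply Rlt_le, Rinv_0_lt_compat; lra|].
    now apply Cmod_square_int_Cauchy_le.
  - apply Rle_div_r; [exact K_pos|lra].
Qed.

End CauchyIntegral.

Lemma rect_int_uniform_limit (fn : nat -> C -> C) (f : C -> C) (a b c d : R) : a <= b -> c <= d ->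
  (forall n z, rectangle_boundary a b c d z -> Ccontinuous (fn n) z) ->
  (forall z, rectangle_boundary a b c d z -> Ccontinuous f z) ->
  (forall eps, 0 < eps -> exists N, forall n, (N <= n)%nat -> forall z,
    rectangle_boundary a b c d z -> Cmod (fn n z - f z)%C <= eps) ->
  filterlim (fun n => rect_int (fn n) a b c d) eventually
    (locally (T := C_UniformSpace) (rect_int f a b c d)).
Proof.
  intros Hab Hcd fn_cont f_cont uniform P HP. apply locally_Cmod in HP.
  destruct HP as (eps & eps_pos & HP). set (L := 2 * ((b - a) + (d - c)) + 1).
  assert (L_pos : 0 < L) by (unfold L; lra).
  destruct (uniform (eps / (2 * L))) as [N close]; [apply Rdiv_lt_0_compat; lra|].
  exists N. intros n Hn. apply HP. rewrite <- rect_int_minus by auto.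
  apply Rle_lt_trans with (2 * ((b - a) + (d - c)) * (eps / (2 * L))).
  - apply Cmod_rect_int_le; auto.
    intros z Hz. apply continuous_Cminus; auto.
  - apply Rle_lt_trans with (L * (eps / (2 * L))).
    + apply Rmult_le_compat_r; [apply Rlt_le, Rdiv_lt_0_compat; lra|unfold L; lra].
    + replace (L * (eps / (2 * L))) with (eps / 2) by (field; lra). lra.
Qed.

Section UniformLimit.

Variables (fn : nat -> C -> C) (f : C -> C) (z0 : C) (R0 : R).
Hypothesis R0_pos : 0 < R0.
Hypothesis fn_holo : forall n z, Cmod (z - z0)%C < R0 -> ex_Cderive (fn n) z.
Hypothesis uniform : forall eps, 0 < eps -> exists N, forall n, (N <= n)%nat -> forall z,
  Cmod (z - z0)%C < R0 -> Cmod (fn n z - f z)%C <= eps.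

Let r := R0 / 4.

Lemma quarter_square_in_disc (z : C) : square z0 r z -> Cmod (z - z0)%C < R0.
Proof.
  intros Hz. assert (dist_le := square_dist_le z0 z r Hz). unfold r in dist_le. lra.
Qed.

Lemma uniform_limit_continuous (z : C) : Cmod (z - z0)%C < R0 -> Ccontinuous f z.
Proof.
  intros Hz. apply (continuous_uniform_limit fn).
  - intros n. now apply ex_Cderive_continuous, fn_holo.
  - intros eps eps_pos. destruct (uniform eps eps_pos) as [N close]. exists N.
    apply locally_Cmod. exists (R0 - Cmod (z - z0)%C). split; [lra|]. intros w Hw.
    apply close; [apply Nat.le_refl|].
    replace (w - z0)%C with (w - z + (z - z0))%C by ring.
    eapply Rle_lt_trans; [apply Cmod_triangle|]. lra.
Qed.

Lemma uniform_limit_Cauchy_integral (w : C) : Cmod (w - z0)%C < r / 2 ->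
  filterlim (fun n => square_int (fun z => fn n z / (z - w))%C z0 r) eventually
    (locally (T := C_UniformSpace) (square_int (fun z => f z / (z - w))%C z0 r)).
Proof.
  intros w_near. assert (r_pos : 0 < r) by (unfold r; lra).
  apply (rect_int_uniform_limit (fun n z => fn n z / (z - w))%C (fun z => f z / (z - w))%C
    (Re z0 - r) (Re z0 + r) (Im z0 - r) (Im z0 + r)); try lra.
  - intros n. apply continuous_Cauchy_kernel; auto.
    intros z [Hz _]. now apply ex_Cderive_continuous, fn_holo, quarter_square_in_disc.
  - apply continuous_Cauchy_kernel; auto.
    intros z [Hz _]. now apply uniform_limit_continuous, quarter_square_in_disc.
  - intros eps eps_pos. destruct (uniform (eps * (r / 2))) as [N close]; [nra|].
    exists N. intros n Hn z Hz.
    assert (far := square_boundary_far z0 r r_pos w z w_near Hz).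
    replace (fn n z / (z - w) - f z / (z - w))%C with ((fn n z - f z) / (z - w))%C
      by (unfold Cdiv; ring).
    rewrite Cmod_div by (apply Cmod_gt_0; lra). apply Rle_div_l; [lra|].
    apply Rle_trans with (eps * (r / 2)); [|apply Rmult_le_compat_l; lra].
    apply close; [exact Hn|]. destruct Hz as [Hz _]. now apply quarter_square_in_disc.
Qed.

(* Weierstrass: Cauchy's formula passes to the limit. *)
Lemma ex_Cderive_uniform_limit : ex_Cderive f z0.
Proof.
  assert (r_pos : 0 < r) by (unfold r; lra).
  apply (ex_Cderive_Cauchy_formula z0 r r_pos).
  { intros z [Hz _]. now apply uniform_limit_continuous, quarter_square_in_disc. }
  intros w w_near.
  apply (filterlim_locally_unique (V := C_NormedModule) (F := eventually)
    (fun n => square_int (fun z => fn n z / (z - w))%C z0 r));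
    [now apply uniform_limit_Cauchy_integral|].
  apply (filterlim_ext (fun n => RtoC (2 * PI) * Ci * fn n w)%C).
  - intros n. symmetry.
    assert (re_le := re_le_Cmod (w - z0)%C). assert (im_le := Rabs_Im_le_Cmod (w - z0)%C).
    apply Rabs_le_between in re_le, im_le. rewrite Re_Cminus in re_le. rewrite Im_Cminus in im_le.
    apply (Cauchy_formula (fn n) w (Re z0 - r) (Re z0 + r) (Im z0 - r) (Im z0 + r)); [lra|lra|].
    intros z Hz. now apply fn_holo, quarter_square_in_disc.
  - apply filterlim_Cmult; [apply filterlim_const|].
    intros P HP. apply locally_Cmod in HP. destruct HP as (eps & eps_pos & HP).
    destruct (uniform (eps / 2)) as [N close]; [lra|]. exists N. intros n Hn.
    apply HP. assert (w_close := close n Hn w ltac:(unfold r in w_near; lra)). lra.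
Qed.

End UniformLimit.

(** * Telescoping majorants and alternating series *)

Lemma minus_plus_cancel {G : AbelianGroup} (x y : G) : plus (minus x y) y = x.
Proof. unfold minus. now rewrite <- plus_assoc, plus_opp_l, plus_zero_r. Qed.

Lemma filterlim_eventually_subseq {U : UniformSpace} (u : nat -> U) (l : U) (k : nat -> nat) :
  (forall n, (n <= k n)%nat) -> filterlim u eventually (locally l) ->
  filterlim (fun n => u (k n)) eventually (locally l).
Proof.
  intros k_ge Hu P HP. destruct (Hu P HP) as [N HN]. exists N.
  intros n Hn. apply HN. specialize (k_ge n). lia.
Qed.

Section Telescoping.

Context {K : AbsRing} {V : NormedModule K}.
Variables (a : nat -> V) (A : nat -> R).
Hypothesis a_le : forall n, norm (a n) <= A n - A (S n).
Hypothesis A_lim : is_lim_seq A 0.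

Lemma is_series_telescoping : is_series (fun n => A n - A (S n)) (A O).
Proof.
  assert (partial : forall n, sum_n (fun n => A n - A (S n)) n = A O - A (S n)).
  { induction n as [|n IHn]; [now rewrite sum_O|].
    rewrite sum_Sn, IHn. unfold plus; simpl. ring. }
  apply (is_lim_seq_ext (fun n => A O - A (S n)) _ (A O)); [intros n; now rewrite partial|].
  replace (Finite (A O)) with (Rbar_minus (A O) 0) by (simpl; f_equal; ring).
  apply is_lim_seq_minus'; [apply is_lim_seq_const|now apply is_lim_seq_incr_1 in A_lim].
Qed.

Lemma norm_series_telescoping_le (l : V) : is_series a l -> norm l <= A O.
Proof.
  intros Hl.
  apply (is_lim_seq_le (fun n => norm (sum_n a n)) (fun _ => A O) (norm l) (A O)).
  - intros n. eapply Rle_trans; [exact (norm_sum_n_m a 0 n)|].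
    eapply Rle_trans; [exact (sum_n_m_le _ _ 0 n a_le)|].
    apply (is_lim_seq_incr_compare (sum_n (fun n => A n - A (S n)))).
    + exact is_series_telescoping.
    + intros m. rewrite sum_Sn. unfold plus; simpl.
      assert (decr := Rle_trans _ _ _ (norm_ge_0 (a (S m))) (a_le (S m))). lra.
  - exact (filterlim_comp _ _ _ _ _ _ _ _ Hl (filterlim_norm l)).
  - apply is_lim_seq_const.
Qed.

End Telescoping.

Lemma ex_series_telescoping {K : AbsRing} {V : CompleteNormedModule K}
  (a : nat -> V) (A : nat -> R) :
  (forall n, norm (a n) <= A n - A (S n)) -> is_lim_seq A 0 -> ex_series a.
Proof.
  intros a_le A_lim. apply (ex_series_le a _ a_le). eexists. now apply is_series_telescoping.
Qed.

Lemma norm_remainder_telescoping_le {K : AbsRing} {V : NormedModule K}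
  (a : nat -> V) (A : nat -> R) (l : V) (n : nat) :
  (forall n, norm (a n) <= A n - A (S n)) -> is_lim_seq A 0 -> is_series a l ->
  norm (minus l (sum_n a n)) <= A (S n).
Proof.
  intros a_le A_lim Hl.
  assert (tail : is_series (fun k => a (S n + k)%nat) (minus l (sum_n a n))).
  { apply is_series_incr_n; [lia|].
    rewrite <- (minus_plus_cancel (G := V) l (sum_n a n)) in Hl. exact Hl. }
  replace (S n) with (S n + 0)%nat by lia.
  apply (norm_series_telescoping_le (fun k => a (S n + k)%nat) (fun k => A (S n + k)%nat)); auto.
  - intros k. rewrite <- plus_n_Sm. apply a_le.
  - apply (filterlim_eventually_subseq A 0 (fun k => (S n + k)%nat)); [intros; lia|exact A_lim].
Qed.

Section Alternating.

Context {V : NormedModule R_AbsRing}.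
Variable a : nat -> V.

Let alternating (n : nat) : V := scal ((-1) ^ n) (a n).
Let difference (m : nat) : V := minus (a (2 * m)%nat) (a (S (2 * m))).

Lemma sum_n_alternating_odd (m : nat) : sum_n alternating (S (2 * m)) = sum_n difference m.
Proof.
  assert (pair : forall m,
    plus (alternating (2 * m)) (alternating (S (2 * m))) = difference m).
  { intros k. unfold alternating, difference, minus. rewrite pow_1_even, pow_1_odd.
    change (plus (scal one (a (2 * k)%nat)) (scal (opp one) (a (S (2 * k)))) =
      plus (a (2 * k)%nat) (opp (a (S (2 * k))))).
    now rewrite (scal_one (a (2 * k)%nat)), (scal_opp_one (a (S (2 * k)))). }
  induction m as [|m IHm].
  - rewrite sum_Sn, sum_O, sum_O. exact (pair O).
  - replace (2 * S m)%nat with (S (S (2 * m))) by lia.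
    rewrite sum_Sn, sum_Sn, IHm, sum_Sn, <- plus_assoc. f_equal.
    rewrite <- (pair (S m)). now replace (2 * S m)%nat with (S (S (2 * m))) by lia.
Qed.

Lemma is_series_alternating (l : V) :
  filterlim a eventually (locally (zero : V)) -> is_series difference l -> is_series alternating l.
Proof.
  intros a_lim Hl.
  assert (odd_lim : filterlim (fun m => sum_n alternating (S (2 * m))) eventually (locally l)).
  { apply (filterlim_ext (sum_n difference)); [|exact Hl]. intros m. now rewrite sum_n_alternating_odd. }
  assert (even_lim : filterlim (fun m => sum_n alternating (2 * m)) eventually (locally l)).
  { apply (filterlim_ext (fun m => plus (sum_n alternating (S (2 * m))) (a (S (2 * m))))).
    - intros m. rewrite sum_Sn. unfold alternating at 2. rewrite pow_1_odd.
      change (plus (plus (sum_n alternating (2 * m)) (scal (opp one) (a (S (2 * m))))) (a (S (2 * m)))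
        = sum_n alternating (2 * m)).
      rewrite (scal_opp_one (a (S (2 * m)))). exact (minus_plus_cancel (G := V) _ _).
    - rewrite <- (plus_zero_r l).
      apply (filterlim_comp_2 (G := locally l) (H := locally (zero : V))
        (fun m => sum_n alternating (S (2 * m))) (fun m => a (S (2 * m)))).
      + exact odd_lim.
      + apply (filterlim_eventually_subseq a zero (fun m => S (2 * m))); [intros; lia|exact a_lim].
      + apply filterlim_plus. }
  intros P HP. destruct (odd_lim P HP) as [N_odd Hodd]. destruct (even_lim P HP) as [N_even Heven].
  exists (2 * (N_odd + N_even))%nat. intros n Hn.
  destruct (Nat.Even_or_Odd n) as [[m ->]|[m ->]].
  - apply Heven. lia.
  - rewrite Nat.add_1_r. apply Hodd. lia.
Qed.

Lemma is_series_pairs (l : V) : is_series a l ->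
  is_series (fun m => plus (a (2 * m)%nat) (a (S (2 * m)))) l.
Proof.
  intros Hl. apply (filterlim_ext (fun m => sum_n a (S (2 * m)))).
  - intros m. induction m as [|m IHm]; [rewrite sum_Sn, sum_O, sum_O; reflexivity|].
    replace (2 * S m)%nat with (S (S (2 * m))) by lia.
    rewrite sum_Sn, sum_Sn, IHm, sum_Sn, <- plus_assoc.
    now replace (2 * S m)%nat with (S (S (2 * m))) by lia.
  - apply (filterlim_eventually_subseq (sum_n a) l (fun m => S (2 * m))); [intros; lia|exact Hl].
Qed.

End Alternating.

Lemma is_CSeries_unique (a : nat -> C) (l : C) :
  is_series (V := C_R_NormedModule) a l -> CSeries a = l.
Proof.
  intros Hl. destruct l as [x y]. unfold CSeries. f_equal; apply is_series_unique.
  - apply (filterlim_ext (fun n => fst (sum_n (G := C_R_NormedModule) a n))).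
    + intros n. induction n as [|n IHn]; [now rewrite !sum_O|]. now rewrite !sum_Sn, <- IHn.
    + exact (filterlim_comp _ _ _ _ _ _ _ _ Hl (continuous_fst x y)).
  - apply (filterlim_ext (fun n => snd (sum_n (G := C_R_NormedModule) a n))).
    + intros n. induction n as [|n IHn]; [now rewrite !sum_O|]. now rewrite !sum_Sn, <- IHn.
    + exact (filterlim_comp _ _ _ _ _ _ _ _ Hl (continuous_snd x y)).
Qed.

(** * Integrals over horizontal lines *)

Notation is_RInt_line f l := (is_RInt_gen f (Rbar_locally m_infty) (Rbar_locally p_infty) l).
Notation is_CRInt_line f l := (is_RInt_gen (V := C_R_CompleteNormedModule) f
  (Rbar_locally m_infty) (Rbar_locally p_infty) l).

Lemma is_RInt_line_comp_lin {V : NormedModule R_AbsRing} (f : R -> V) (u v : R) (l : V) : 0 < u ->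
  is_RInt_line f l -> is_RInt_line (fun x => scal u (f (u * x + v))) l.
Proof.
  intros u_pos Hl P HP. destruct (Hl P HP) as [Q S [M_minus HQ] [M_plus HS] HQS].
  apply Filter_prod with (fun a => Q (u * a + v)) (fun b => S (u * b + v)).
  - exists ((M_minus - v) / u). intros a Ha. apply HQ. apply Rlt_div_r in Ha; lra.
  - exists ((M_plus - v) / u). intros b Hb. apply HS. apply Rlt_div_l in Hb; lra.
  - intros a b Ha Hb. destruct (HQS _ _ Ha Hb) as [y [Hy Py]].
    exists y. split; [|exact Py]. now apply is_RInt_comp_lin.
Qed.

Lemma is_RInt_line_shift {V : NormedModule R_AbsRing} (f : R -> V) (v : R) (l : V) :
  is_RInt_line f l -> is_RInt_line (fun x => f (x + v)) l.
Proof.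
  intros Hl. apply (is_RInt_line_comp_lin f 1 v l Rlt_0_1) in Hl. revert Hl.
  apply is_RInt_gen_ext. apply filter_forall. intros ab x _.
  rewrite Rmult_1_l. apply (scal_one (f (x + v))).
Qed.

Lemma norm_RInt_swap {V : CompleteNormedModule R_AbsRing} (f : R -> V) (a b : R) :
  ex_RInt f a b -> norm (RInt f b a) = norm (RInt f a b).
Proof. intros Hf. rewrite <- opp_RInt_swap by exact Hf. exact (norm_opp (V := V) (RInt f a b)). Qed.

Lemma is_RInt_reflect {V : NormedModule R_AbsRing} (f : R -> V) (a b : R) (l : V) :
  is_RInt f (- b) (- a) l -> is_RInt (fun x => f (- x)) a b l.
Proof.
  intros Hl. apply is_RInt_swap, is_RInt_comp_opp, is_RInt_opp in Hl. rewrite opp_opp in Hl.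
  revert Hl. apply is_RInt_ext. intros x _. exact (opp_opp (G := V) (f (- x))).
Qed.

Lemma is_RInt_line_reflect {V : NormedModule R_AbsRing} (f : R -> V) (l : V) :
  is_RInt_line f l -> is_RInt_line (fun x => f (- x)) l.
Proof.
  intros Hl P HP. destruct (Hl P HP) as [Q S [M_minus HQ] [M_plus HS] HQS].
  apply Filter_prod with (fun a => S (- a)) (fun b => Q (- b)).
  - exists (- M_plus). intros a Ha. apply HS. lra.
  - exists (- M_minus). intros b Hb. apply HQ. lra.
  - intros a b Ha Hb. destruct (HQS _ _ Hb Ha) as [y [Hy Py]].
    exists y. split; [now apply is_RInt_reflect|exact Py].
Qed.

Lemma exp_opp_eventually_le (c D eps : R) : 0 < c -> 0 < eps ->
  Rbar_locally p_infty (fun x => D * exp (- (c * x)) <= eps).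
Proof.
  intros c_pos eps_pos. assert (D_abs := Rle_abs D). assert (D_abs_pos := Rabs_pos D).
  exists ((Rabs D + 1) / (c * eps)). intros x Hx.
  apply Rlt_div_l in Hx; [|nra].
  assert (exp_ge : 1 + c * x <= exp (c * x)).
  { apply Rlt_le, exp_ineq1. nra. }
  rewrite exp_Ropp. apply Rle_div_l; [apply exp_pos|]. nra.
Qed.

Lemma plus_minus_middle {G : AbelianGroup} (x y z : G) : minus (plus x (plus y z)) y = plus x z.
Proof.
  unfold minus. rewrite (plus_comm y z), (plus_assoc x z y).
  now rewrite <- (plus_assoc (plus x z)), plus_opp_r, plus_zero_r.
Qed.

Section ExponentialDecay.

Context {V : CompleteNormedModule R_AbsRing}.
Variables (f : R -> V) (K c : R).
Hypothesis c_pos : 0 < c.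
Hypothesis f_continuous : forall x, continuous f x.
Hypothesis f_decay : forall x, norm (f x) <= K * exp (- (c * Rabs x)).

Lemma ex_RInt_decay (a b : R) : ex_RInt f a b.
Proof. apply ex_RInt_continuous. auto. Qed.

Lemma is_RInt_exp_decay (a b : R) :
  is_RInt (fun x => K * exp (- (c * x))) a b (K / c * (exp (- (c * a)) - exp (- (c * b)))).
Proof.
  replace (K / c * (exp (- (c * a)) - exp (- (c * b))))
    with (minus (- (K / c * exp (- (c * b)))) (- (K / c * exp (- (c * a)))))
    by (unfold minus, plus, opp; simpl; ring).
  apply (is_RInt_derive (V := R_CompleteNormedModule) (fun x => - (K / c * exp (- (c * x))))).
  - intros x _. auto_derive; [auto|]. field. lra.
  - intros x _. apply (ex_derive_continuous (V := R_NormedModule)). auto_derive. auto.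
Qed.

Lemma norm_RInt_tail_le (g : R -> V) (T a b : R) :
  (forall x, norm (g x) <= K * exp (- (c * Rabs x))) ->
  (forall a b, ex_RInt g a b) -> 0 <= T <= a -> T <= b ->
  norm (RInt g a b) <= K / c * exp (- (c * T)).
Proof.
  intros g_decay g_int Ha Hb.
  assert (K_pos : 0 <= K).
  { assert (decay_0 := Rle_trans _ _ _ (norm_ge_0 _) (g_decay 0)).
    rewrite Rabs_R0, Rmult_0_r, Ropp_0, exp_0 in decay_0. lra. }
  assert (ordered : forall u v, T <= u -> u <= v -> norm (RInt g u v) <= K / c * exp (- (c * T))).
  { intros u v Hu Huv.
    apply Rle_trans with (K / c * (exp (- (c * u)) - exp (- (c * v)))).
    - apply (norm_RInt_le g (fun x => K * exp (- (c * x))) u v); auto.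
      + intros x Hx. eapply Rle_trans; [apply g_decay|]. rewrite Rabs_pos_eq; lra.
      + now apply RInt_correct.
      + apply is_RInt_exp_decay.
    - apply Rmult_le_compat_l; [apply Rmult_le_pos; [lra|apply Rlt_le, Rinv_0_lt_compat; lra]|].
      assert (exp_v_pos := exp_pos (- (c * v))).
      assert (exp_u_le : exp (- (c * u)) <= exp (- (c * T))) by (apply exp_le; nra). lra. }
  destruct (Rle_dec a b) as [Hab|Hab]; [apply ordered; lra|].
  rewrite norm_RInt_swap by auto. apply ordered; lra.
Qed.

Lemma ex_RInt_line_exp_decay : ex_RInt_gen f (Rbar_locally m_infty) (Rbar_locally p_infty).
Proof.
  assert (cauchy : exists l, filterlim (fun ab => RInt f (fst ab) (snd ab))
    (filter_prod (Rbar_locally m_infty) (Rbar_locally p_infty)) (locally l)).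
  2:{ destruct cauchy as [l Hl]. exists l. revert Hl. apply filterlimi_lim_ext.
      intros [a b]. apply RInt_correct, ex_RInt_decay. }
  apply filterlim_locally_cauchy. intros eps.
  destruct (exp_opp_eventually_le c (2 * (K / c)) (eps / 2) c_pos) as [M HM];
    [assert (eps_pos := cond_pos eps); lra|].
  set (T := Rmax 0 (M + 1)). assert (T_pos := Rmax_l 0 (M + 1) : 0 <= T).
  assert (T_ge := Rmax_r 0 (M + 1) : M + 1 <= T).
  assert (reflect_decay : forall x, norm (f (- x)) <= K * exp (- (c * Rabs x))).
  { intros x. rewrite <- (Rabs_Ropp x). apply f_decay. }
  assert (reflect_int : forall a b, is_RInt (fun x => f (- x)) a b (RInt f (- b) (- a))).
  { intros a b. apply is_RInt_reflect, RInt_correct, ex_RInt_decay. }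
  exists (fun ab => fst ab < - T /\ T < snd ab). split.
  { apply Filter_prod with (fun a => a < - T) (fun b => T < b); [now exists (- T)|now exists T|now split]. }
  intros [a b] [a' b'] [Ha Hb] [Ha' Hb']. simpl in *. apply (norm_compat1 (V := V)).
  assert (difference : minus (RInt f a' b') (RInt f a b) = plus (RInt f a' a) (RInt f b b')).
  { rewrite <- (RInt_Chasles f a' a b'), <- (RInt_Chasles f a b b') by apply ex_RInt_decay.
    exact (plus_minus_middle (G := V) _ _ _). }
  eapply Rle_lt_trans; [right; exact (f_equal (norm (V := V)) difference)|].
  eapply Rle_lt_trans; [apply (norm_triangle (V := V))|].
  assert (right := norm_RInt_tail_le f T b b' f_decay ex_RInt_decay ltac:(lra) ltac:(lra)).
  assert (left := norm_RInt_tail_le (fun x => f (- x)) T (- a) (- a') reflect_decay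
    (fun a b => ex_intro _ _ (reflect_int a b)) ltac:(lra) ltac:(lra)).
  rewrite (is_RInt_unique _ _ _ _ (reflect_int _ _)), !Ropp_involutive in left.
  specialize (HM T ltac:(lra)). assert (eps_pos := cond_pos eps). lra.
Qed.

End ExponentialDecay.

Lemma is_CRInt_line_ext (f g : R -> C) (l : C) : (forall x, f x = g x) ->
  is_CRInt_line f l -> is_CRInt_line g l.
Proof.
  intros fg. apply (is_RInt_gen_ext (V := C_R_NormedModule)), filter_forall. auto.
Qed.

Lemma is_CRInt_line_plus (f g : R -> C) (l m : C) :
  is_CRInt_line f l -> is_CRInt_line g m -> is_CRInt_line (fun x => f x + g x)%C (l + m)%C.
Proof. apply (is_RInt_gen_plus (V := C_R_NormedModule)). Qed.

Lemma is_CRInt_line_minus (f g : R -> C) (l m : C) :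
  is_CRInt_line f l -> is_CRInt_line g m -> is_CRInt_line (fun x => f x - g x)%C (l - m)%C.
Proof. apply (is_RInt_gen_minus (V := C_R_NormedModule)). Qed.

Lemma is_CRInt_line_Cmult (c : C) (f : R -> C) (l : C) :
  is_CRInt_line f l -> is_CRInt_line (fun x => c * f x)%C (c * l)%C.
Proof.
  apply (is_RInt_gen_linear (U := C_R_NormedModule) (V := C_R_NormedModule) _ _ (Cmult c)),
    is_linear_Cmult.
Qed.

Lemma is_CRInt_line_conj (f : R -> C) (l : C) :
  is_CRInt_line f l -> is_CRInt_line (fun x => Cconj (f x)) (Cconj l).
Proof.
  apply (is_RInt_gen_linear (U := C_R_NormedModule) (V := C_R_NormedModule) _ _ Cconj),
    is_linear_Cconj.
Qed.

Lemma is_CRInt_line_sum_n (f : nat -> R -> C) (l : nat -> C) (n : nat) :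
  (forall k, is_CRInt_line (f k) (l k)) ->
  is_CRInt_line (fun x => sum_n (G := C_R_NormedModule) (fun k => f k x) n)
    (sum_n (G := C_R_NormedModule) l n).
Proof.
  intros Hl. induction n as [|n IHn].
  - rewrite sum_O. apply (is_CRInt_line_ext (f O)); [|apply Hl]. intros x. now rewrite sum_O.
  - rewrite sum_Sn.
    apply (is_CRInt_line_ext (fun x => sum_n (G := C_R_NormedModule) (fun k => f k x) n + f (S n) x)%C).
    + intros x. now rewrite sum_Sn.
    + now apply is_CRInt_line_plus.
Qed.

Lemma Cmod_RInt_line_le (f : R -> C) (g : R -> R) (l : C) (m : R) :
  (forall x, Cmod (f x) <= g x) -> is_CRInt_line f l -> is_RInt_line g m -> Cmod l <= m.
Proof.
  intros fg Hl Hm. rewrite Cmod_norm.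
  apply (RInt_gen_norm (V := C_R_CompleteNormedModule)
    (Fa := Rbar_locally m_infty) (Fb := Rbar_locally p_infty) f g l m); auto.
  - apply Filter_prod with (fun a => a < 0) (fun b => 0 < b); [now exists 0|now exists 0|].
    intros a b Ha Hb. simpl. lra.
  - apply filter_forall. intros ab x _. rewrite <- Cmod_norm. auto.
Qed.

Lemma ex_CRInt_line_exp_decay (f : R -> C) (K c : R) : 0 < c ->
  (forall x, continuous (U := C_UniformSpace) f x) ->
  (forall x, Cmod (f x) <= K * exp (- (c * Rabs x))) -> exists l, is_CRInt_line f l.
Proof.
  intros c_pos f_cont f_decay.
  apply (ex_RInt_line_exp_decay (V := C_R_CompleteNormedModule) f K c); auto.
  intros x. rewrite <- Cmod_norm. apply f_decay.
Qed.

Lemma ex_RInt_line_exp_Rabs (c : R) : 0 < c -> exists l, is_RInt_line (fun x => exp (- (c * Rabs x))) l.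
Proof.
  intros c_pos.
  apply (ex_RInt_line_exp_decay (V := R_CompleteNormedModule) _ 1 c); auto.
  - intros x. apply (continuous_comp (fun x => - (c * Rabs x)) exp).
    + apply (continuous_opp (V := R_NormedModule)), (continuous_scal_r (V := R_NormedModule) c Rabs).
      apply continuous_Rabs.
    + apply (ex_derive_continuous (V := R_NormedModule)). auto_derive. auto.
  - intros x. unfold norm; simpl. rewrite Rmult_1_l. right. apply Rabs_pos_eq, Rlt_le, exp_pos.
Qed.

Lemma CRInt_symmetric_lim (f : R -> C) (l : C) (T : nat -> R) :
  is_lim_seq T p_infty -> is_CRInt_line f l ->
  filterlim (fun n => CRInt f (- T n) (T n)) eventually (locally (T := C_UniformSpace) l).
Proof.
  intros T_lim Hl P HP. destruct (Hl P HP) as [Q S [M_minus HQ] HS HQS].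
  assert (T_large := T_lim _ HS).
  assert (T_minus := proj2 (is_lim_seq_spec T p_infty) T_lim (- M_minus)).
  generalize (filter_and _ _ T_large T_minus). unfold filtermap. apply filter_imp.
  intros n [T_n_S T_n_minus].
  destruct (HQS (- T n) (T n)) as [y [Hy Py]]; [apply HQ; lra|exact T_n_S|].
  apply CRInt_unique in Hy. simpl in Hy. now rewrite Hy.
Qed.

Lemma rect_int_lim_lines (f : C -> C) (c d : R) (lower upper : C) (T : nat -> R) (K k : R) :
  c <= d -> 0 < k -> (forall n, 0 <= T n) -> is_lim_seq T p_infty ->
  is_CRInt_line (fun s => f (s, c)) lower -> is_CRInt_line (fun s => f (s, d)) upper ->
  (forall n x y, Rabs x = T n -> c <= y <= d -> Ccontinuous f (x, y)) ->
  (forall n x y, Rabs x = T n -> c <= y <= d -> Cmod (f (x, y)) <= K * exp (- (k * Rabs x))) ->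
  filterlim (fun n => rect_int f (- T n) (T n) c d) eventually
    (locally (T := C_UniformSpace) (lower - upper)%C).
Proof.
  intros Hcd k_pos T_pos T_lim Hlower Hupper f_cont f_decay.
  assert (side_lim : forall u : nat -> R, (forall n, Rabs (u n) = T n) ->
    filterlim (fun n => CRInt (fun y : R => f (u n, y)) c d) eventually
      (locally (T := C_UniformSpace) (RtoC 0))).
  { intros u abs_u P HP. apply locally_Cmod in HP. destruct HP as (eps & eps_pos & HP).
    generalize (T_lim _ (exp_opp_eventually_le k ((d - c) * K) (eps / 2) k_pos ltac:(lra))).
    unfold filtermap. apply filter_imp. intros n bound. apply HP.
    unfold Cminus. rewrite Copp_0, Cplus_0_r.
    apply Rle_lt_trans with ((d - c) * (K * exp (- (k * T n)))); [|lra].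
    apply Cmod_CRInt_le; [exact Hcd| |].
    - apply ex_CRInt_vertical; [exact Hcd|]. intros y Hy. now apply (f_cont n).
    - intros y Hy. rewrite <- (abs_u n). now apply (f_decay n). }
  replace (lower - upper)%C with (lower - upper + Ci * (RtoC 0 - RtoC 0))%C by ring.
  apply filterlim_Cplus; [|apply filterlim_Cmult; [apply filterlim_const|]]; apply filterlim_Cminus.
  - now apply CRInt_symmetric_lim.
  - now apply CRInt_symmetric_lim.
  - apply side_lim. intros n. now apply Rabs_pos_eq.
  - apply (side_lim (fun n => - T n)). intros n. rewrite Rabs_Ropp. now apply Rabs_pos_eq.
Qed.

Lemma is_lim_seq_INR_plus (x : R) : is_lim_seq (fun n => INR n + x) p_infty.
Proof. apply (is_lim_seq_plus _ _ p_infty x); [apply is_lim_seq_INR|apply is_lim_seq_const|reflexivity]. Qed.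

Lemma CRInt_line_shift_contour (f : C -> C) (c d K k : R) (lower upper : C) : c <= d -> 0 < k ->
  (forall x y, c <= y <= d -> ex_Cderive f (x, y)) ->
  (forall x y, c <= y <= d -> Cmod (f (x, y)) <= K * exp (- (k * Rabs x))) ->
  is_CRInt_line (fun s => f (s, c)) lower -> is_CRInt_line (fun s => f (s, d)) upper -> lower = upper.
Proof.
  intros Hcd k_pos f_holo f_decay Hlower Hupper. apply Ceq_minus.
  apply (filterlim_locally_unique (V := C_NormedModule) (F := eventually)
    (fun n => rect_int f (- (INR n + 0)) (INR n + 0) c d)).
  - apply (rect_int_lim_lines f c d lower upper _ K k); auto.
    + intros n. assert (n_pos := pos_INR n). lra.
    + apply is_lim_seq_INR_plus.
    + intros n x y _ Hy. now apply ex_Cderive_continuous, f_holo.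
  - apply (filterlim_ext (fun _ => RtoC 0)); [|apply filterlim_const].
    intros n. symmetry. assert (n_pos := pos_INR n).
    apply Goursat; [|lra|exact Hcd]. intros [x y] [_ Hy]. now apply f_holo.
Qed.

Lemma is_CRInt_line_height (f : C -> C) (c d K k y0 y1 : R) (l : C) : 0 < k ->
  (forall x y, c <= y <= d -> ex_Cderive f (x, y)) ->
  (forall x y, c <= y <= d -> Cmod (f (x, y)) <= K * exp (- (k * Rabs x))) ->
  c <= y0 <= d -> c <= y1 <= d ->
  is_CRInt_line (fun s => f (s, y0)) l -> is_CRInt_line (fun s => f (s, y1)) l.
Proof.
  intros k_pos f_holo f_decay Hy0 Hy1 Hl.
  destruct (ex_CRInt_line_exp_decay (fun s => f (s, y1)) K k) as [m Hm]; auto.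
  { intros x. now apply continuous_horizontal, ex_Cderive_continuous, f_holo. }
  replace l with m; [exact Hm|]. destruct (Rle_dec y0 y1) as [Hle|Hgt].
  - symmetry. apply (CRInt_line_shift_contour f y0 y1 K k); auto;
      intros x y Hy; (apply f_holo || apply f_decay); lra.
  - apply (CRInt_line_shift_contour f y1 y0 K k); auto; try lra;
      intros x y Hy; (apply f_holo || apply f_decay); lra.
Qed.

(** * Poisson summation *)

Fixpoint sum_Z (a : Z -> C) (N : nat) : C :=
  match N with
  | O => a 0%Z
  | S n => (sum_Z a n + (a (Z.of_nat (S n)) + a (- Z.of_nat (S n))%Z))%C
  end.

Notation Csum_n := (sum_n (G := C_R_NormedModule)).
Notation is_Cseries := (is_series (V := C_R_NormedModule)).

Lemma sum_Z_half_sums (a : Z -> C) (N : nat) :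
  sum_Z a N = (Csum_n (fun n => a (Z.of_nat n)) N + Csum_n (fun n => a (- Z.of_nat n)%Z) N - a 0%Z)%C.
Proof.
  induction N as [|N IHN].
  - rewrite !sum_O. simpl. ring.
  - rewrite !sum_Sn. change (@plus C_R_NormedModule) with Cplus.
    change (sum_Z a (S N)) with (sum_Z a N + (a (Z.of_nat (S N)) + a (- Z.of_nat (S N))%Z))%C.
    rewrite IHN. ring.
Qed.

Lemma Csum_n_Cmult (c : C) (a : nat -> C) (N : nat) :
  Csum_n (fun n => c * a n)%C N = (c * Csum_n a N)%C.
Proof. exact (sum_n_mult_l (K := C_Ring) c a N). Qed.

Lemma Csum_n_geometric (q : C) (N : nat) : q <> RtoC 1 ->
  Csum_n (Cpow q) N = (1 / (1 - q) - q ^ S N / (1 - q))%C.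
Proof.
  intros q_neq_1. assert (den_neq_0 : (1 - q)%C <> RtoC 0) by now apply Cminus_eq_contra, not_eq_sym.
  induction N as [|N IHN].
  - rewrite sum_O. simpl. field. auto.
  - rewrite sum_Sn, IHN. change (@plus C_R_NormedModule) with Cplus. simpl. field. auto.
Qed.

Definition exp_2pii (z : C) : C := cexp (Ci * RtoC (2 * PI) * z).

Lemma exp_2pii_plus (z w : C) : exp_2pii (z + w) = (exp_2pii z * exp_2pii w)%C.
Proof. unfold exp_2pii. rewrite <- cexp_plus. f_equal. ring. Qed.

Lemma Cmod_exp_2pii (x y : R) : Cmod (exp_2pii (x, y)) = exp (- (2 * PI * y)).
Proof. unfold exp_2pii. rewrite Cmod_cexp. f_equal. simpl. ring. Qed.

Lemma exp_2pii_INR (n : nat) : exp_2pii (RtoC (INR n)) = RtoC 1.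
Proof.
  unfold exp_2pii.
  replace (Ci * RtoC (2 * PI) * RtoC (INR n))%C with ((0%R, (0 + 2 * INR n * PI)%R) : C)
    by (Ccomponents; ring).
  unfold cexp. simpl. rewrite exp_0, cos_period, sin_period, cos_0, sin_0. Ccomponents; ring.
Qed.

Lemma exp_2pii_opp (z : C) : exp_2pii (- z) = (/ exp_2pii z)%C.
Proof. unfold exp_2pii. rewrite <- cexp_opp. f_equal. ring. Qed.

Lemma exp_2pii_IZR (n : Z) : exp_2pii (RtoC (IZR n)) = RtoC 1.
Proof.
  destruct (Z.le_ge_cases 0 n) as [n_pos|n_neg].
  - rewrite <- (Z2Nat.id n), <- INR_IZR_INZ by exact n_pos. apply exp_2pii_INR.
  - replace n with (- Z.of_nat (Z.to_nat (- n)))%Z by lia.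
    rewrite opp_IZR, <- INR_IZR_INZ, RtoC_opp, exp_2pii_opp, exp_2pii_INR. Ccomponents; field.
Qed.

Lemma exp_2pii_eq_1 (z : C) : - / 2 <= Re z <= / 2 -> exp_2pii z = RtoC 1 -> z = RtoC 0.
Proof.
  intros Hz exp_z. assert (PI_pos := PI_RGT_0).
  apply cexp_eq_1_small in exp_z.
  - destruct (Cmult_integral _ _ exp_z) as [E|E]; [exfalso|exact E].
    revert E. apply Cmult_neq_0; [apply Ci_nz|apply RtoC_neq_0; lra].
  - replace (Im (Ci * RtoC (2 * PI) * z)%C) with (2 * PI * Re z) by (destruct z; simpl; ring). nra.
Qed.

Lemma is_Cderive_exp_2pii_minus_1 (z : C) :
  is_Cderive (fun z => exp_2pii z - 1)%C z (Ci * RtoC (2 * PI) * exp_2pii z)%C.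
Proof.
  rewrite <- (Cplus_0_r (Ci * RtoC (2 * PI) * exp_2pii z)%C), <- Copp_0.
  apply (is_derive_minus (V := C_NormedModule) exp_2pii (fun _ => RtoC 1)).
  - apply is_Cderive_cexp_scal.
  - apply (is_derive_const (V := C_NormedModule)).
Qed.

Lemma exp_2pii_minus_1_neq_0 (n : Z) (z : C) : Rabs (Re z - IZR n) <= / 2 ->
  z <> RtoC (IZR n) -> (exp_2pii z - 1)%C <> RtoC 0.
Proof.
  intros Hz z_neq E. apply z_neq, Ceq_minus. apply exp_2pii_eq_1.
  - apply Rabs_le_between. exact Hz.
  - replace z with (z - RtoC (IZR n) + RtoC (IZR n))%C in E by ring.
    rewrite exp_2pii_plus, exp_2pii_IZR, Cmult_1_r in E. now apply Ceq_minus.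
Qed.

Lemma exp_2pii_minus_1_off_axis (x y : R) : y <> 0 -> (exp_2pii (x, y) - 1)%C <> RtoC 0.
Proof.
  intros y_neq_0 E. apply Ceq_minus in E. assert (PI_pos := PI_RGT_0).
  assert (modulus := Cmod_exp_2pii x y). rewrite E, Cmod_1, <- exp_0 in modulus.
  apply exp_inv in modulus. apply y_neq_0. nra.
Qed.

Lemma Cmod_exp_2pii_minus_1_half_ge (n : Z) (y : R) :
  1 <= Cmod (exp_2pii ((IZR n + / 2)%R, y) - 1)%C.
Proof.
  replace ((IZR n + / 2)%R, y) with (RtoC (IZR n) + (RtoC (/ 2) + Ci * RtoC y))%C
    by (Ccomponents; ring).
  rewrite exp_2pii_plus, exp_2pii_IZR, Cmult_1_l.
  replace (exp_2pii (RtoC (/ 2) + Ci * RtoC y)) with (RtoC (- exp (- (2 * PI * y)))).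
  - rewrite <- RtoC_minus, Cmod_R, Rabs_left1; assert (exp_y_pos := exp_pos (- (2 * PI * y))); lra.
  - unfold exp_2pii, cexp.
    replace (Ci * RtoC (2 * PI) * (RtoC (/ 2) + Ci * RtoC y))%C with ((- (2 * PI * y), PI) : C)
      by (Ccomponents; field).
    simpl. rewrite cos_PI, sin_PI. Ccomponents; ring.
Qed.

Section Poisson.

Variables (g : C -> C) (K k : R) (ghat : Z -> C).
Hypothesis k_pos : 0 < k.
Hypothesis g_holo : forall x y, Rabs y <= 1 -> ex_Cderive g (x, y).
Hypothesis g_decay : forall x y, Rabs y <= 1 -> Cmod (g (x, y)) <= K * exp (- (k * Rabs x)).
Hypothesis ghat_spec : forall j : Z,
  is_CRInt_line (fun u => g (u, 0%R) * exp_2pii (- (RtoC (IZR j) * (u, 0%R))))%C (ghat j).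

Let kernel (z : C) : C := (g z / (exp_2pii z - 1))%C.

Lemma ex_Cderive_kernel (x y : R) : Rabs y <= 1 -> (exp_2pii (x, y) - 1)%C <> RtoC 0 ->
  ex_Cderive kernel (x, y).
Proof.
  intros Hy den_neq_0. apply ex_Cderive_div; [now apply g_holo| |exact den_neq_0].
  eexists. apply is_Cderive_exp_2pii_minus_1.
Qed.

Lemma rect_int_kernel_unit (n : Z) :
  rect_int kernel (IZR n - / 2) (IZR n + / 2) (- (1)) 1 = g (RtoC (IZR n)).
Proof.
  assert (PI_pos := PI_RGT_0).
  assert (slope_neq_0 : (Ci * RtoC (2 * PI))%C <> RtoC 0)
    by (rewrite Cmult_comm; exact two_pi_i_neq_0).
  unfold kernel. rewrite (rect_int_simple_pole g (fun z => exp_2pii z - 1)%C (RtoC (IZR n))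
    (Ci * RtoC (2 * PI))%C); simpl; try lra; auto.
  - field. split; [apply RtoC_neq_0; lra|apply Ci_nz].
  - intros [x y] [_ Hy]. apply g_holo, Rabs_le. exact Hy.
  - intros z _. eexists. apply is_Cderive_exp_2pii_minus_1.
  - intros z [Hx _]. apply exp_2pii_minus_1_neq_0. apply Rabs_le. lra.
  - assert (derivative := is_Cderive_exp_2pii_minus_1 (RtoC (IZR n))).
    now rewrite exp_2pii_IZR, Cmult_1_r in derivative.
  - rewrite exp_2pii_IZR. ring.
Qed.

Lemma rect_int_kernel (N : nat) :
  rect_int kernel (- (INR N + / 2)) (INR N + / 2) (- (1)) 1 = sum_Z (fun n => g (RtoC (IZR n))) N.
Proof.
  assert (kernel_cont : forall x y, y = - (1) \/ y = 1 -> Ccontinuous kernel (x, y)).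
  { intros x y Hy. apply ex_Cderive_continuous, ex_Cderive_kernel; [apply Rabs_le; lra|].
    apply exp_2pii_minus_1_off_axis. lra. }
  induction N as [|N IHN].
  - simpl. rewrite <- (rect_int_kernel_unit 0). f_equal; ring.
  - assert (N_pos := pos_INR N). rewrite S_INR.
    rewrite (rect_int_split_x kernel _ (- (INR N + / 2))) by (lra || auto).
    rewrite (rect_int_split_x kernel (- (INR N + / 2)) (INR N + / 2)) by (lra || auto).
    rewrite IHN. change (sum_Z ?a (S N)) with (sum_Z a N + (a (Z.of_nat (S N)) + a (- Z.of_nat (S N))%Z))%C.
    cbv beta. rewrite <- !rect_int_kernel_unit, opp_IZR, <- INR_IZR_INZ, S_INR.
    replace (INR N + 1 - / 2) with (INR N + / 2) by field.
    replace (- (INR N + 1) + / 2) with (- (INR N + / 2)) by field.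
    replace (- (INR N + 1) - / 2) with (- (INR N + 1 + / 2)) by field. ring.
Qed.

Lemma is_CRInt_line_Fourier_height (j : Z) (y : R) : Rabs y <= 1 ->
  is_CRInt_line (fun s => g (s, y) * exp_2pii (- (RtoC (IZR j) * (s, y))))%C (ghat j).
Proof.
  intros Hy. assert (PI_pos := PI_RGT_0). apply Rabs_le_between in Hy.
  apply (is_CRInt_line_height (fun z => g z * exp_2pii (- (RtoC (IZR j) * z)))%C
    (- (1)) 1 (K * exp (2 * PI * Rabs (IZR j))) k 0 y); auto; try lra.
  - intros x u Hu. apply ex_Cderive_mult; [apply g_holo, Rabs_le; exact Hu|].
    apply ex_Cderive_cexp, ex_Cderive_mult; [apply ex_Cderive_const|].
    apply ex_Cderive_opp, ex_Cderive_mult; [apply ex_Cderive_const|apply ex_Cderive_id].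
  - intros x u Hu. assert (g_le := g_decay x u (Rabs_le _ _ Hu)).
    replace (- (RtoC (IZR j) * (x, u)))%C with ((- (IZR j * x), - (IZR j * u)) : C) by (Ccomponents; ring).
    rewrite Cmod_mult, Cmod_exp_2pii.
    replace (K * exp (2 * PI * Rabs (IZR j)) * exp (- (k * Rabs x)))
      with (K * exp (- (k * Rabs x)) * exp (2 * PI * Rabs (IZR j))) by ring.
    apply Rmult_le_compat; auto using Cmod_ge_0, Rlt_le, exp_pos.
    apply exp_le.
    assert (ju_le : IZR j * u <= Rabs (IZR j)).
    { assert (j_le := Rle_abs (IZR j)). assert (j_ge := Rle_abs (- IZR j)). rewrite Rabs_Ropp in j_ge. nra. }
    nra.
Qed.

(* On the line [Im z = sigma] with [sigma = 1] or [sigma = -1], [q = e^(2 pi i sigma z)] has modulus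
   [e^(-2 pi)], and [1 / (1 - q)] expands into a geometric series. *)
Section HalfLine.

Variable sigma : Z.
Hypothesis sigma_unit : sigma = 1%Z \/ sigma = (-1)%Z.

Let q (s : R) : C := exp_2pii (RtoC (IZR sigma) * (s, IZR sigma)).

Lemma Rabs_IZR_sign_le_1 : Rabs (IZR sigma) <= 1.
Proof. apply Rabs_le. destruct sigma_unit as [-> | ->]; lra. Qed.

Lemma Cmod_half_line_ratio (s : R) : Cmod (q s) = exp (- (2 * PI)).
Proof.
  unfold q. destruct sigma_unit as [-> | ->].
  - rewrite Cmult_1_l.
    rewrite Cmod_exp_2pii. f_equal. ring.
  - replace (RtoC (-1) * (s, (-1)%R))%C with (((- s)%R, 1%R) : C) by (Ccomponents; ring).
    rewrite Cmod_exp_2pii. f_equal. ring.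
Qed.

Lemma Cmod_1_minus_half_line_ratio_ge (s : R) : / 2 <= Cmod (1 - q s)%C.
Proof.
  assert (PI_gt_1 := PI2_1).
  assert (q_le_half : exp (- (2 * PI)) <= / 2).
  { rewrite exp_Ropp. apply Rinv_le_contravar; [lra|].
    assert (exp_ge := exp_ineq1 (2 * PI) ltac:(lra)). lra. }
  assert (triangle := Cmod_Cplus_ge 1 (- q s)). rewrite Cmod_opp, Cmod_1, Cmod_half_line_ratio in triangle.
  unfold Cminus. lra.
Qed.

Lemma one_minus_half_line_ratio_neq_0 (s : R) : (1 - q s)%C <> RtoC 0.
Proof. apply Cmod_gt_0. assert (q_ge := Cmod_1_minus_half_line_ratio_ge s). lra. Qed.

Definition half_line_integrand (s : R) : C := (g (s, IZR sigma) / (1 - q s))%C.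

Lemma Cmod_half_line_integrand_le (s : R) :
  Cmod (half_line_integrand s) <= 2 * K * exp (- (k * Rabs s)).
Proof.
  unfold half_line_integrand. rewrite Cmod_div by apply one_minus_half_line_ratio_neq_0.
  assert (q_ge := Cmod_1_minus_half_line_ratio_ge s). apply Rle_div_l; [lra|].
  assert (g_le := g_decay s (IZR sigma) Rabs_IZR_sign_le_1).
  assert (g_pos := Cmod_ge_0 (g (s, IZR sigma))). nra.
Qed.

Lemma ex_CRInt_half_line : exists l, is_CRInt_line half_line_integrand l.
Proof.
  apply (ex_CRInt_line_exp_decay _ (2 * K) k k_pos); [|exact Cmod_half_line_integrand_le].
  intros s. apply (continuous_horizontal (fun z => g z / (1 - exp_2pii (RtoC (IZR sigma) * z)))%C).
  apply ex_Cderive_continuous, ex_Cderive_div.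
  - apply g_holo, Rabs_IZR_sign_le_1.
  - apply ex_Cderive_minus; [apply ex_Cderive_const|].
    apply ex_Cderive_cexp, ex_Cderive_mult; [apply ex_Cderive_const|].
    apply ex_Cderive_mult; [apply ex_Cderive_const|apply ex_Cderive_id].
  - apply one_minus_half_line_ratio_neq_0.
Qed.

Lemma half_line_remainder (s : R) (N : nat) :
  (half_line_integrand s - Csum_n (fun n => g (s, IZR sigma) *
    exp_2pii (- (RtoC (IZR (- (sigma * Z.of_nat n))) * (s, IZR sigma)))) N)%C =
  (q s ^ S N * half_line_integrand s)%C.
Proof.
  assert (den_neq_0 := one_minus_half_line_ratio_neq_0 s).
  rewrite (sum_n_ext (G := C_R_NormedModule) _ (fun n => g (s, IZR sigma) * q s ^ n)%C).
  - rewrite Csum_n_Cmult, Csum_n_geometric.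
    + unfold half_line_integrand. simpl. field. exact den_neq_0.
    + intros q_eq_1. apply den_neq_0. rewrite q_eq_1. ring.
  - intros n. f_equal. unfold q, exp_2pii. rewrite <- cexp_INR_mult. f_equal.
    rewrite opp_IZR, mult_IZR, <- INR_IZR_INZ, RtoC_opp, (RtoC_mult (IZR sigma)). ring.
Qed.

Lemma Cmod_Fourier_half_remainder_le (l : C) (m : R) (N : nat) :
  is_CRInt_line half_line_integrand l -> is_RInt_line (fun x => exp (- (k * Rabs x))) m ->
  Cmod (l - Csum_n (fun n => ghat (- (sigma * Z.of_nat n))%Z) N)%C
    <= exp (- (2 * PI * INR (S N))) * (2 * K) * m.
Proof.
  intros Hl Hm.
  apply (Cmod_RInt_line_le (fun s => q s ^ S N * half_line_integrand s)%C
    (fun s => exp (- (2 * PI * INR (S N))) * (2 * K) * exp (- (k * Rabs s)))).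
  - intros s. rewrite Cmod_mult, Cmod_pow, Cmod_half_line_ratio, exp_pow.
    replace (INR (S N) * - (2 * PI)) with (- (2 * PI * INR (S N))) by ring.
    rewrite (Rmult_assoc _ (2 * K)). apply Rmult_le_compat_l; [apply Rlt_le, exp_pos|].
    apply Cmod_half_line_integrand_le.
  - apply (is_CRInt_line_ext _ _ _ (fun s => half_line_remainder s N)).
    apply is_CRInt_line_minus; [exact Hl|].
    apply (is_CRInt_line_sum_n (fun n s => g (s, IZR sigma) *
      exp_2pii (- (RtoC (IZR (- (sigma * Z.of_nat n))) * (s, IZR sigma))))%C).
    intros n. apply is_CRInt_line_Fourier_height, Rabs_IZR_sign_le_1.
  - apply (is_RInt_gen_scal (V := R_NormedModule)). exact Hm.
Qed.

Lemma is_series_Fourier_half (l : C) : is_CRInt_line half_line_integrand l ->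
  is_Cseries (fun n => ghat (- (sigma * Z.of_nat n))%Z) l.
Proof.
  intros Hl P HP. apply locally_Cmod in HP. destruct HP as (eps & eps_pos & HP).
  destruct (ex_RInt_line_exp_Rabs k k_pos) as [m Hm].
  assert (two_PI_pos : 0 < 2 * PI) by (assert (PI_pos := PI_RGT_0); lra).
  generalize (is_lim_seq_INR_plus 1 _
    (exp_opp_eventually_le (2 * PI) (2 * K * m) (eps / 2) two_PI_pos ltac:(lra))).
  unfold filtermap. apply filter_imp. intros N bound. apply HP.
  rewrite Cmod_Cminus_sym.
  eapply Rle_lt_trans; [exact (Cmod_Fourier_half_remainder_le l m N Hl Hm)|].
  rewrite S_INR. lra.
Qed.

End HalfLine.

Lemma is_CRInt_kernel_upper (l : C) :
  is_CRInt_line (half_line_integrand 1) l -> is_CRInt_line (fun s => kernel (s, 1)) (- l)%C.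
Proof.
  intros Hl. replace (- l)%C with (RtoC (-1) * l)%C by (Ccomponents; ring).
  apply (is_CRInt_line_ext (fun s => RtoC (-1) * half_line_integrand 1 s)%C);
    [|now apply is_CRInt_line_Cmult].
  intros s. unfold half_line_integrand, kernel. rewrite Cmult_1_l.
  assert (den_neq_0 := exp_2pii_minus_1_off_axis s 1 R1_neq_R0).
  replace (1 - exp_2pii (s, 1%R))%C with (RtoC (-1) * (exp_2pii (s, 1%R) - 1))%C by (Ccomponents; ring).
  field. exact den_neq_0.
Qed.

(* [1 / (w - 1) = 1 / (1 - 1 / w) - 1] with [w = e^(2 pi i z)]. *)
Lemma is_CRInt_kernel_lower (l : C) :
  is_CRInt_line (half_line_integrand (-1)) l ->
  is_CRInt_line (fun s => kernel (s, - (1))) (l - ghat 0)%C.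
Proof.
  intros Hl.
  apply (is_CRInt_line_ext (fun s => half_line_integrand (-1) s -
    g (s, (- (1))%R) * exp_2pii (- (RtoC (IZR 0) * (s, (- (1))%R))))%C).
  - intros s. unfold half_line_integrand, kernel.
    change (IZR (-1)) with (- (1))%R.
    assert (den_neq_0 := exp_2pii_minus_1_off_axis s (- (1)) ltac:(lra)).
    replace (RtoC (- (1)) * (s, (- (1))%R))%C with (- (s, (- (1))%R))%C by (Ccomponents; ring).
    replace (- (RtoC (IZR 0) * (s, (- (1))%R)))%C with (RtoC (INR 0)) by (Ccomponents; ring).
    rewrite exp_2pii_INR, exp_2pii_opp.
    assert (w_neq_0 := cexp_neq_0 (Ci * RtoC (2 * PI) * (s, (- (1))%R))).
    fold (exp_2pii (s, (- (1))%R)) in w_neq_0.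
    field. split; [exact den_neq_0|]. exact w_neq_0.
  - apply is_CRInt_line_minus; [exact Hl|].
    apply (is_CRInt_line_Fourier_height 0). rewrite Rabs_Ropp, Rabs_R1. lra.
Qed.

Lemma Cmod_exp_2pii_minus_1_sides_ge (N : nat) (x y : R) :
  Rabs x = INR N + / 2 -> 1 <= Cmod (exp_2pii (x, y) - 1)%C.
Proof.
  intros Hx. destruct (Rle_dec 0 x) as [x_pos|x_neg].
  - rewrite Rabs_pos_eq, INR_IZR_INZ in Hx by exact x_pos. rewrite Hx.
    apply Cmod_exp_2pii_minus_1_half_ge.
  - rewrite Rabs_left in Hx by lra.
    replace x with (IZR (- Z.of_nat (S N)) + / 2); [apply Cmod_exp_2pii_minus_1_half_ge|].
    rewrite opp_IZR, <- INR_IZR_INZ, S_INR. lra.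
Qed.

Lemma filterlim_rect_int_kernel (lower upper : C) :
  is_CRInt_line (half_line_integrand (-1)) lower -> is_CRInt_line (half_line_integrand 1) upper ->
  filterlim (fun N => rect_int kernel (- (INR N + / 2)) (INR N + / 2) (- (1)) 1)
    eventually (locally (T := C_UniformSpace) (lower + upper - ghat 0%Z)%C).
Proof.
  intros Hlower Hupper.
  assert (den_neq_0 : forall N x y, Rabs x = INR N + / 2 -> (exp_2pii (x, y) - 1)%C <> RtoC 0).
  { intros N x y Hx. apply Cmod_gt_0.
    assert (den_ge := Cmod_exp_2pii_minus_1_sides_ge N x y Hx). lra. }
  replace (lower + upper - ghat 0%Z)%C with (lower - ghat 0%Z - (- upper))%C by ring.
  apply (rect_int_lim_lines kernel _ _ _ _ (fun N => INR N + / 2) K k); try lra.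
  - intros n. assert (n_pos := pos_INR n). lra.
  - apply is_lim_seq_INR_plus.
  - now apply is_CRInt_kernel_lower.
  - now apply is_CRInt_kernel_upper.
  - intros N x y Hx Hy. apply ex_Cderive_continuous, ex_Cderive_kernel; [now apply Rabs_le|].
    now apply (den_neq_0 N).
  - intros N x y Hx Hy. unfold kernel. rewrite Cmod_div by now apply (den_neq_0 N).
    assert (den_ge := Cmod_exp_2pii_minus_1_sides_ge N x y Hx). apply Rle_div_l; [lra|].
    assert (g_le := g_decay x y (Rabs_le _ _ Hy)). assert (g_pos := Cmod_ge_0 (g (x, y))). nra.
Qed.

Lemma Poisson_summation : exists S : C,
  filterlim (sum_Z (fun n => g (RtoC (IZR n)))) eventually (locally (T := C_UniformSpace) S) /\
  filterlim (sum_Z ghat) eventually (locally (T := C_UniformSpace) S).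
Proof.
  destruct (ex_CRInt_half_line 1 (or_introl eq_refl)) as [upper Hupper].
  destruct (ex_CRInt_half_line (-1) (or_intror eq_refl)) as [lower Hlower].
  exists (lower + upper - ghat 0%Z)%C. split.
  - apply (filterlim_ext _ _ rect_int_kernel). now apply filterlim_rect_int_kernel.
  - apply (filterlim_ext (fun N => Csum_n (fun n => ghat (Z.of_nat n)) N +
      Csum_n (fun n => ghat (- Z.of_nat n)%Z) N - ghat 0%Z)%C).
    { intros N. symmetry. apply sum_Z_half_sums. }
    apply filterlim_Cminus; [apply filterlim_Cplus|apply filterlim_const].
    + apply (is_series_ext (V := C_R_NormedModule) (fun n => ghat (- (-1 * Z.of_nat n))%Z));
        [intros n; f_equal; lia|]. apply is_series_Fourier_half; auto.
    + apply (is_series_ext (V := C_R_NormedModule) (fun n => ghat (- (1 * Z.of_nat n))%Z));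
        [intros n; f_equal; lia|]. apply is_series_Fourier_half; auto.
Qed.

End Poisson.

(** * The Jacobi theta function *)

Lemma is_Cseries_RtoC (a : nat -> R) (l : R) :
  is_series a l -> is_Cseries (fun n => RtoC (a n)) (RtoC l).
Proof.
  intros Hl. apply (filterlim_ext (fun n => RtoC (sum_n a n))).
  - intros n. induction n as [|n IHn]; [now rewrite !sum_O|].
    rewrite !sum_Sn, <- IHn. apply RtoC_plus.
  - exact (filterlim_comp _ _ _ _ _ _ _ _ Hl (continuous_RtoC l)).
Qed.

Definition gauss (x : R) (z : C) : C := cexp (RtoC (- (PI * x)) * (z * z))%C.

Lemma gauss_RtoC (x u : R) : gauss x (RtoC u) = RtoC (exp (- (PI * x * (u * u)))).
Proof.
  unfold gauss. rewrite <- !RtoC_mult, cexp_RtoC. do 2 f_equal. ring.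
Qed.

Lemma ex_Cderive_gauss (x : R) (z : C) : ex_Cderive (gauss x) z.
Proof.
  apply ex_Cderive_cexp, ex_Cderive_mult; [apply ex_Cderive_const|].
  apply ex_Cderive_mult; apply ex_Cderive_id.
Qed.

Lemma Cmod_gauss_le (x Y s y : R) : 0 < x -> Rabs y <= Y ->
  Cmod (gauss x (s, y)) <= exp (PI * x * (1 + Y * Y)) * exp (- (2 * PI * x * Rabs s)).
Proof.
  intros x_pos Hy. unfold gauss. rewrite Cmod_cexp, <- exp_plus. apply exp_le.
  replace (Re (RtoC (- (PI * x)) * ((s, y) * (s, y)))%C) with (PI * x * (y * y - s * s))
    by (simpl; ring).
  replace (PI * x * (1 + Y * Y) + - (2 * PI * x * Rabs s))
    with (PI * x * (1 + Y * Y - 2 * Rabs s)) by ring.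
  apply Rmult_le_compat_l; [apply Rmult_le_pos; [apply Rlt_le, PI_RGT_0|lra]|].
  assert (y_sqr_le : y * y <= Y * Y).
  { rewrite <- Rabs_sqr. apply Rmult_le_compat; auto using Rabs_pos. }
  assert (s_sqr := Rabs_sqr s). assert (sqr_pos := Rle_0_sqr (Rabs s - 1)). unfold Rsqr in sqr_pos. lra.
Qed.

Lemma ex_CRInt_gauss (x : R) : 0 < x -> exists l, is_CRInt_line (fun u => gauss x (u, 0)) l.
Proof.
  intros x_pos.
  apply (ex_CRInt_line_exp_decay _ (exp (PI * x * (1 + 0 * 0))) (2 * PI * x)).
  - assert (PI_pos := PI_RGT_0). nra.
  - intros u. apply (continuous_horizontal (gauss x)), ex_Cderive_continuous, ex_Cderive_gauss.
  - intros u. apply Cmod_gauss_le; [exact x_pos|]. rewrite Rabs_R0. lra.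
Qed.

Lemma is_CRInt_gauss_height (x y : R) (l : C) : 0 < x ->
  is_CRInt_line (fun u => gauss x (u, 0)) l -> is_CRInt_line (fun u => gauss x (u, y)) l.
Proof.
  intros x_pos. assert (PI_pos := PI_RGT_0).
  assert (Hy := Rabs_le_between y (Rabs y)).
  apply (is_CRInt_line_height (gauss x) (- Rabs y) (Rabs y)
    (exp (PI * x * (1 + Rabs y * Rabs y))) (2 * PI * x)); try (nra || (apply Hy; lra)).
  - intros s u _. apply ex_Cderive_gauss.
  - intros s u Hu. apply Cmod_gauss_le; [exact x_pos|]. now apply Rabs_le.
Qed.

(* Completing the square moves the line of integration to height [xi / x]. *)
Lemma gauss_Fourier (x xi : R) (l : C) : 0 < x -> is_CRInt_line (fun u => gauss x (u, 0)) l ->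
  is_CRInt_line (fun u => gauss x (u, 0%R) * exp_2pii (- (RtoC xi * (u, 0%R))))%C
    (gauss (/ x) (RtoC xi) * l)%C.
Proof.
  intros x_pos Hl.
  apply (is_CRInt_line_ext (fun u => gauss (/ x) (RtoC xi) * gauss x (u, (xi / x)%R))%C).
  - intros u. unfold gauss, exp_2pii. rewrite <- !cexp_plus. f_equal.
    Ccomponents; field; lra.
  - apply is_CRInt_line_Cmult. now apply is_CRInt_gauss_height.
Qed.

Lemma is_CRInt_gauss_scale (x : R) (l : C) : 0 < x ->
  is_CRInt_line (fun u => gauss 1 (u, 0)) l ->
  is_CRInt_line (fun u => gauss x (u, 0)) (RtoC (/ sqrt x) * l)%C.
Proof.
  intros x_pos Hl. assert (sqrt_pos := sqrt_lt_R0 x x_pos).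
  apply (is_CRInt_line_ext (fun u => RtoC (/ sqrt x) *
    scal (sqrt x) (gauss 1 ((sqrt x * u + 0)%R, 0%R) : C_R_NormedModule))%C).
  - intros u. rewrite scal_R_Cmult, Cmult_assoc, <- RtoC_mult, Rinv_l, Cmult_1_l by lra.
    unfold gauss. f_equal. rewrite Rplus_0_r.
    replace (- (PI * x)) with (- (PI * 1) * (sqrt x * sqrt x)) by (rewrite sqrt_sqrt; lra).
    Ccomponents; ring.
  - apply is_CRInt_line_Cmult.
    now apply (is_RInt_line_comp_lin (V := C_R_NormedModule) (fun u => gauss 1 (u, 0))).
Qed.

Definition theta_term (x : R) (n : nat) : R := exp (- (PI * x * (INR (S n) * INR (S n)))).

Definition omega (x : R) : R := Series (theta_term x).

Lemma theta_term_le_geometric (x : R) (n : nat) : 0 < x ->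
  theta_term x n <= exp (- (PI * x)) * exp (- (PI * x)) ^ n.
Proof.
  intros x_pos. assert (PI_pos := PI_RGT_0). assert (n_pos := pos_INR n).
  unfold theta_term. rewrite exp_pow, <- exp_plus, S_INR. apply exp_le.
  assert (px_pos : 0 < PI * x) by nra.
   nra.
Qed.

Lemma is_series_theta_geometric (x : R) : 0 < x ->
  is_series (fun n => exp (- (PI * x)) * exp (- (PI * x)) ^ n) (exp (- (PI * x)) / (1 - exp (- (PI * x)))).
Proof.
  intros x_pos. assert (PI_pos := PI_RGT_0).
  apply (is_series_scal (V := R_NormedModule)), is_series_geom.
  rewrite Rabs_pos_eq by apply Rlt_le, exp_pos. apply exp_opp_lt_1. nra.
Qed.

Lemma is_series_omega (x : R) : 0 < x -> is_series (theta_term x) (omega x).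
Proof.
  intros x_pos. apply Series_correct.
  apply (ex_series_le (V := R_CompleteNormedModule) _
    (fun n => exp (- (PI * x)) * exp (- (PI * x)) ^ n)).
  - intros n. unfold norm; simpl. unfold abs; simpl.
    rewrite Rabs_pos_eq by apply Rlt_le, exp_pos. now apply theta_term_le_geometric.
  - eexists. now apply is_series_theta_geometric.
Qed.

Lemma omega_pos (x : R) : 0 < x -> 0 <= omega x.
Proof.
  intros x_pos. unfold omega. rewrite <- (Rmult_0_l (Series (theta_term x))), <- Series_scal_l.
  apply Series_le; [|eexists; now apply is_series_omega].
  intros n. rewrite Rmult_0_l. split; [lra|apply Rlt_le, exp_pos].
Qed.

Lemma omega_le_geometric (x : R) : 0 < x -> omega x <= exp (- (PI * x)) / (1 - exp (- (PI * x))).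
Proof.
  intros x_pos. rewrite <- (is_series_unique _ _ (is_series_theta_geometric x x_pos)).
  apply Series_le; [|eexists; now apply is_series_theta_geometric].
  intros n. split; [apply Rlt_le, exp_pos|now apply theta_term_le_geometric].
Qed.

Lemma sum_Z_gauss_lim (x : R) : 0 < x ->
  filterlim (sum_Z (fun n => gauss x (RtoC (IZR n)))) eventually
    (locally (T := C_UniformSpace) (RtoC (1 + 2 * omega x))).
Proof.
  intros x_pos.
  assert (half : is_Cseries (fun n => gauss x (RtoC (INR n))) (RtoC (1 + omega x))).
  { apply (is_series_ext (V := C_R_NormedModule) (fun n => RtoC (exp (- (PI * x * (INR n * INR n)))))).
    { intros n. symmetry. apply gauss_RtoC. }
    apply is_Cseries_RtoC, (is_series_decr_1 (V := R_NormedModule)).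
    replace (plus _ _) with (omega x); [now apply is_series_omega|].
    unfold plus, opp; simpl. rewrite !Rmult_0_r, Ropp_0, exp_0. ring. }
  apply (filterlim_ext (fun N => Csum_n (fun n => gauss x (RtoC (INR n))) N +
    Csum_n (fun n => gauss x (RtoC (INR n))) N - 1)%C).
  - intros N. rewrite sum_Z_half_sums. f_equal; [f_equal|].
    + apply (sum_n_ext (G := C_R_NormedModule)). intros n. now rewrite INR_IZR_INZ.
    + apply (sum_n_ext (G := C_R_NormedModule)). intros n.
      rewrite opp_IZR, <- INR_IZR_INZ, !gauss_RtoC. do 2 f_equal. ring.
    + rewrite gauss_RtoC, !Rmult_0_r, Ropp_0, exp_0. reflexivity.
  - replace (RtoC (1 + 2 * omega x)) with (RtoC (1 + omega x) + RtoC (1 + omega x) - 1)%C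
      by (rewrite <- RtoC_plus, <- RtoC_minus; f_equal; ring).
    apply filterlim_Cminus; [now apply filterlim_Cplus|apply filterlim_const].
Qed.

Lemma theta_Poisson (x : R) (l : C) : 0 < x -> is_CRInt_line (fun u => gauss x (u, 0)) l ->
  RtoC (1 + 2 * omega x) = (l * RtoC (1 + 2 * omega (/ x)))%C.
Proof.
  intros x_pos Hl. assert (PI_pos := PI_RGT_0).
  destruct (Poisson_summation (gauss x) (exp (PI * x * (1 + 1 * 1))) (2 * PI * x)
    (fun j => gauss (/ x) (RtoC (IZR j)) * l)%C) as (S & gauss_sum & Fourier_sum).
  - nra.
  - intros s y _. apply ex_Cderive_gauss.
  - intros s y Hy. now apply Cmod_gauss_le.
  - intros j. now apply gauss_Fourier.
  - transitivity S.
    + exact (filterlim_locally_unique (V := C_NormedModule) _ _ _ (sum_Z_gauss_lim x x_pos) gauss_sum).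
    + apply (filterlim_locally_unique (V := C_NormedModule) _ _ _ Fourier_sum).
      apply (filterlim_ext (fun N => l * sum_Z (fun j => gauss (/ x) (RtoC (IZR j))) N)%C).
      * intros N. induction N as [|N IHN]; simpl; [ring|]. rewrite <- IHN. ring.
      * apply filterlim_Cmult; [apply filterlim_const|].
        apply sum_Z_gauss_lim. now apply Rinv_0_lt_compat.
Qed.

(* The Gaussian integral follows from Poisson summation at the fixed point [x = 1]. *)
Lemma is_CRInt_gauss_1 : is_CRInt_line (fun u => gauss 1 (u, 0)) (RtoC 1).
Proof.
  destruct (ex_CRInt_gauss 1 Rlt_0_1) as [l Hl]. replace (RtoC 1) with l; [exact Hl|].
  assert (Poisson := theta_Poisson 1 l Rlt_0_1 Hl). rewrite Rinv_1 in Poisson.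
  assert (theta_neq_0 : RtoC (1 + 2 * omega 1) <> RtoC 0).
  { apply RtoC_neq_0. assert (omega_1_pos := omega_pos 1 Rlt_0_1). lra. }
  rewrite <- (Cmult_1_r l), <- (Cinv_r _ theta_neq_0), Cmult_assoc, <- Poisson. reflexivity.
Qed.

Lemma theta_modular (x : R) : 0 < x -> sqrt x * (1 + 2 * omega x) = 1 + 2 * omega (/ x).
Proof.
  intros x_pos. assert (sqrt_pos := sqrt_lt_R0 x x_pos).
  assert (Poisson := theta_Poisson x _ x_pos (is_CRInt_gauss_scale x _ x_pos is_CRInt_gauss_1)).
  rewrite <- !RtoC_mult in Poisson. apply RtoC_inj in Poisson. rewrite Poisson. field. lra.
Qed.

(** * The eta series and the zeta function *)

Lemma ln_INR_S_le (n m : nat) : (n <= m)%nat -> ln (INR (S n)) <= ln (INR (S m)).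
Proof. intros Hnm. apply ln_le; [apply lt_0_INR|apply le_INR]; lia. Qed.

Lemma ln_INR_S_pos (n : nat) : 0 <= ln (INR (S n)).
Proof. rewrite <- ln_1. apply (ln_INR_S_le 0 n). lia. Qed.

Lemma exp_opp_ln_lim (d : R) : 0 < d -> is_lim_seq (fun n => exp (- (d * ln (INR (S n))))) 0.
Proof.
  intros d_pos.
  assert (ln_lim : is_lim_seq (fun n => ln (INR (S n))) p_infty).
  { apply (is_lim_comp_seq ln (fun n => INR (S n)) p_infty p_infty is_lim_ln_p).
    - now apply filter_forall.
    - apply (is_lim_seq_incr_1 INR), is_lim_seq_INR. }
  apply (is_lim_comp_seq exp _ m_infty 0 is_lim_exp_m); [now apply filter_forall|].
  apply (is_lim_seq_opp _ p_infty).
  apply (is_lim_seq_mult (fun _ => d) (fun n => ln (INR (S n))) d p_infty);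
    [apply is_lim_seq_const|exact ln_lim|].
  apply is_Rbar_mult_sym, is_Rbar_mult_p_infty_pos. exact d_pos.
Qed.

Lemma Cmod_cexp_difference_le (s : C) (d a b : R) : 0 < d <= Re s -> 0 <= a <= b ->
  Cmod (cexp (- s * RtoC a) - cexp (- s * RtoC b))%C <= Cmod s / d * (exp (- (d * a)) - exp (- (d * b))).
Proof.
  intros Hd Hab. rewrite Cmod_Cminus_sym, !(Cmult_comm (- s)), Cmod_norm.
  apply (norm_RInt_le (V := C_R_NormedModule) (fun t => - s * cexp (RtoC t * - s))%C
    (fun t => Cmod s * exp (- (d * t))) a b); [lra| |apply is_CRInt_cexp|apply is_RInt_exp_decay; lra].
  intros t Ht. rewrite <- Cmod_norm, Cmod_mult, Cmod_opp, Cmod_cexp, re_scal_l.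
  apply Rmult_le_compat_l; [apply Cmod_ge_0|]. apply exp_le.
  change (Re (- s)%C) with (- Re s). nra.
Qed.

Definition eta_pair (s : C) (m : nat) : C :=
  (Rcpow (INR (S (2 * m))) (- s) - Rcpow (INR (S (S (2 * m)))) (- s))%C.

Definition eta_tail (s : C) (d : R) (m : nat) : R := Cmod s / d * exp (- (d * ln (INR (S (2 * m))))).

Lemma Cmod_eta_pair_le (s : C) (d : R) (m : nat) : 0 < d <= Re s ->
  Cmod (eta_pair s m) <= eta_tail s d m - eta_tail s d (S m).
Proof.
  intros Hd. unfold eta_pair, eta_tail, Rcpow.
  eapply Rle_trans.
  { apply (Cmod_cexp_difference_le s d); [exact Hd|]. split; [apply ln_INR_S_pos|apply ln_INR_S_le; lia]. }
  rewrite <- Rmult_minus_distr_l. apply Rmult_le_compat_l.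
  - apply Rmult_le_pos; [apply Cmod_ge_0|]. apply Rlt_le, Rinv_0_lt_compat. lra.
  - apply Rplus_le_compat_l, Ropp_le_contravar, exp_le.
    assert (ln_le_next := ln_INR_S_le (S (2 * m)) (2 * S m) ltac:(lia)). nra.
Qed.

Lemma eta_tail_lim (s : C) (d : R) : 0 < d -> is_lim_seq (eta_tail s d) 0.
Proof.
  intros d_pos. replace (Finite 0) with (Rbar_mult (Cmod s / d) 0) by (simpl; f_equal; ring).
  apply is_lim_seq_scal_l.
  apply (filterlim_eventually_subseq (U := R_UniformSpace) (fun n => exp (- (d * ln (INR (S n)))))
    0 (fun m => 2 * m)%nat); [intros; lia|]. now apply exp_opp_ln_lim.
Qed.

Lemma eta_terms_lim (s : C) : 0 < Re s ->
  filterlim (fun n => Rcpow (INR (S n)) (- s)) eventually (locally (T := C_UniformSpace) (RtoC 0)).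
Proof.
  intros Hs. apply (filterlim_norm_zero (V := C_R_NormedModule)). intros P HP.
  generalize (exp_opp_ln_lim (Re s) Hs P HP). unfold filtermap. apply filter_imp.
  intros n Hn. rewrite <- Cmod_norm, Cmod_Rcpow. change (Re (- s)%C) with (- Re s).
  now rewrite <- Ropp_mult_distr_l.
Qed.

Lemma is_series_eta_pair (s : C) : 0 < Re s -> is_Cseries (eta_pair s) (eta s).
Proof.
  intros Hs.
  destruct (ex_series_telescoping (V := C_R_CompleteNormedModule) (eta_pair s) (eta_tail s (Re s)))
    as [l Hl].
  - intros m. rewrite <- Cmod_norm. apply Cmod_eta_pair_le. lra.
  - now apply eta_tail_lim.
  - replace (eta s) with l; [exact Hl|]. symmetry. apply is_CSeries_unique.
    apply (is_series_ext (V := C_R_NormedModule)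
      (fun n => scal ((-1) ^ n) (Rcpow (INR (S n)) (- s) : C_R_NormedModule)));
      [intros n; apply scal_R_Cmult|].
    now apply (is_series_alternating (V := C_R_NormedModule)); [apply eta_terms_lim|].
Qed.

Lemma Cmod_eta_remainder_le (s : C) (d : R) (n : nat) : 0 < d <= Re s ->
  Cmod (eta s - Csum_n (eta_pair s) n)%C <= eta_tail s d (S n).
Proof.
  intros Hd. rewrite Cmod_norm.
  apply (norm_remainder_telescoping_le (V := C_R_NormedModule) (eta_pair s)).
  - intros m. rewrite <- Cmod_norm. now apply Cmod_eta_pair_le.
  - apply eta_tail_lim. lra.
  - apply is_series_eta_pair. lra.
Qed.

Lemma Cmod_eta_le (s : C) (d : R) : 0 < d <= Re s -> Cmod (eta s) <= Cmod s / d.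
Proof.
  intros Hd. rewrite Cmod_norm. replace (Cmod s / d) with (eta_tail s d 0).
  - apply (norm_series_telescoping_le (V := C_R_NormedModule) (eta_pair s)).
    + intros m. rewrite <- Cmod_norm. now apply Cmod_eta_pair_le.
    + apply eta_tail_lim. lra.
    + apply is_series_eta_pair. lra.
  - unfold eta_tail. simpl. rewrite ln_1, Rmult_0_r, Ropp_0, exp_0. ring.
Qed.

Lemma ex_Cderive_Csum_n (a : nat -> C -> C) (n : nat) (z : C) : (forall k, ex_Cderive (a k) z) ->
  ex_Cderive (fun w => Csum_n (fun k => a k w) n) z.
Proof.
  intros Ha. induction n as [|n IHn].
  - apply (ex_derive_ext (V := C_NormedModule) (a O)); [|apply Ha]. intros w. now rewrite sum_O.
  - apply (ex_derive_ext (V := C_NormedModule) (fun w => Csum_n (fun k => a k w) n + a (S n) w)%C).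
    + intros w. now rewrite sum_Sn.
    + now apply ex_Cderive_plus.
Qed.

Lemma ex_Cderive_Rcpow (b : R) (f : C -> C) (z : C) :
  ex_Cderive f z -> ex_Cderive (fun w => Rcpow b (f w)) z.
Proof. intros Hf. apply ex_Cderive_cexp, ex_Cderive_mult; [exact Hf|apply ex_Cderive_const]. Qed.

Lemma ex_Cderive_eta (s : C) : 0 < Re s -> ex_Cderive eta s.
Proof.
  intros Hs. set (d := Re s / 2). set (M := (Cmod s + d)%R).
  assert (in_disc : forall z, Cmod (z - s)%C < d -> d <= Re z /\ Cmod z <= M).
  { intros z Hz. split.
    - assert (re_le := re_le_Cmod (z - s)%C). apply Rabs_le_between in re_le.
      rewrite Re_Cminus in re_le. unfold d in *. lra.
    - replace z with (s + (z - s))%C by ring. eapply Rle_trans; [apply Cmod_triangle|unfold M; lra]. }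
  apply (ex_Cderive_uniform_limit (fun n w => Csum_n (eta_pair w) n) eta s d); [unfold d; lra| |].
  - intros n z _. apply (ex_Cderive_Csum_n (fun k w => eta_pair w k)). intros k.
    apply ex_Cderive_minus; apply ex_Cderive_Rcpow, ex_Cderive_opp, ex_Cderive_id.
  - intros eps eps_pos.
    destruct (proj2 (is_lim_seq_spec _ _) (eta_tail_lim (RtoC M) d ltac:(unfold d; lra))
      (mkposreal eps eps_pos)) as [N HN].
    exists N. intros n Hn z Hz. destruct (in_disc z Hz) as [re_ge mod_le].
    rewrite Cmod_Cminus_sym.
    eapply Rle_trans; [apply (Cmod_eta_remainder_le z d); unfold d in *; lra|].
    apply Rle_trans with (eta_tail (RtoC M) d (S n)).
    + unfold eta_tail. apply Rmult_le_compat_r; [apply Rlt_le, exp_pos|].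
      apply Rmult_le_compat_r; [apply Rlt_le, Rinv_0_lt_compat; unfold d; lra|].
      rewrite Cmod_R. eapply Rle_trans; [exact mod_le|apply Rle_abs].
    + specialize (HN (S n) ltac:(lia)). simpl in HN. rewrite Rminus_0_r in HN.
      apply Rlt_le. eapply Rle_lt_trans; [apply Rle_abs|exact HN].
Qed.

Lemma Cmod_zeta_denominator_ge (s : C) (d : R) : Re s <= 1 - d ->
  exp (d * ln 2) - 1 <= Cmod (1 - Rcpow 2 (1 - s))%C.
Proof.
  intros Hs. rewrite Cmod_Cminus_sym. unfold Cminus.
  eapply Rle_trans; [|apply Cmod_Cplus_ge]. rewrite Cmod_opp, Cmod_1, Cmod_Rcpow.
  apply Rplus_le_compat_r, exp_le, Rmult_le_compat_r.
  - rewrite <- ln_1. apply ln_le; lra.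
  - change (Re (1 + - s)%C) with (1 + - Re s). lra.
Qed.

Lemma exp_ln_2_gt_1 (d : R) : 0 < d -> 0 < exp (d * ln 2) - 1.
Proof.
  intros d_pos. assert (ln_2_pos := ln_lt_2).
  assert (exp_ge := exp_ineq1 (d * ln 2)). nra.
Qed.

Lemma zeta_denominator_neq_0 (s : C) : Re s < 1 -> (1 - Rcpow 2 (1 - s))%C <> RtoC 0.
Proof.
  intros Hs. apply Cmod_gt_0.
  eapply Rlt_le_trans; [|apply (Cmod_zeta_denominator_ge s (1 - Re s)); lra].
  apply exp_ln_2_gt_1. lra.
Qed.

Lemma Cmod_zeta_le (s : C) (d : R) : 0 < d <= Re s -> Re s <= 1 - d ->
  Cmod (zeta s) <= Cmod s / d / (exp (d * ln 2) - 1).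
Proof.
  intros Hd Hs. unfold zeta. assert (den_pos := exp_ln_2_gt_1 d ltac:(lra)).
  rewrite Cmod_div by (apply zeta_denominator_neq_0; lra).
  apply Rmult_le_compat; [apply Cmod_ge_0| |now apply Cmod_eta_le|].
  - apply Rlt_le, Rinv_0_lt_compat, Cmod_gt_0, zeta_denominator_neq_0. lra.
  - apply Rinv_le_contravar; [exact den_pos|apply Cmod_zeta_denominator_ge; lra].
Qed.

Lemma ex_Cderive_zeta (s : C) : 0 < Re s < 1 -> ex_Cderive zeta s.
Proof.
  intros Hs. apply ex_Cderive_div; [apply ex_Cderive_eta; lra| |apply zeta_denominator_neq_0; lra].
  apply ex_Cderive_minus; [apply ex_Cderive_const|].
  apply ex_Cderive_Rcpow, ex_Cderive_minus; [apply ex_Cderive_const|apply ex_Cderive_id].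
Qed.

Lemma CSeries_conj (a : nat -> C) : CSeries (fun n => Cconj (a n)) = Cconj (CSeries a).
Proof.
  unfold CSeries. apply injective_projections; simpl; [reflexivity|].
  exact (Series_opp (fun n => Im (a n))).
Qed.

Lemma eta_conj (s : C) : eta (Cconj s) = Cconj (eta s).
Proof.
  unfold eta. rewrite <- CSeries_conj.
  unfold CSeries. f_equal; apply Series_ext; intros n;
    now rewrite <- Copp_conj, Rcpow_conj, Cmult_conj, Cconj_RtoC.
Qed.

Lemma zeta_conj (s : C) : Re s < 1 -> zeta (Cconj s) = Cconj (zeta s).
Proof.
  intros Hs. unfold zeta.
  rewrite Cdiv_conj, Cminus_conj, <- Rcpow_conj, Cminus_conj, Cconj_RtoC, eta_conj
    by now apply zeta_denominator_neq_0.
  reflexivity.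
Qed.

(** * Mellin transforms and the functional equation *)

(* The Mellin transform of [f] at [z] after the substitution [u = e^v], which turns scaling into
   translation and inversion into reflection. *)
Definition is_Mellin (f : R -> R) (z l : C) : Prop :=
  is_CRInt_line (fun v => RtoC (f (exp v)) * cexp (RtoC v * z))%C l.

Lemma is_Mellin_ext (f g : R -> R) (z l : C) : (forall u, 0 < u -> f u = g u) ->
  is_Mellin f z l -> is_Mellin g z l.
Proof.
  intros fg Hf. refine (is_CRInt_line_ext _ _ _ _ Hf). intros v. now rewrite fg by apply exp_pos.
Qed.

Lemma is_Mellin_plus (f g : R -> R) (z l m : C) : is_Mellin f z l -> is_Mellin g z m ->
  is_Mellin (fun u => f u + g u) z (l + m)%C.
Proof.
  intros Hf Hg. refine (is_CRInt_line_ext _ _ _ _ (is_CRInt_line_plus _ _ _ _ Hf Hg)).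
  intros v. rewrite RtoC_plus. ring.
Qed.

Lemma is_Mellin_scal (k : R) (f : R -> R) (z l : C) : is_Mellin f z l ->
  is_Mellin (fun u => k * f u) z (RtoC k * l)%C.
Proof.
  intros Hf. refine (is_CRInt_line_ext _ _ _ _ (is_CRInt_line_Cmult (RtoC k) _ _ Hf)).
  intros v. rewrite RtoC_mult. ring.
Qed.

Lemma is_Mellin_minus (f g : R -> R) (z l m : C) : is_Mellin f z l -> is_Mellin g z m ->
  is_Mellin (fun u => f u - g u) z (l - m)%C.
Proof.
  intros Hf Hg. refine (is_CRInt_line_ext _ _ _ _ (is_CRInt_line_minus _ _ _ _ Hf Hg)).
  intros v. rewrite RtoC_minus. ring.
Qed.

Lemma is_Mellin_sum_n (f : nat -> R -> R) (z : C) (l : nat -> C) (n : nat) :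
  (forall k, is_Mellin (f k) z (l k)) -> is_Mellin (fun u => sum_n (fun k => f k u) n) z (Csum_n l n).
Proof.
  intros Hl. induction n as [|n IHn].
  - rewrite sum_O. apply (is_Mellin_ext (f O)); [|apply Hl]. intros u _. now rewrite sum_O.
  - rewrite sum_Sn. apply (is_Mellin_ext (fun u => sum_n (fun k => f k u) n + f (S n) u)).
    + intros u _. now rewrite sum_Sn.
    + now apply is_Mellin_plus.
Qed.

Lemma is_Mellin_scale (a : R) (f : R -> R) (z l : C) : 0 < a -> is_Mellin f z l ->
  is_Mellin (fun u => f (a * u)) z (Rcpow a (- z) * l)%C.
Proof.
  intros a_pos Hf.
  refine (is_CRInt_line_ext _ _ _ _ (is_CRInt_line_Cmult (Rcpow a (- z)) _ _
    (is_RInt_line_shift (V := C_R_NormedModule) _ (ln a) _ Hf))).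
  intros v. rewrite exp_plus, exp_ln, (Rmult_comm (exp v)) by exact a_pos.
  rewrite Cmult_assoc, (Cmult_comm (Rcpow a (- z))), <- Cmult_assoc. f_equal.
  unfold Rcpow. rewrite <- cexp_plus. f_equal. rewrite RtoC_plus. ring.
Qed.

Lemma is_Mellin_reflect (f : R -> R) (z l : C) : is_Mellin f z l ->
  is_Mellin (fun u => f (/ u)) (- z) l.
Proof.
  intros Hf. refine (is_CRInt_line_ext _ _ _ _ (is_RInt_line_reflect (V := C_R_NormedModule) _ _ Hf)).
  intros v. rewrite exp_Ropp. do 2 f_equal. rewrite RtoC_opp. ring.
Qed.

Lemma is_Mellin_sqrt (f : R -> R) (z l : C) : is_Mellin (fun u => sqrt u * f u) z l ->
  is_Mellin f (z + RtoC (/ 2))%C l.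
Proof.
  intros Hf. refine (is_CRInt_line_ext _ _ _ _ Hf). intros v.
  rewrite sqrt_exp, RtoC_mult, (Cmult_comm (RtoC (exp _))), <- Cmult_assoc, <- cexp_RtoC, <- cexp_plus.
  do 2 f_equal. unfold Rdiv. rewrite RtoC_mult. ring.
Qed.

Lemma Cmod_Mellin_le (f g : R -> R) (z l m : C) : (forall u, 0 < u -> Rabs (f u) <= g u) ->
  is_Mellin f z l -> is_Mellin g (RtoC (Re z)) m -> Cmod l <= Cmod m.
Proof.
  intros fg Hf Hg. apply Rle_trans with (Re m).
  - apply (Cmod_RInt_line_le _ (fun v => Re (RtoC (g (exp v)) * cexp (RtoC v * RtoC (Re z)))%C) l)
      with (2 := Hf).
    + intros v. rewrite <- RtoC_mult, cexp_RtoC, <- RtoC_mult, Cmod_mult, Cmod_R, Cmod_cexp, re_scal_l.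
      apply Rmult_le_compat_r; [apply Rlt_le, exp_pos|apply fg, exp_pos].
    + apply (is_RInt_gen_linear (U := C_R_NormedModule) (V := R_NormedModule) _ _ Re);
        [exact is_linear_fst|exact Hg].
  - eapply Rle_trans; [apply Rle_abs|apply re_le_Cmod].
Qed.

Lemma ex_Mellin_exp_bound (f : R -> R) (z : C) (K c : R) : 0 < c ->
  (forall u, 0 < u -> continuous f u) ->
  (forall v, Rabs (f (exp v)) * exp (v * Re z) <= K * exp (- (c * Rabs v))) ->
  exists l, is_Mellin f z l.
Proof.
  intros c_pos f_cont f_le. apply (ex_CRInt_line_exp_decay _ K c c_pos).
  - intros v. apply continuous_Cmult.
    + apply (continuous_comp (fun v => f (exp v)) RtoC); [|apply continuous_RtoC].
      apply (continuous_comp exp f); [|apply f_cont, exp_pos].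
      apply (ex_derive_continuous (V := R_NormedModule)). auto_derive. auto.
    + apply (ex_derive_continuous (V := C_R_NormedModule)). eexists. apply is_derive_cexp_real.
  - intros v. rewrite Cmod_mult, Cmod_R, Cmod_cexp, re_scal_l. apply f_le.
Qed.

Lemma is_RInt_gen_exp_substitution {V : CompleteNormedModule R_AbsRing} (f : R -> V) (l : V) :
  (forall u, 0 < u -> continuous f u) -> is_RInt_line (fun v => scal (exp v) (f (exp v))) l ->
  is_RInt_gen f (at_right 0) (Rbar_locally p_infty) l.
Proof.
  intros f_cont Hl P HP. destruct (Hl P HP) as [Q S [M_minus HQ] [M_plus HS] HQS].
  apply Filter_prod with (fun a => 0 < a /\ Q (ln a)) (fun b => 0 < b /\ S (ln b)).
  - exists (mkposreal _ (exp_pos M_minus)). intros a Ha a_pos. split; [exact a_pos|]. apply HQ.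
    rewrite <- (ln_exp M_minus). apply ln_increasing; [exact a_pos|].
    change (Rabs (a - 0) < exp M_minus) in Ha. rewrite Rminus_0_r, Rabs_pos_eq in Ha; lra.
  - exists (exp M_plus). intros b Hb. assert (exp_M_pos := exp_pos M_plus). split; [lra|]. apply HS.
    rewrite <- (ln_exp M_plus). apply ln_increasing; lra.
  - intros a b [a_pos Qa] [b_pos Sb]. destruct (HQS _ _ Qa Sb) as [y [Hy Py]].
    exists y. split; [|exact Py].
    assert (substitution := is_RInt_comp f exp exp (ln a) (ln b)).
    simpl in *. rewrite !exp_ln in substitution by assumption.
    rewrite <- (is_RInt_unique _ _ _ _ Hy). erewrite is_RInt_unique.
    2:{ apply substitution.
        - intros v _. apply f_cont, exp_pos.
        - intros v _. split; [apply is_derive_exp|].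
          apply (ex_derive_continuous (V := R_NormedModule)). auto_derive. auto. }
    apply RInt_correct, ex_RInt_continuous. intros u Hu. apply f_cont.
    eapply Rlt_le_trans; [apply (Rmin_pos a b a_pos b_pos)|apply Hu].
Qed.

Lemma continuous_Rcpow (z : C) (u : R) : 0 < u -> continuous (U := C_UniformSpace) (fun u => Rcpow u z) u.
Proof.
  intros u_pos. apply (continuous_ext (fun u => cexp (RtoC (ln u) * z)%C)).
  - intros w. unfold Rcpow. f_equal. ring.
  - apply (continuous_comp ln (fun t => cexp (RtoC t * z)%C)).
    + apply (ex_derive_continuous (V := R_NormedModule)). auto_derive. exact u_pos.
    + apply (ex_derive_continuous (V := C_R_NormedModule)). eexists. apply is_derive_cexp_real.
Qed.

Lemma CGamma_Mellin (z l : C) : is_Mellin (fun u => exp (- u)) z l -> CGamma z = l.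
Proof.
  intros Hl. unfold CGamma. apply (is_RInt_gen_unique (V := C_R_CompleteNormedModule)).
  apply (is_RInt_gen_exp_substitution (V := C_R_CompleteNormedModule)).
  - intros u u_pos. apply continuous_Cmult; [now apply continuous_Rcpow|].
    apply (continuous_comp (fun u => exp (- u)) RtoC); [|apply continuous_RtoC].
    apply (ex_derive_continuous (V := R_NormedModule)). auto_derive. auto.
  - refine (is_CRInt_line_ext _ _ _ _ Hl). intros v.
    rewrite scal_R_Cmult, <- !cexp_RtoC. unfold Rcpow. rewrite ln_exp, <- !cexp_plus. f_equal. ring.
Qed.

Lemma sqr_div_4_le_exp (v : R) : 0 <= v -> v * v / 4 <= exp v.
Proof.
  intros Hv. replace v with (v / 2 + v / 2) at 3 by field. rewrite exp_plus.
  assert (exp_ge := exp_ineq1_le (v / 2)). nra.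
Qed.

Lemma is_Mellin_CGamma (z : C) : 0 < Re z -> is_Mellin (fun u => exp (- u)) z (CGamma z).
Proof.
  intros Hz. destruct (ex_Mellin_exp_bound (fun u => exp (- u)) z (exp (4 * (Re z * Re z))) (Re z) Hz)
    as [l Hl].
  - intros u _. apply (ex_derive_continuous (V := R_NormedModule)). auto_derive. auto.
  - intros v. rewrite Rabs_pos_eq by apply Rlt_le, exp_pos. rewrite <- !exp_plus. apply exp_le.
    assert (exp_v_pos := exp_pos v). destruct (Rle_dec 0 v) as [v_pos|v_neg].
    + rewrite Rabs_pos_eq by exact v_pos. assert (exp_ge := sqr_div_4_le_exp v v_pos).
      assert (square := Rle_0_sqr (v / 2 - 2 * Re z)). unfold Rsqr in square. nra.
    + rewrite Rabs_left by lra. nra.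
  - now rewrite (CGamma_Mellin z l Hl).
Qed.

Lemma CGamma_conj (z : C) : 0 < Re z -> CGamma (Cconj z) = Cconj (CGamma z).
Proof.
  intros Hz. apply CGamma_Mellin.
  refine (is_CRInt_line_ext _ _ _ _ (is_CRInt_line_conj _ _ (is_Mellin_CGamma z Hz))).
  intros v. now rewrite Cmult_conj, cexp_conj, Cmult_conj, !Cconj_RtoC.
Qed.

(* [1 / (2 sqrt x)] is the asymptotic value of [omega x] at [0]; once it is removed,
   the Mellin transform converges exactly in the critical strip. *)
Definition phi (x : R) : R := omega x - / (2 * sqrt x).

Lemma phi_inv (x : R) : 0 < x -> phi (/ x) = sqrt x * phi x.
Proof.
  intros x_pos. assert (modular := theta_modular x x_pos). assert (sqrt_pos := sqrt_lt_R0 x x_pos).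
  unfold phi. rewrite sqrt_inv.
  replace (/ (2 * / sqrt x)) with (sqrt x / 2) by (field; lra).
  replace (sqrt x * (omega x - / (2 * sqrt x))) with (sqrt x * omega x - / 2) by (field; lra).
  lra.
Qed.

Lemma omega_le_inv_sqrt (x : R) : 1 <= x -> omega x <= / sqrt x.
Proof.
  intros Hx. assert (PI_gt_1 := PI2_1).
  eapply Rle_trans; [apply omega_le_geometric; lra|]. rewrite exp_Ropp.
  assert (exp_ge : 1 + x <= exp (PI * x)).
  { eapply Rle_trans; [|apply exp_ineq1_le]. nra. }
  replace (/ exp (PI * x) / (1 - / exp (PI * x))) with (/ (exp (PI * x) - 1)) by (field; lra).
  apply Rinv_le_contravar; [apply sqrt_lt_R0; lra|].
  apply Rle_trans with x; [|lra].
  rewrite <- (sqrt_square x) at 2 by lra. apply sqrt_le_1; nra.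
Qed.

Lemma Rabs_phi_exp_le_pos (v : R) : 0 <= v -> Rabs (phi (exp v)) <= exp (- (v / 2)).
Proof.
  intros Hv. assert (exp_ge_1 : 1 <= exp v) by (rewrite <- exp_0; now apply exp_le).
  assert (omega_le := omega_le_inv_sqrt (exp v) exp_ge_1).
  assert (omega_ge := omega_pos (exp v) ltac:(lra)).
  unfold phi. rewrite sqrt_exp in *. rewrite exp_Ropp. assert (exp_half_pos := exp_pos (v / 2)).
  replace (/ (2 * exp (v / 2))) with (/ exp (v / 2) / 2) by (field; lra).
  apply Rabs_le. lra.
Qed.

Lemma Rabs_phi_exp_le_neg (v : R) : v <= 0 -> Rabs (phi (exp v)) <= 1.
Proof.
  intros Hv. rewrite <- (Rinv_inv (exp v)), <- exp_Ropp.
  rewrite phi_inv, sqrt_exp, Rabs_mult, Rabs_pos_eq by (apply Rlt_le, exp_pos || apply exp_pos).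
  rewrite <- exp_0. replace 0 with (- v / 2 + - (- v / 2)) by ring. rewrite exp_plus.
  apply Rmult_le_compat_l; [apply Rlt_le, exp_pos|]. apply Rabs_phi_exp_le_pos. lra.
Qed.

Lemma Rabs_theta_remainder_le (x y : R) (N : nat) : 0 < x <= y ->
  Rabs (omega y - sum_n (theta_term y) N) <= exp (- (PI * x)) ^ S (S N) / (1 - exp (- (PI * x))).
Proof.
  intros Hxy. assert (PI_pos := PI_RGT_0). set (q := exp (- (PI * x))).
  assert (q_lt_1 : q < 1) by (apply exp_opp_lt_1; nra).
  assert (q_pos : 0 < q) by apply exp_pos.
  apply (norm_remainder_telescoping_le (V := R_NormedModule) (theta_term y)
    (fun n => q ^ S n / (1 - q)) (omega y) N).
  - intros n. unfold norm; simpl. unfold abs; simpl. rewrite Rabs_pos_eq by apply Rlt_le, exp_pos.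
    eapply Rle_trans; [apply theta_term_le_geometric; lra|].
    replace (q * q ^ n / (1 - q) - q * (q * q ^ n) / (1 - q)) with (q ^ S n) by (simpl; field; lra).
    apply (pow_incr _ _ (S n)). split; [apply Rlt_le, exp_pos|]. apply exp_le. nra.
  - apply (is_lim_seq_ext (fun n => q / (1 - q) * q ^ n)); [intros n; simpl; field; lra|].
    replace (Finite 0) with (Rbar_mult (q / (1 - q)) 0) by (simpl; f_equal; ring).
    apply is_lim_seq_scal_l, is_lim_seq_geom. now rewrite Rabs_pos_eq by lra.
  - apply is_series_omega. lra.
Qed.

Lemma continuous_omega (x : R) : 0 < x -> continuous omega x.
Proof.
  intros x_pos. set (q := exp (- (PI * (x / 2)))). assert (PI_pos := PI_RGT_0).
  assert (q_lt_1 : q < 1) by (apply exp_opp_lt_1; nra). assert (q_pos : 0 < q) by apply exp_pos.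
  apply (continuous_comp (fun y => RtoC (omega y)) (fun z : C => fst z)); [|apply continuous_fst].
  apply (continuous_uniform_limit (fun N y => RtoC (sum_n (theta_term y) N))).
  - intros N. apply (continuous_comp (fun y => sum_n (theta_term y) N) RtoC); [|apply continuous_RtoC].
    induction N as [|N IHN].
    + apply (continuous_ext (fun y => theta_term y 0)); [intros y; now rewrite sum_O|].
      apply (ex_derive_continuous (V := R_NormedModule)). unfold theta_term. auto_derive. auto.
    + apply (continuous_ext (fun y => plus (sum_n (theta_term y) N) (theta_term y (S N))));
        [intros y; now rewrite sum_Sn|].
      apply (continuous_plus (V := R_NormedModule)); [exact IHN|].
      apply (ex_derive_continuous (V := R_NormedModule)). unfold theta_term. auto_derive. auto.
  - intros eps eps_pos.
    assert (tail_lim := is_lim_seq_geom q ltac:(rewrite Rabs_pos_eq; lra)).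
    destruct (proj2 (is_lim_seq_spec _ _) tail_lim (mkposreal (eps * (1 - q)) ltac:(nra))) as [N HN].
    exists N. exists (mkposreal (x / 2) ltac:(lra)). intros y Hy.
    apply Rabs_lt_between in Hy. simpl in Hy. unfold minus, plus, opp in Hy; simpl in Hy.
    rewrite <- RtoC_minus, Cmod_R, Rabs_minus_sym.
    eapply Rle_trans; [apply (Rabs_theta_remainder_le (x / 2)); lra|]. fold q.
    apply Rle_div_l; [lra|]. specialize (HN (S (S N)) ltac:(lia)). simpl in HN.
    rewrite Rminus_0_r, Rabs_pos_eq in HN; [simpl; lra|].
    apply (pow_le q (S (S N))). lra.
Qed.

Lemma continuous_phi (x : R) : 0 < x -> continuous phi x.
Proof.
  intros x_pos. assert (sqrt_pos := sqrt_lt_R0 x x_pos).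
  apply (continuous_minus (V := R_NormedModule) omega (fun x => / (2 * sqrt x)));
    [now apply continuous_omega|].
  apply (ex_derive_continuous (V := R_NormedModule)). auto_derive. repeat split; lra.
Qed.

Lemma ex_Mellin_phi (z : C) : 0 < Re z < / 2 -> exists l, is_Mellin phi z l.
Proof.
  intros Hz. set (c := Rmin (Re z) (/ 2 - Re z)).
  assert (c_le_left : c <= Re z) by apply Rmin_l. assert (c_le_right : c <= / 2 - Re z) by apply Rmin_r.
  apply (ex_Mellin_exp_bound phi z 1 c); [apply Rmin_pos; lra|exact continuous_phi|].
  intros v. rewrite Rmult_1_l. destruct (Rle_dec 0 v) as [v_pos|v_neg].
  - apply Rle_trans with (exp (- (v / 2)) * exp (v * Re z)).
    + apply Rmult_le_compat_r; [apply Rlt_le, exp_pos|now apply Rabs_phi_exp_le_pos].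
    + rewrite <- exp_plus, Rabs_pos_eq by exact v_pos. apply exp_le. nra.
  - apply Rle_trans with (1 * exp (v * Re z)).
    + apply Rmult_le_compat_r; [apply Rlt_le, exp_pos|apply Rabs_phi_exp_le_neg; lra].
    + rewrite Rmult_1_l, Rabs_left by lra. apply exp_le. nra.
Qed.

Lemma is_Mellin_phi_reflect (z l : C) : is_Mellin phi z l -> is_Mellin phi (RtoC (/ 2) - z) l.
Proof.
  intros Hl. replace (RtoC (/ 2) - z)%C with (- z + RtoC (/ 2))%C by ring.
  apply is_Mellin_sqrt, (is_Mellin_ext (fun u => phi (/ u))); [exact phi_inv|].
  now apply is_Mellin_reflect.
Qed.

Definition psi (x : R) : R := omega x - 2 * omega (4 * x).

Lemma psi_phi (x : R) : 0 < x -> psi x = phi x - 2 * phi (4 * x).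
Proof.
  intros x_pos. unfold psi, phi. assert (sqrt_pos := sqrt_lt_R0 x x_pos).
  rewrite sqrt_mult by lra. replace (sqrt 4) with 2; [field; lra|].
  replace 4 with (2 * 2) by ring. symmetry. apply sqrt_square. lra.
Qed.

Definition theta_pair (x : R) (m : nat) : R := theta_term x (2 * m) - theta_term x (S (2 * m)).

(* The terms [e^(-pi (2 n)^2 x)] of [omega x] make up [omega (4 x)]. *)
Lemma is_series_psi (x : R) : 0 < x -> is_series (theta_pair x) (psi x).
Proof.
  intros x_pos.
  assert (pairs := is_series_pairs (V := R_NormedModule) _ _ (is_series_omega x x_pos)).
  assert (evens := is_series_scal (V := R_NormedModule) 2 _ _ (is_series_omega (4 * x) ltac:(lra))).
  refine (is_series_ext _ _ _ _ (is_series_minus (V := R_NormedModule) _ _ _ _ pairs evens)).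
  intros m. unfold theta_pair.
  replace (theta_term (4 * x) m) with (theta_term x (S (2 * m))).
  - unfold plus, opp, scal; simpl. unfold mult; simpl. ring.
  - unfold theta_term. do 2 f_equal. rewrite !S_INR, mult_INR. simpl. ring.
Qed.

Lemma theta_term_decr (x : R) (n : nat) : 0 < x -> theta_term x (S n) <= theta_term x n.
Proof.
  intros x_pos. assert (PI_pos := PI_RGT_0). assert (n_pos := pos_INR n).
  apply exp_le. rewrite !S_INR. apply Ropp_le_contravar, Rmult_le_compat_l; nra.
Qed.

Lemma Rabs_psi_remainder_le (x : R) (N : nat) : 0 < x ->
  Rabs (psi x - sum_n (theta_pair x) N) <= theta_term x (2 * S N).
Proof.
  intros x_pos.
  apply (norm_remainder_telescoping_le (V := R_NormedModule) (theta_pair x)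
    (fun m => theta_term x (2 * m)) (psi x) N).
  - intros m. unfold norm; simpl. unfold abs; simpl. unfold theta_pair.
    assert (first_le := theta_term_decr x (2 * m) x_pos).
    assert (second_le := theta_term_decr x (S (2 * m)) x_pos).
    rewrite Rabs_pos_eq by lra.
    replace (m + S (m + 0))%nat with (S (2 * m)) by lia. simpl in *. lra.
  - apply (filterlim_eventually_subseq (U := R_UniformSpace) (theta_term x) 0 (fun m => 2 * m)%nat);
      [intros; lia|].
    apply ex_series_lim_0. eexists. now apply is_series_omega.
  - now apply is_series_psi.
Qed.

Lemma Rcpow_mult_base (a b : R) (z : C) : 0 < a -> 0 < b -> Rcpow (a * b) z = (Rcpow a z * Rcpow b z)%C.
Proof.
  intros a_pos b_pos. unfold Rcpow. rewrite <- cexp_plus, ln_mult, RtoC_plus by assumption. f_equal. ring.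
Qed.

Definition gamma_factor (s : C) : C := (Rcpow PI (- (s / 2)) * CGamma (s / 2))%C.

Lemma Re_Cdiv_2 (s : C) : Re (s / 2)%C = Re s / 2.
Proof. destruct s. simpl. field. Qed.

Lemma is_Mellin_theta_term (s : C) (n : nat) : 0 < Re s ->
  is_Mellin (fun x => theta_term x n) (s / 2) (gamma_factor s * Rcpow (INR (S n)) (- s))%C.
Proof.
  intros Hs. assert (PI_pos := PI_RGT_0). assert (n_pos := lt_0_INR (S n) (Nat.lt_0_succ n)).
  assert (sqr_pos := Rmult_lt_0_compat _ _ n_pos n_pos).
  replace (gamma_factor s * Rcpow (INR (S n)) (- s))%C
    with (Rcpow (PI * (INR (S n) * INR (S n))) (- (s / 2)) * CGamma (s / 2))%C.
  - apply (is_Mellin_ext (fun x => exp (- (PI * (INR (S n) * INR (S n)) * x)))).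
    + intros x _. unfold theta_term. do 2 f_equal. ring.
    + apply (is_Mellin_scale (PI * (INR (S n) * INR (S n))) (fun u => exp (- u)));
        [now apply Rmult_lt_0_compat|].
      apply is_Mellin_CGamma. rewrite Re_Cdiv_2. lra.
  - rewrite !Rcpow_mult_base by assumption. unfold gamma_factor.
    replace (Rcpow (INR (S n)) (- s))
      with (Rcpow (INR (S n)) (- (s / 2)) * Rcpow (INR (S n)) (- (s / 2)))%C;
      [ring|].
    unfold Rcpow. rewrite <- cexp_plus. f_equal. field.
Qed.

Lemma Cmod_psi_Mellin_remainder_le (s l : C) (N : nat) : 0 < Re s -> is_Mellin psi (s / 2) l ->
  Cmod (l - gamma_factor s * Csum_n (eta_pair s) N)%C <=
  Cmod (gamma_factor (RtoC (Re s)) * Rcpow (INR (S (2 * S N))) (- RtoC (Re s)))%C.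
Proof.
  intros Hs Hl. rewrite <- Csum_n_Cmult.
  apply (Cmod_Mellin_le (fun x => psi x - sum_n (fun m => theta_pair x m) N)
    (fun x => theta_term x (2 * S N)) (s / 2)).
  - intros x x_pos. now apply Rabs_psi_remainder_le.
  - apply is_Mellin_minus; [exact Hl|]. apply (is_Mellin_sum_n (fun m x => theta_pair x m)). intros m.
    replace (gamma_factor s * eta_pair s m)%C with
      (gamma_factor s * Rcpow (INR (S (2 * m))) (- s)
        - gamma_factor s * Rcpow (INR (S (S (2 * m)))) (- s))%C
      by (unfold eta_pair; ring).
    now apply is_Mellin_minus; apply is_Mellin_theta_term.
  - rewrite Re_Cdiv_2, RtoC_div by lra. now apply is_Mellin_theta_term.
Qed.

Lemma psi_Mellin (s l : C) : 0 < Re s -> is_Mellin psi (s / 2) l -> (gamma_factor s * eta s)%C = l.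
Proof.
  intros Hs Hl.
  apply (filterlim_locally_unique (V := C_NormedModule) (F := eventually)
    (fun N => gamma_factor s * Csum_n (eta_pair s) N)%C).
  - apply filterlim_Cmult; [apply filterlim_const|now apply is_series_eta_pair].
  - intros P HP. apply locally_Cmod in HP. destruct HP as (eps & eps_pos & HP).
    set (bound := fun n => (gamma_factor (RtoC (Re s)) * Rcpow (INR (S n)) (- RtoC (Re s)))%C).
    assert (bound_lim : filterlim bound eventually (locally (T := C_UniformSpace) (RtoC 0))).
    { rewrite <- (Cmult_0_r (gamma_factor (RtoC (Re s)))).
      apply filterlim_Cmult; [apply filterlim_const|now apply eta_terms_lim]. }
    apply (filterlim_eventually_subseq bound _ (fun N => (2 * S N)%nat)) in bound_lim; [|intros; lia].
    assert (bound_small : eventually (fun N => Cmod (bound (2 * S N)%nat) < eps)).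
    { apply (bound_lim (fun w => Cmod w < eps)), locally_Cmod. exists eps. split; [exact eps_pos|].
      intros w. unfold Cminus. now rewrite Copp_0, Cplus_0_r. }
    revert bound_small. unfold filtermap. apply filter_imp.
    intros N small. apply HP. rewrite Cmod_Cminus_sym.
    eapply Rle_lt_trans; [now apply Cmod_psi_Mellin_remainder_le|exact small].
Qed.

Lemma phi_Mellin (s l : C) : 0 < Re s < 1 -> is_Mellin phi (s / 2) l -> (gamma_factor s * zeta s)%C = l.
Proof.
  intros Hs Hl. assert (den_neq_0 := zeta_denominator_neq_0 s (proj2 Hs)).
  assert (psi_transform : is_Mellin psi (s / 2) (l - RtoC 2 * (Rcpow 4 (- (s / 2)) * l))%C).
  { apply (is_Mellin_ext (fun x => phi x - 2 * phi (4 * x))); [intros x x_pos; now rewrite psi_phi|].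
    apply is_Mellin_minus; [exact Hl|]. apply is_Mellin_scal, is_Mellin_scale; [lra|exact Hl]. }
  apply psi_Mellin in psi_transform; [|lra].
  replace (l - RtoC 2 * (Rcpow 4 (- (s / 2)) * l))%C with ((1 - Rcpow 2 (1 - s)) * l)%C in psi_transform.
  - unfold zeta. transitivity (gamma_factor s * eta s / (1 - Rcpow 2 (1 - s)))%C; [field; exact den_neq_0|].
    rewrite psi_transform. field. exact den_neq_0.
  - replace (Rcpow 2 (1 - s)) with (RtoC 2 * Rcpow 4 (- (s / 2)))%C; [ring|].
    replace (RtoC 2 * Rcpow 4 (- (s / 2)))%C with (cexp (RtoC (ln 2)) * Rcpow (2 * 2) (- (s / 2)))%C
      by (rewrite cexp_RtoC, exp_ln by lra; do 2 f_equal; ring).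
    unfold Rcpow. rewrite <- cexp_plus, ln_mult, RtoC_plus by lra. f_equal. field.
Qed.

Lemma zeta_functional_equation (s : C) : 0 < Re s < 1 ->
  (gamma_factor s * zeta s)%C = (gamma_factor (1 - s) * zeta (1 - s))%C.
Proof.
  intros Hs. destruct (ex_Mellin_phi (s / 2)) as [l Hl]; [rewrite Re_Cdiv_2; lra|].
  rewrite (phi_Mellin s l Hs Hl). symmetry. apply phi_Mellin.
  - change (Re (1 - s)%C) with (1 - Re s). lra.
  - replace ((1 - s) / 2)%C with (RtoC (/ 2) - s / 2)%C by (rewrite RtoC_inv by lra; field).
    now apply is_Mellin_phi_reflect.
Qed.

(** * The Riemann-Siegel phase *)

Lemma RtoC_2_neq_0 : RtoC 2 <> RtoC 0.
Proof. apply RtoC_neq_0. lra. Qed.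

Lemma Cconj_Cdiv_2 (z : C) : Cconj (z / 2)%C = (Cconj z / 2)%C.
Proof. rewrite Cdiv_conj by exact RtoC_2_neq_0. now rewrite Cconj_RtoC. Qed.

Lemma gamma_factor_conj (s : C) : 0 < Re s -> gamma_factor (Cconj s) = Cconj (gamma_factor s).
Proof.
  intros Hs. unfold gamma_factor.
  rewrite Cmult_conj, <- Rcpow_conj, Copp_conj, Cconj_Cdiv_2, <- CGamma_conj, Cconj_Cdiv_2; [reflexivity|].
  rewrite Re_Cdiv_2. lra.
Qed.

Lemma eq_1_of_sqr_eq_1_path (q : R -> C) :
  (forall u, 0 <= u <= 1 -> continuous (U := C_UniformSpace) q u) ->
  (forall u, 0 <= u <= 1 -> (q u * q u)%C = RtoC 1) -> q 0 = RtoC 1 -> q 1 = RtoC 1.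
Proof.
  intros q_cont q_sqr q_0.
  assert (q_sign : forall u, 0 <= u <= 1 -> q u = RtoC 1 \/ q u = RtoC (- (1))).
  { intros u Hu. destruct (Cmult_integral (q u - 1)%C (q u + 1)%C) as [E|E].
    - replace ((q u - 1) * (q u + 1))%C with (q u * q u - 1)%C by ring. rewrite q_sqr by exact Hu. ring.
    - left. now apply Ceq_minus.
    - right. rewrite RtoC_opp. apply Ceq_minus. rewrite <- E. ring. }
  destruct (q_sign 1 ltac:(lra)) as [E|q_1]; [exact E|exfalso].
  destruct (Ranalysis5.IVT_interv (fun u => - Re (q u)) 0 1) as [u [Hu re_0]].
  - intros u Hu. apply continuity_pt_filterlim, (continuous_opp (V := R_NormedModule) (fun u => Re (q u))).
    apply (continuous_comp q (fun z : C => fst z)); [now apply q_cont|apply continuous_fst].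
  - lra.
  - rewrite q_0. simpl. lra.
  - rewrite q_1. simpl. lra.
  - destruct (q_sign u Hu) as [E|E]; rewrite E in re_0; simpl in re_0; lra.
Qed.

Definition zeta_arg (z : C) : C := (RtoC (/ 2) + Ci * z)%C.

Lemma Re_zeta_arg (z : C) : Re (zeta_arg z) = / 2 - Im z.
Proof. destruct z. simpl. ring. Qed.

Lemma zeta_arg_conj (z : C) : zeta_arg (Cconj z) = Cconj (1 - zeta_arg z)%C.
Proof. unfold zeta_arg. Ccomponents; field. Qed.

Lemma strip_zeta_arg (z : C) : strip z -> 0 < Re (zeta_arg z) < 1.
Proof. intros Hz. rewrite Re_zeta_arg. apply Rabs_lt_between in Hz. lra. Qed.

Lemma strip_conj (z : C) : strip z -> strip (Cconj z).
Proof. unfold strip. now rewrite im_conj, Rabs_Ropp. Qed.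

Lemma continuous_Cconj {T : UniformSpace} (f : T -> C) (x : T) :
  continuous (U := C_UniformSpace) f x -> continuous (U := C_UniformSpace) (fun y => Cconj (f y)) x.
Proof.
  intros Hf. apply (continuous_comp f Cconj); [exact Hf|].
  exact (linear_cont (U := C_R_NormedModule) (V := C_R_NormedModule) Cconj (f x) is_linear_Cconj).
Qed.

Lemma ex_Cderive_zeta_arg (z : C) : ex_Cderive zeta_arg z.
Proof.
  apply ex_Cderive_plus; [apply ex_Cderive_const|].
  apply ex_Cderive_mult; [apply ex_Cderive_const|apply ex_Cderive_id].
Qed.

Section RiemannSiegel.

Variable th : C -> C.
Hypothesis th_spec : is_RS_theta th.

Definition phase (z : C) : C := cexp (Ci * th z)%C.

Lemma ex_Cderive_phase (z : C) : strip z -> ex_Cderive phase z.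
Proof.
  intros Hz. apply ex_Cderive_cexp, ex_Cderive_mult; [apply ex_Cderive_const|]. now apply th_spec.
Qed.

(* The nonvanishing of Gamma is read off the defining equation of theta, whose left-hand side
   is an exponential and whose right-hand side is [0] when the denominator is. *)
Lemma phase_sqr (z : C) : strip z ->
  gamma_factor (zeta_arg z) <> RtoC 0 /\ gamma_factor (1 - zeta_arg z)%C <> RtoC 0 /\
  (phase z * phase z)%C = (gamma_factor (zeta_arg z) / gamma_factor (1 - zeta_arg z))%C.
Proof.
  intros Hz. destruct th_spec as (_ & _ & th_eq). specialize (th_eq z Hz).
  fold (phase z) in th_eq.
  replace (RtoC (/ 4) + Ci * z / RtoC 2)%C with (zeta_arg z / 2)%C in th_eq
    by (unfold zeta_arg; Ccomponents; field).
  replace (RtoC (/ 4) - Ci * z / RtoC 2)%C with ((1 - zeta_arg z) / 2)%C in th_eq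
    by (unfold zeta_arg; Ccomponents; field).
  assert (phase_neq_0 : (phase z * phase z)%C <> RtoC 0) by (apply Cmult_neq_0; apply cexp_neq_0).
  assert (num_neq_0 : CGamma (zeta_arg z / 2)%C <> RtoC 0).
  { intros E. apply phase_neq_0. rewrite th_eq, E. unfold Cdiv. ring. }
  assert (den_neq_0 : CGamma ((1 - zeta_arg z) / 2)%C <> RtoC 0).
  { intros E. apply phase_neq_0. rewrite th_eq, E. unfold Cdiv. rewrite Cinv_0. ring. }
  assert (left_neq_0 := cexp_neq_0 (- (zeta_arg z / 2) * RtoC (ln PI))).
  assert (right_neq_0 := cexp_neq_0 (- ((1 - zeta_arg z) / 2) * RtoC (ln PI))).
  unfold gamma_factor. split; [now apply Cmult_neq_0|]. split; [now apply Cmult_neq_0|].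
  rewrite th_eq.
  replace (Rcpow PI (- (Ci * z)))
    with (Rcpow PI (- (zeta_arg z / 2)) / Rcpow PI (- ((1 - zeta_arg z) / 2)))%C.
  - unfold Rcpow. field. repeat split; assumption.
  - unfold Rcpow, zeta_arg. rewrite <- cexp_minus. f_equal. rewrite RtoC_inv by lra. field.
Qed.

Lemma phase_sqr_zeta (z : C) : strip z ->
  (phase z * phase z * zeta (zeta_arg z))%C = zeta (1 - zeta_arg z)%C.
Proof.
  intros Hz. destruct (phase_sqr z Hz) as (num_neq_0 & den_neq_0 & sqr_eq). rewrite sqr_eq.
  assert (functional := zeta_functional_equation _ (strip_zeta_arg z Hz)).
  transitivity (gamma_factor (zeta_arg z) * zeta (zeta_arg z) / gamma_factor (1 - zeta_arg z))%C.
  - field. exact den_neq_0.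
  - rewrite functional. field. exact den_neq_0.
Qed.

Lemma phase_conj_sqr (z : C) : strip z ->
  (phase z * Cconj (phase (Cconj z)) * (phase z * Cconj (phase (Cconj z))))%C = RtoC 1.
Proof.
  intros Hz. destruct (phase_sqr z Hz) as (num_neq_0 & den_neq_0 & sqr_eq).
  destruct (phase_sqr (Cconj z) (strip_conj z Hz)) as (_ & conj_den_neq_0 & conj_sqr_eq).
  assert (Re_arg := strip_zeta_arg z Hz).
  transitivity ((phase z * phase z) * Cconj (phase (Cconj z) * phase (Cconj z)))%C;
    [rewrite Cmult_conj; ring|].
  rewrite sqr_eq, conj_sqr_eq, Cdiv_conj by exact conj_den_neq_0.
  rewrite zeta_arg_conj.
  replace (1 - Cconj (1 - zeta_arg z))%C with (Cconj (zeta_arg z)) by (Ccomponents; ring).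
  rewrite !gamma_factor_conj, !Cconj_conj by (rewrite ?Re_Cminus; simpl in *; lra).
  field. split; assumption.
Qed.

Lemma phase_conj (z : C) : strip z -> (phase z * Cconj (phase (Cconj z)))%C = RtoC 1.
Proof.
  intros Hz. set (q := fun u : R => (phase (RtoC u * z) * Cconj (phase (Cconj (RtoC u * z))))%C).
  assert (path_strip : forall u, 0 <= u <= 1 -> strip (RtoC u * z)%C).
  { intros u Hu. unfold strip in *. rewrite im_scal_l, Rabs_mult, Rabs_pos_eq by lra.
    assert (abs_pos := Rabs_pos (Im z)). nra. }
  replace (phase z * Cconj (phase (Cconj z)))%C with (q 1) by (unfold q; now rewrite Cmult_1_l).
  apply eq_1_of_sqr_eq_1_path.
  - intros u Hu.
    assert (path_cont : continuous (U := C_UniformSpace) (fun u => RtoC u * z)%C u).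
    { apply continuous_Cmult; [apply continuous_RtoC|apply continuous_const]. }
    apply continuous_Cmult; [|apply continuous_Cconj].
    + apply (continuous_comp (fun u => RtoC u * z)%C phase); [exact path_cont|].
      now apply ex_Cderive_continuous, ex_Cderive_phase, path_strip.
    + apply (continuous_comp (fun u => Cconj (RtoC u * z))%C phase); [now apply continuous_Cconj|].
      now apply ex_Cderive_continuous, ex_Cderive_phase, strip_conj, path_strip.
  - intros u Hu. now apply phase_conj_sqr, path_strip.
  - unfold q. rewrite Cmult_0_l, Cconj_RtoC. destruct th_spec as (_ & th_0 & _).
    unfold phase. rewrite th_0, Cmult_0_r, cexp_0, Cconj_RtoC. ring.
Qed.

Definition Hardy_Z (z : C) : C := (phase z * zeta (zeta_arg z))%C.

Lemma ex_Cderive_Hardy_Z (z : C) : strip z -> ex_Cderive Hardy_Z z.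
Proof.
  intros Hz. apply ex_Cderive_mult; [now apply ex_Cderive_phase|].
  apply (ex_Cderive_comp zeta_arg zeta); [apply ex_Cderive_zeta_arg|].
  now apply ex_Cderive_zeta, strip_zeta_arg.
Qed.

Lemma Hardy_Z_conj (z : C) : strip z -> Hardy_Z (Cconj z) = Cconj (Hardy_Z z).
Proof.
  intros Hz. assert (Re_arg := strip_zeta_arg z Hz). unfold Hardy_Z.
  rewrite zeta_arg_conj, zeta_conj by (rewrite Re_Cminus; simpl in *; lra).
  rewrite <- (phase_sqr_zeta z Hz), !Cmult_conj.
  assert (conj_eq := phase_conj (Cconj z) (strip_conj z Hz)). rewrite Cconj_conj in conj_eq.
  transitivity (phase (Cconj z) * Cconj (phase z) * (Cconj (phase z) * Cconj (zeta (zeta_arg z))))%C; [ring|].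
  rewrite conj_eq. ring.
Qed.

Lemma Hardy_Z_sqr (z : C) : strip z ->
  (Hardy_Z z * Hardy_Z z)%C = (zeta (zeta_arg z) * zeta (1 - zeta_arg z))%C.
Proof. intros Hz. rewrite <- phase_sqr_zeta by exact Hz. unfold Hardy_Z. ring. Qed.

(* The identity [Hardy_Z_sqr] controls the growth of [Hardy_Z] without any estimate for Gamma. *)
Lemma Cmod_Hardy_Z_le (z : C) (d : R) : 0 < d -> Rabs (Im z) <= / 2 - d ->
  Cmod (Hardy_Z z) <= (Cmod z + 1) / d / (exp (d * ln 2) - 1).
Proof.
  intros d_pos Hz. assert (z_strip : strip z) by (unfold strip; lra).
  apply Rabs_le_between in Hz. assert (Re_arg := Re_zeta_arg z).
  assert (exp_gt_1 := exp_ln_2_gt_1 d d_pos).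
  set (B := (Cmod z + 1) / d / (exp (d * ln 2) - 1)).
  assert (zeta_le : forall s, Cmod s <= Cmod z + 1 -> d <= Re s <= 1 - d -> Cmod (zeta s) <= B).
  { intros s s_le Re_s. eapply Rle_trans; [apply (Cmod_zeta_le s d); lra|].
    unfold B. apply Rmult_le_compat_r; [now apply Rlt_le, Rinv_0_lt_compat|].
    apply Rmult_le_compat_r; [now apply Rlt_le, Rinv_0_lt_compat|exact s_le]. }
  assert (left_le : Cmod (zeta (zeta_arg z)) <= B).
  { apply zeta_le; [|lra]. eapply Rle_trans; [apply Cmod_triangle|].
    rewrite Cmod_mult, Cmod_Ci, Cmod_R, Rabs_pos_eq; lra. }
  assert (right_le : Cmod (zeta (1 - zeta_arg z)%C) <= B).
  { apply zeta_le; [|rewrite Re_Cminus; simpl in *; lra].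
    replace (1 - zeta_arg z)%C with (RtoC (/ 2) - Ci * z)%C by (unfold zeta_arg; Ccomponents; field).
    eapply Rle_trans; [apply Cmod_Cminus_le|]. rewrite Cmod_mult, Cmod_Ci, Cmod_R, Rabs_pos_eq; lra. }
  assert (sqr_le : Cmod (Hardy_Z z) * Cmod (Hardy_Z z) <= B * B).
  { rewrite <- Cmod_mult, Hardy_Z_sqr, Cmod_mult by exact z_strip.
    apply Rmult_le_compat; auto using Cmod_ge_0. }
   assert (B_pos := Rle_trans _ _ _ (Cmod_ge_0 _) left_le).
  apply Rnot_lt_le. intros Hlt. nra.
Qed.

End RiemannSiegel.

(** * The contour shift *)

Lemma ex_CRInt_line_exp_decay_outside (f : R -> C) (K c : R) : 0 < c ->
  (forall x, continuous (U := C_UniformSpace) f x) ->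
  (forall x, 1 <= Rabs x -> Cmod (f x) <= K * exp (- (c * Rabs x))) -> exists l, is_CRInt_line f l.
Proof.
  intros c_pos f_cont f_decay.
  destruct (Cmod_bounded_segment f (- (1)) 1) as (M & M_pos & f_le); [auto|].
  apply (ex_CRInt_line_exp_decay f (Rmax K (M * exp c)) c c_pos f_cont). intros x.
  assert (exp_pos_x := exp_pos (- (c * Rabs x))). destruct (Rle_dec 1 (Rabs x)) as [x_large|x_small].
  - eapply Rle_trans; [now apply f_decay|]. apply Rmult_le_compat_r; [lra|apply Rmax_l].
  - apply Rle_trans with (M * exp c * exp (- (c * Rabs x))).
    + rewrite Rmult_assoc, <- exp_plus.
      assert (exp_ge_1 : 1 <= exp (c + - (c * Rabs x))).
      { rewrite <- exp_0. apply exp_le. nra. }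
      assert (f_x_le : Cmod (f x) <= M) by (apply f_le, Rabs_le_between; lra). nra.
    + apply Rmult_le_compat_r; [lra|apply Rmax_r].
Qed.

Definition sinh_denominator (x : C) : C := (RtoC 2 * csinh (RtoC PI * x / RtoC 2))%C.

Lemma sinh_denominator_cexp (x : C) :
  sinh_denominator x = (cexp (RtoC (PI / 2) * x) - cexp (RtoC (- (PI / 2)) * x))%C.
Proof.
  unfold sinh_denominator, csinh. rewrite RtoC_opp, RtoC_div by lra.
  replace (- (RtoC PI / RtoC 2) * x)%C with (- (RtoC PI * x / RtoC 2))%C by field.
  replace (RtoC PI / RtoC 2 * x)%C with (RtoC PI * x / RtoC 2)%C by field. field.
Qed.

Lemma sinh_denominator_conj (x : C) : sinh_denominator (Cconj x) = Cconj (sinh_denominator x).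
Proof. now rewrite !sinh_denominator_cexp, Cminus_conj, !cexp_conj, !Cmult_conj, !Cconj_RtoC. Qed.

Lemma is_Cderive_sinh_denominator (x : C) : is_Cderive sinh_denominator x
  (RtoC (PI / 2) * cexp (RtoC (PI / 2) * x) - RtoC (- (PI / 2)) * cexp (RtoC (- (PI / 2)) * x))%C.
Proof.
  apply (is_derive_ext (V := C_NormedModule)
    (fun x => cexp (RtoC (PI / 2) * x) - cexp (RtoC (- (PI / 2)) * x))%C).
  { intros w. symmetry. apply sinh_denominator_cexp. }
  apply (is_derive_minus (V := C_NormedModule) (fun x => cexp (RtoC (PI / 2) * x)%C)
    (fun x => cexp (RtoC (- (PI / 2)) * x)%C)); apply is_Cderive_cexp_scal.
Qed.

Lemma is_Cderive_sinh_denominator_0 : is_Cderive sinh_denominator (RtoC 0) (RtoC PI).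
Proof.
  assert (derivative := is_Cderive_sinh_denominator (RtoC 0)).
  rewrite !Cmult_0_r, cexp_0, !Cmult_1_r, <- RtoC_minus in derivative.
  now replace (PI / 2 - - (PI / 2)) with PI in derivative by field.
Qed.

Lemma sinh_denominator_0 : sinh_denominator (RtoC 0) = RtoC 0.
Proof. rewrite sinh_denominator_cexp, !Cmult_0_r. ring. Qed.

Lemma sinh_denominator_neq_0 (x : C) : Rabs (Im x) <= 1 -> x <> RtoC 0 -> sinh_denominator x <> RtoC 0.
Proof.
  intros Hx x_neq_0 kernel_0. apply x_neq_0. assert (PI_pos := PI_RGT_0). apply Rabs_le_between in Hx.
  rewrite sinh_denominator_cexp in kernel_0. apply Ceq_minus in kernel_0.
  assert (double : cexp (RtoC PI * x) = RtoC 1).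
  { replace (RtoC PI * x)%C with (RtoC (PI / 2) * x - RtoC (- (PI / 2)) * x)%C
      by (Ccomponents; field).
    rewrite cexp_minus, kernel_0. apply Cinv_r, cexp_neq_0. }
  apply cexp_eq_1_small in double; [|rewrite im_scal_l; nra].
  destruct (Cmult_integral _ _ double) as [E|E]; [exfalso|exact E].
  apply RtoC_inj in E. lra.
Qed.

Lemma Cmod_sinh_denominator_ge (u y : R) : 1 <= Rabs u ->
  exp (Rabs u) <= 2 * Cmod (sinh_denominator (u, y)).
Proof.
  intros Hu. assert (PI_gt_1 := PI2_1). set (a := PI / 2 * Rabs u).
  assert (kernel_ge : exp a - exp (- a) <= Cmod (sinh_denominator (u, y))).
  { rewrite sinh_denominator_cexp.
    assert (left := Cmod_cexp (RtoC (PI / 2) * (u, y))). rewrite re_scal_l in left.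
    assert (right := Cmod_cexp (RtoC (- (PI / 2)) * (u, y))). rewrite re_scal_l in right.
    simpl in left, right. unfold a. destruct (Rle_dec 0 u) as [u_pos|u_neg].
    - rewrite Rabs_pos_eq by exact u_pos. rewrite Ropp_mult_distr_l, <- left, <- right.
      unfold Cminus. rewrite <- (Cmod_opp (cexp (RtoC (- (PI / 2)) * (u, y)))). apply Cmod_Cplus_ge.
    - rewrite Rabs_left, <- Ropp_mult_distr_r, Ropp_involutive, Ropp_mult_distr_l, <- left, <- right
        by lra.
      rewrite Cmod_Cminus_sym. unfold Cminus.
      rewrite <- (Cmod_opp (cexp (RtoC (PI / 2) * (u, y)))). apply Cmod_Cplus_ge. }
  assert (a_ge : Rabs u <= a) by (unfold a; nra).
  assert (exp_ge := exp_ineq1_le a).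
  assert (exp_opp_le : exp (- a) <= 1) by (rewrite <- exp_0; apply exp_le; lra).
  assert (exp_a_ge := exp_le _ _ a_ge). lra.
Qed.

Lemma Im_RtoC_plus (t : R) (x : C) : Im (RtoC t + x)%C = Im x.
Proof. destruct x. simpl. ring. Qed.

Section ContourShift.

Variable th : C -> C.
Hypothesis th_spec : is_RS_theta th.
Variables t sigma : R.
Hypothesis sigma_range : 0 < sigma < / 2.

Definition contour_integrand (x : C) : C := (Hardy_Z th (RtoC t + x) * RtoC PI / sinh_denominator x)%C.

Lemma strip_shift (x : C) : Rabs (Im x) <= sigma -> strip (RtoC t + x)%C.
Proof. intros Hx. unfold strip. rewrite Im_RtoC_plus. lra. Qed.

Lemma ex_Cderive_contour_numerator (x : C) : Rabs (Im x) <= sigma ->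
  ex_Cderive (fun x => Hardy_Z th (RtoC t + x) * RtoC PI)%C x.
Proof.
  intros Hx. apply ex_Cderive_mult; [|apply ex_Cderive_const].
  apply (ex_Cderive_comp (fun x => RtoC t + x)%C (Hardy_Z th)).
  - apply ex_Cderive_plus; [apply ex_Cderive_const|apply ex_Cderive_id].
  - now apply ex_Cderive_Hardy_Z, strip_shift.
Qed.

Lemma continuous_contour_integrand (x : C) : Rabs (Im x) <= sigma -> x <> RtoC 0 ->
  Ccontinuous contour_integrand x.
Proof.
  intros Hx x_neq_0. apply ex_Cderive_continuous, ex_Cderive_div.
  - now apply ex_Cderive_contour_numerator.
  - eexists. apply is_Cderive_sinh_denominator.
  - apply sinh_denominator_neq_0; [lra|exact x_neq_0].
Qed.

Lemma contour_integrand_decay : exists K, forall u y, 1 <= Rabs u -> Rabs y <= sigma ->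
  Cmod (contour_integrand (u, y)) <= K * exp (- (/ 2 * Rabs u)).
Proof.
  set (d := / 2 - sigma). assert (d_pos : 0 < d) by (unfold d; lra).
  assert (exp_gt_1 := exp_ln_2_gt_1 d d_pos). assert (PI_pos := PI_RGT_0).
  set (B := / d / (exp (d * ln 2) - 1)).
  assert (B_pos : 0 < B) by (apply Rmult_lt_0_compat; now apply Rinv_0_lt_compat).
  exists (2 * (Rabs t + 2) * B * PI * 2). intros u y Hu Hy.
  assert (kernel_ge := Cmod_sinh_denominator_ge u y Hu). assert (exp_u_pos := exp_pos (Rabs u)).
  unfold contour_integrand. rewrite Cmod_div by (apply Cmod_gt_0; lra).
  apply Rle_div_l; [lra|]. rewrite Cmod_mult, Cmod_R, (Rabs_pos_eq PI) by lra.
  apply Rle_trans with (2 * (Rabs t + 2) * exp (/ 2 * Rabs u) * B * PI).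
  - apply Rmult_le_compat_r; [lra|].
    eapply Rle_trans;
      [apply (Cmod_Hardy_Z_le th th_spec _ d d_pos); rewrite Im_RtoC_plus; unfold d; simpl; lra|].
    replace ((Cmod (RtoC t + (u, y)) + 1) / d / (exp (d * ln 2) - 1))
      with ((Cmod (RtoC t + (u, y)) + 1) * B) by (unfold B; field; lra).
    apply Rmult_le_compat_r; [lra|].
    assert (exp_ge := exp_ineq1_le (/ 2 * Rabs u)). assert (t_pos := Rabs_pos t).
    assert (triangle := Cmod_triangle (RtoC t) (u, y)). rewrite Cmod_R in triangle.
    assert (mod_le := Cmod_le_Rabs_Re_Im (u, y)). simpl in mod_le. nra.
  - replace (exp (/ 2 * Rabs u)) with (exp (- (/ 2 * Rabs u)) * exp (Rabs u))
      by (rewrite <- exp_plus; f_equal; field).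
    assert (factor_pos : 0 <= 2 * (Rabs t + 2) * B * PI * exp (- (/ 2 * Rabs u))).
    { assert (exp_half_pos := exp_pos (- (/ 2 * Rabs u))). assert (t_pos := Rabs_pos t).
      apply Rmult_le_pos; [apply Rmult_le_pos; [apply Rmult_le_pos|]|]; lra. }
    nra.
Qed.

Lemma ex_CRInt_contour_lower : exists l, is_CRInt_line (fun u => contour_integrand (u, - sigma)) l.
Proof.
  assert (abs_sigma : Rabs (- sigma) <= sigma) by (rewrite Rabs_Ropp, Rabs_pos_eq; lra).
  destruct contour_integrand_decay as [K decay].
  apply (ex_CRInt_line_exp_decay_outside _ K (/ 2)); [lra| |].
  - intros u. apply continuous_horizontal, continuous_contour_integrand; [exact abs_sigma|].
    intros E. apply (f_equal Im) in E. simpl in E. lra.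
  - intros u Hu. now apply decay.
Qed.

Lemma contour_integrand_conj (x : C) : Rabs (Im x) <= sigma -> x <> RtoC 0 ->
  contour_integrand (Cconj x) = Cconj (contour_integrand x).
Proof.
  intros Hx x_neq_0. unfold contour_integrand.
  rewrite Cdiv_conj by (apply sinh_denominator_neq_0; [lra|exact x_neq_0]).
  rewrite sinh_denominator_conj, Cmult_conj, Cconj_RtoC, <- Hardy_Z_conj
    by (exact th_spec || now apply strip_shift).
  now rewrite Cplus_conj, Cconj_RtoC.
Qed.

Lemma is_CRInt_contour_upper (l : C) : is_CRInt_line (fun u => contour_integrand (u, - sigma)) l ->
  is_CRInt_line (fun u => contour_integrand (u, sigma)) (Cconj l).
Proof.
  intros Hl. refine (is_CRInt_line_ext _ _ _ _ (is_CRInt_line_conj _ _ Hl)).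
  intros u. rewrite <- contour_integrand_conj.
  - unfold Cconj. simpl. now rewrite Ropp_involutive.
  - simpl. rewrite Rabs_Ropp, Rabs_pos_eq; lra.
  - intros E. apply (f_equal Im) in E. simpl in E. lra.
Qed.

Lemma rect_int_contour (T : R) : 0 < T ->
  rect_int contour_integrand (- T) T (- sigma) sigma = (RtoC (2 * PI) * Ci * Hardy_Z th (RtoC t))%C.
Proof.
  intros T_pos. assert (PI_neq_0 : RtoC PI <> RtoC 0) by apply RtoC_neq_0, PI_neq0.
  unfold contour_integrand.
  rewrite (rect_int_simple_pole (fun x => Hardy_Z th (RtoC t + x) * RtoC PI)%C sinh_denominator
    (RtoC 0) (RtoC PI)).
  - rewrite Cplus_0_r. field. exact PI_neq_0.
  - simpl. lra.
  - simpl. lra.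
  - intros x [_ Hy]. now apply ex_Cderive_contour_numerator, Rabs_le.
  - intros x _. eexists. apply is_Cderive_sinh_denominator.
  - intros x [_ Hy] x_neq_0. apply sinh_denominator_neq_0; [|exact x_neq_0]. apply Rabs_le. lra.
  - exact is_Cderive_sinh_denominator_0.
  - exact sinh_denominator_0.
  - exact PI_neq_0.
Qed.

Lemma contour_lower_minus_conj (l : C) : is_CRInt_line (fun u => contour_integrand (u, - sigma)) l ->
  (l - Cconj l)%C = (RtoC (2 * PI) * Ci * Hardy_Z th (RtoC t))%C.
Proof.
  intros Hl. destruct contour_integrand_decay as [K decay].
  apply (filterlim_locally_unique (V := C_NormedModule) (F := eventually)
    (fun n => rect_int contour_integrand (- (INR n + 1)) (INR n + 1) (- sigma) sigma)).
  - assert (T_ge_1 : forall n, 1 <= INR n + 1) by (intros n; assert (n_pos := pos_INR n); lra).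
    apply (rect_int_lim_lines contour_integrand _ _ _ _ (fun n => INR n + 1) K (/ 2)); try lra.
    + intros n. specialize (T_ge_1 n). lra.
    + apply is_lim_seq_INR_plus.
    + exact Hl.
    + now apply is_CRInt_contour_upper.
    + intros n x y Hx Hy. apply continuous_contour_integrand; [now apply Rabs_le|].
      intros E. apply (f_equal Re) in E. simpl in E. subst x. rewrite Rabs_R0 in Hx.
      specialize (T_ge_1 n). lra.
    + intros n x y Hx Hy. apply decay; [rewrite Hx; apply T_ge_1|now apply Rabs_le].
  - apply (filterlim_ext (fun _ => (RtoC (2 * PI) * Ci * Hardy_Z th (RtoC t))%C)); [|apply filterlim_const].
    intros n. symmetry. apply rect_int_contour. assert (n_pos := pos_INR n). lra.
Qed.

Lemma phase_mult_U (l : C) : is_CRInt_line (fun u => contour_integrand (u, - sigma)) l ->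
  (cexp (Ci * th (RtoC t)) * U th sigma t)%C = (l / (RtoC (2 * PI) * Ci))%C.
Proof.
  intros Hl. unfold U. set (c := cexp (Ci * th (RtoC t))).
  assert (c_neq_0 : c <> RtoC 0) by apply cexp_neq_0.
  rewrite (is_RInt_gen_unique (V := C_R_CompleteNormedModule) _ (/ c * l)%C).
  - assert (two_pi_i_nz := two_pi_i_neq_0). set (two_pi_i := (RtoC (2 * PI) * Ci)%C) in *.
    field. split; assumption.
  - refine (is_CRInt_line_ext _ _ _ _ (is_CRInt_line_Cmult (/ c) _ _ Hl)). intros u.
    rewrite cexp_minus. unfold contour_integrand, Hardy_Z, phase, sinh_denominator, zeta_arg, Cdiv.
    fold c. ring.
Qed.

End ContourShift.

Theorem mainTheorem1 :
  forall (th : C -> C), is_RS_theta th ->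
  forall (sigma : R), 0 < sigma < / 2 ->
  forall t : R,
    Zfun th t = RtoC (2 * Re (cexp (Ci * th (RtoC t)) * U th sigma t)%C).
Proof.
  intros th th_spec sigma sigma_range t.
  destruct (ex_CRInt_contour_lower th th_spec t sigma sigma_range) as [l Hl].
  assert (jump := contour_lower_minus_conj th th_spec t sigma sigma_range l Hl).
  rewrite (phase_mult_U th t sigma l Hl). change (Zfun th t) with (Hardy_Z th (RtoC t)).
  replace (Hardy_Z th (RtoC t)) with ((l - Cconj l) / (RtoC (2 * PI) * Ci))%C.
  - assert (PI_pos := PI_RGT_0). destruct l as [x y]. Ccomponents; field; lra.
  - rewrite jump. assert (two_pi_i_nz := two_pi_i_neq_0). set (two_pi_i := (RtoC (2 * PI) * Ci)%C) in *.
    field. exact two_pi_i_nz.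
Qed.
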